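(* For every $\alpha$ with $0<\alpha\le 0.46$, the map $G_\alpha$ admits an absolutely continuous invariant probability measure (with respect to two-dimensional Lebesgue measure on $[0,1]^2$).
   Context: Let $\tau:[0,1]\to[0,1]$ be the symmetric tent map, $\tau(x)=2x$ for $0\le x<1/2$ and $\tau(x)=2-2x$ for $1/2\le x\le 1$. For $0<\alpha<1$ define $G_\alpha:[0,1]^2\to[0,1]^2$ by $G_\alpha(x,y)=(y,\tau(\alpha y+(1-\alpha)x))$. *)

(* Defs.v *)
From Stdlib Require Import Reals.
Open Scope R_scope.

Definition tau (x : R) : R :=
  if Rlt_dec x (1/2) then 2 * x else 2 - 2 * x.

Definition G (alpha : R) (p : R * R) : R * R :=
  (snd p, tau (alpha * snd p + (1 - alpha) * fst p)).

Definition set2 := R * R -> Prop.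

Definition unit_square : set2 :=
  fun p => 0 <= fst p <= 1 /\ 0 <= snd p <= 1.

Inductive borel : set2 -> Prop :=
| borel_rect (a b c d : R) :
    borel (fun p => a < fst p < b /\ c < snd p < d)
| borel_compl (A : set2) : borel A -> borel (fun p => ~ A p)
| borel_union (F : nat -> set2) :
    (forall n, borel (F n)) -> borel (fun p => exists n, F n p)
| borel_ext (A B : set2) : borel A -> (forall p, A p <-> B p) -> borel B.

Definition lebesgue_null (A : set2) : Prop :=
  forall eps, 0 < eps ->
  exists a b c d : nat -> R,
    (forall n, a n <= b n /\ c n <= d n) /\
    (forall p, A p -> exists n,
        a n <= fst p <= b n /\ c n <= snd p <= d n) /\
    (forall N, sum_f_R0 (fun n => (b n - a n) * (d n - c n)) N <= eps).

Definition borel_prob_on_square (mu : set2 -> R) : Prop :=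
  (forall A, borel A -> 0 <= mu A) /\
  (forall F : nat -> set2,
      (forall n, borel (F n)) ->
      (forall m n p, m <> n -> F m p -> F n p -> False) ->
      infinite_sum (fun n => mu (F n)) (mu (fun p => exists n, F n p))) /\
  mu (fun _ => True) = 1 /\
  mu unit_square = 1.

Definition abs_continuous (mu : set2 -> R) : Prop :=
  forall A, borel A -> lebesgue_null A -> mu A = 0.

(* invariance under T : [0,1]^2 -> [0,1]^2 : mu(T^{-1} A) = mu(A) *)
Definition invariant (T : R * R -> R * R) (mu : set2 -> R) : Prop :=
  forall A, borel A ->
    mu (fun p => unit_square p /\ A (T p)) = mu A.

Definition has_acip (T : R * R -> R * R) : Prop :=
  exists mu : set2 -> R,
    borel_prob_on_square mu /\ abs_continuous mu /\ invariant T mu.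

(* Main.v *)
(** On either side of the line {a y + (1 - a) x = 1/2} the map G = G_a is affine with Jacobian
    determinant of absolute value d = 2(1 - a) > 1.

    Contraction. On a forward invariant set Lam, the inverses of the derivatives of G^n are bounded
    by C th^n with th < 1. Long runs of minuses contract the quadratic form [quad]; for the other
    words, the parameter interval is cut into cells, and for each of them a finite tree of words
    that contract a polyhedral norm was found by computer search and is checked by computation:
    branches are pruned when Farkas' lemma shows that the word does not occur.

    Strips. Let X = [9/10, 1]^2, which lies in Lam. The area of the points p of X whose n-th image
    is at distance at most delta from the critical line is at most K delta, uniformly in n. By
    induction on n: moving p so that its n-th image moves transversally to the critical line
    produces about 1/delta disjoint translates, unless the orbit of a translate crosses the line
    some time before n. As an inverse branch of G^k contracts, a crossing k steps before n forces
    that image to be th^k delta-close to the line, which the induction hypothesis controls if k is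
    large; for the finitely many small k, the preimages of the critical line form finitely many
    lines near it, and a direction which avoids them is chosen in each chamber that they cut out.

    Measure. Hence, outside an area O(eps), the cylinder of p in X is mapped by G^n onto a set
    containing the box of radius eps about G^n p, so that comparing areas in the cylinder gives
    |{p in X : G^n p in A}| <= M eps + |A| / (4 eps^2), uniformly in n. A generalized limit of the
    Cesaro means of the push-forwards of area on X is finitely additive and invariant, and this
    bound makes it countably additive and absolutely continuous. *)

(* The fixed point (0, 0) of the plus branch is a saddle as soon as a > 1/4, so long runs of pluses
   do not contract; contraction can only be expected on a forward invariant set that avoids this
   point, which is the role of [Lam]. The derivative of the minus branch has complex eigenvalues of
   modulus sqrt d: it is sqrt d times a rotation for [quad]. In the strip estimate, the induction
   closes only if the recursive term keeps a factor below 1, however many lines pass near a point.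
   Therefore the chambers are swept inside pairwise disjoint sets: the loss is counted once, not
   once per chamber. Only a factor 4 remains, from the two sides of the critical line and from the
   points far from or close to the vertices. The choice of constants looks circular: a crossing k
   steps back costs about T th^k if the directions have slope at most T, while T has to exceed the
   slopes of the lines to be avoided. The way out is that lines of slope at least T are crossed at a
   cost independent of T. So T is fixed by the words of length at most K0, and only then is K1
   chosen, beyond which contraction alone suffices. *)
Require Import Defs.
From Stdlib Require Import Reals.

(** * Area *)

Module Area.
From HB Require Import structures.
From mathcomp Require Import all_boot all_order all_algebra.
From mathcomp Require Import all_classical all_reals all_analysis.
From mathcomp Require Import measurable_realfun.
From mathcomp Require Import Rstruct Rstruct_topology.
Import Order.TTheory GRing.Theory Num.Theory numFieldNormedType.Exports.
Local Open Scope classical_set_scope.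
Local Open Scope ring_scope.

(** * Lebesgue measure under affine maps and shears *)

Section Shear.
Variable (K : realType).
Notation leb := (@lebesgue_measure K).
Notation mu2 := (leb \x leb)%E.

Lemma measurable_affine1 (e c : K) :
  measurable_fun setT (fun x : K => (e * x + c : K)).
Proof.
by apply: measurable_funD => //; exact: measurable_funM.
Qed.

Lemma leb_affine (e c : K) (A : set (K)) : e != 0 -> measurable A ->
  (leb ((fun x => e * x + c)%R @^-1` A) = `|e|^-1%:E * leb A)%E.
Proof.
move=> e0 mA.
have ne : (0 < `|e|)%R by rewrite normr_gt0.
pose f : measurableTypeR K -> measurableTypeR K := fun x => e * x + c.
have mf : measurable_fun setT f by exact: measurable_affine1.
pose k : {nonneg K} := NngNum (normr_ge0 e).
pose m1 : {measure set (measurableTypeR K) -> \bar K} :=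
  measure_function_pushforward__canonical__measure_function_Measure leb mf.
pose m2 : {measure set (measurableTypeR K) -> \bar K} := mscale k m1.
(* Both sides are measures in [A], so half-open intervals decide; a negative [e] exchanges the ends
   of an interval and keeps its length. *)
have H : leb A = (`|e|%:E * leb (f @^-1` A))%E.
  change (leb A = m2 A).
  have := @lebesgue_measure_unique K m2.
  move=> /(_ _ A mA); apply => _ [[a b]] _ <-.
  change (leb [set` `]a, b]] = (`|e|%:E * leb (f @^-1` [set` `]a, b]]))%E).
  have [e_gt0|e_le0] := ltP 0%R e.
    have -> : f @^-1` [set` `]a, b]] = [set` `](a - c) / e, (b - c) / e]].
      apply/seteqP; split => x /=; rewrite !in_itv /= /f;
      rewrite ltr_pdivrMr // ler_pdivlMr // ltrBlDr lerBrDr (mulrC x) //.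
    rewrite !lebesgue_measure_itv /= !lte_fin ltr_pM2r ?invr_gt0 // ltrD2r.
    case: ifP => // _; last by rewrite mule0.
    rewrite gtr0_norm // -EFinD -EFinD -EFinM; congr (_%:E).
    by rewrite -mulrBl opprB addrA subrK mulrC divfK.
  have {e_le0}e_lt0 : (e < 0)%R by rewrite lt_neqAle e0.
  have -> : f @^-1` [set` `]a, b]] = [set` `[(b - c) / e, (a - c) / e[].
    apply/seteqP; split => x /=; rewrite !in_itv /= /f;
    rewrite ltr_ndivlMr // ler_ndivrMr // ltrBlDr lerBrDr (mulrC x) andbC //.
  rewrite !lebesgue_measure_itv /= !lte_fin ltr_nM2r ?invr_lt0 // ltrD2r.
  case: ifP => // _; last by rewrite mule0.
  rewrite ltr0_norm // -EFinD -EFinD -EFinM; congr (_%:E).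
  by rewrite -mulrBl opprB addrA subrK mulNr mulrC divfK // opprB.
rewrite H muleA -EFinM mulVf ?mul1e //.
by rewrite normr_eq0.
Qed.

Notation KR := (measurableTypeR K).

(** Each branch of [G] has this form, with [e] and [f] equal to 2(1 - a) and 2a up to a common
    sign. *)
Definition shear (e f g : K) (p : KR * KR) : KR * KR := (p.2, e * p.1 + f * p.2 + g).

Lemma measurable_shear e f g : measurable_fun setT (shear e f g).
Proof.
apply/measurable_fun_pairP; split; first exact: measurable_snd.
have m1 : measurable_fun setT (fst : KR * KR -> KR) by exact: measurable_fst.
have m2 : measurable_fun setT (snd : KR * KR -> KR) by exact: measurable_snd.
by apply: measurable_funD => //; apply: measurable_funD; apply: measurable_funM.
Qed.

(** A horizontal section of the preimage is an affine preimage of a vertical section of [X]. Hence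
    the left side is integrated in the other order before the two integrands are compared. *)
Lemma mu2_shear (e f g : K) (X : set (KR * KR)) : e != 0 -> measurable X ->
  (mu2 (shear e f g @^-1` X) = `|e|^-1%:E * mu2 X)%E.
Proof.
move=> e0 mX.
have mY : measurable (shear e f g @^-1` X).
  by rewrite -[X in measurable X]setTI; apply: measurable_shear.
have -> : mu2 (shear e f g @^-1` X) = (leb \x^ leb)%E (shear e f g @^-1` X).
  by apply: product_measure_unique => //= A B mA mB; exact: product_measure2E.
rewrite /product_measure2 /product_measure1 -ge0_integralZl //; last exact: measurable_fun_xsection.
apply: eq_integral => y _ /=.
rewrite -(leb_affine e (f * y + g)) //; last exact: measurable_xsection.
congr (leb _); apply/seteqP; split => x /=;
 rewrite /ysection /xsection /= !inE /shear /= ?addrA //.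
Qed.

End Shear.

Local Notation RR := (measurableTypeR R).
Definition mu2 : set (RR * RR) -> \bar R := (@lebesgue_measure R \x @lebesgue_measure R)%E.
HB.instance Definition _ := Measure.on mu2.

Definition meas (A : set2) : Prop := measurable (A : set (RR * RR)).
(** Cut down to the square so that every measurable set has finite area and real arithmetic
    applies. *)
Definition area (A : set2) : R := fine (mu2 ((A : set (RR * RR)) `&` unit_square)).

Lemma meas_ext (A B : set2) : meas A -> (forall p, A p <-> B p) -> meas B.
Proof. by move=> mA /predeqP AB; rewrite /meas -AB. Qed.

Lemma meas_compl (A : set2) : meas A -> meas (fun p => ~ A p).
Proof. exact: measurableC. Qed.

Lemma meas_and (A B : set2) : meas A -> meas B -> meas (fun p => A p /\ B p).
Proof. exact: measurableI. Qed.

Lemma meas_or (A B : set2) : meas A -> meas B -> meas (fun p => A p \/ B p).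
Proof. exact: measurableU. Qed.

Lemma meas_ex (F : nat -> set2) : (forall n, meas (F n)) -> meas (fun p => exists n, F n p).
Proof.
move=> mF; have : measurable (\bigcup_n (F n : set (RR * RR))) by exact: bigcupT_measurable.
move/meas_ext; apply => p; split; last by move=> [n Fn]; exists n.
by move=> [n _ Fn]; exists n.
Qed.

Lemma meas_const (P : Prop) : meas (fun _ => P).
Proof.
have [p|np] := pselect P.
  by apply: (@meas_ext setT); [exact: measurableT|move=> q; split].
by apply: (@meas_ext set0); [exact: measurable0|move=> q; split].
Qed.

Lemma meas_le (a b c : R) : meas (fun p => a * fst p + b * snd p <= c)%coqR.
Proof.
have m1 : measurable_fun setT (fst : RR * RR -> RR) by exact: measurable_fst.
have m2 : measurable_fun setT (snd : RR * RR -> RR) by exact: measurable_snd.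
have mf : measurable_fun setT (fun p : RR * RR => a * p.1 + b * p.2 : RR).
  by apply: measurable_funD; apply: measurable_funM.
have := mf measurableT `]-oo, c]%classic (measurable_itv _).
rewrite setTI => /meas_ext; apply => p /=.
by rewrite in_itv /=; split => /RleP.
Qed.

Lemma meas_shear (A : set2) (e f g : R) : meas A ->
  meas (fun p => A (snd p, e * fst p + f * snd p + g)%coqR).
Proof.
move=> mA; rewrite /meas.
have := @measurable_shear R e f g measurableT A mA.
by rewrite setTI.
Qed.

Lemma mu2_rect (a b c d : R) : (a <= b)%coqR -> (c <= d)%coqR ->
  mu2 (fun p => (a <= fst p <= b /\ c <= snd p <= d)%coqR) = ((b - a) * (d - c))%coqR%:E.
Proof.
move=> /RleP ab /RleP cd.
have -> : (fun p => (a <= fst p <= b /\ c <= snd p <= d)%coqR)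
   = ([set` `[a, b]] : set RR) `*` ([set` `[c, d]] : set RR).
  apply/predeqP => -[x y] /=; rewrite !in_itv /=; split.
    by move=> [[/RleP -> /RleP ->] [/RleP -> /RleP ->]].
  by move=> [/andP[/RleP ? /RleP ?] /andP[/RleP ? /RleP ?]].
have -> : mu2 ([set` `[a, b]] `*` [set` `[c, d]]) =
   (@lebesgue_measure R `[a, b] * @lebesgue_measure R `[c, d])%E.
  by apply: product_measure1E.
rewrite !lebesgue_measure_itv /= !lte_fin.
have E (x y : R) : x <= y -> (if x < y then (y%:E - x%:E)%E else 0%E) = (y - x)%:E.
  by rewrite le_eqVlt => /orP[/eqP ->|->//]; rewrite ltxx subrr.
by rewrite !E.
Qed.

Lemma mu2_sq : mu2 unit_square = 1%:E.
Proof.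
have /mu2_rect H : (0 <= 1)%coqR by apply/RleP; exact: ler01.
have /H H1 : (0 <= 1)%coqR by apply/RleP; exact: ler01.
by rewrite [LHS]H1 Rminus_0_r Rmult_1_r.
Qed.

Lemma meas_sq : meas unit_square.
Proof.
have H : meas (fun p => (((0 * fst p + -1 * snd p <= 0) /\ (0 * fst p + 1 * snd p <= 1)) /\
  ((-1 * fst p + 0 * snd p <= 0) /\ (1 * fst p + 0 * snd p <= 1)))%coqR).
  by do 2?apply: meas_and; exact: meas_le.
apply: (meas_ext _ _ H) => -[x y] /=; rewrite /unit_square /=.
by split => [[[? ?] [? ?]]|[[? ?] [? ?]]]; repeat split; Lra.lra.
Qed.

Lemma borel_meas (A : set2) : borel A -> meas A.
Proof.
elim=> {A} [a b c d|A _ IH|F _ IH|A B _ IH AB].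
- have H : meas (fun p => ((~ (1 * fst p + 0 * snd p <= a) /\ ~ (-1 * fst p + 0 * snd p <= - b)) /\
    (~ (0 * fst p + 1 * snd p <= c) /\ ~ (0 * fst p + -1 * snd p <= - d)))%coqR).
    by do 2?apply: meas_and; apply: meas_compl; exact: meas_le.
  apply: (meas_ext _ _ H) => -[x y] /=.
  by split => [[[? ?] [? ?]]|[[? ?] [? ?]]]; repeat split; Lra.lra.
- exact: meas_compl.
- exact: meas_ex.
- exact: meas_ext IH AB.
Qed.

Lemma mu2_fin (A : set2) : meas A -> mu2 ((A : set (RR * RR)) `&` unit_square) \is a fin_num.
Proof.
move=> mA; rewrite ge0_fin_numE ?measure_ge0 //.
apply: (@le_lt_trans _ _ (mu2 unit_square)); last by rewrite mu2_sq ltry.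
by apply: le_measure; rewrite ?inE //; [apply: measurableI => //|];
  exact: meas_sq.
Qed.

Lemma areaE (A : set2) : meas A -> mu2 ((A : set (RR * RR)) `&` unit_square) = (area A)%:E.
Proof. by move=> mA; rewrite /area fineK // mu2_fin. Qed.

Lemma area_ge0 (A : set2) : (0 <= area A)%coqR.
Proof. by apply/RleP; rewrite /area fine_ge0. Qed.

Lemma area_mono (A B : set2) : meas A -> meas B ->
  (forall p, unit_square p -> A p -> B p) -> (area A <= area B)%coqR.
Proof.
move=> mA mB AB; apply/RleP; rewrite -lee_fin -!areaE //.
apply: le_measure; rewrite ?inE //; try by apply: measurableI => //; exact: meas_sq.
by move=> p [Ap sp]; split => //; exact: AB.
Qed.

Lemma area_sq : area unit_square = 1%coqR.
Proof. by rewrite /area setIid mu2_sq. Qed.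

Lemma area_or (A B : set2) : meas A -> meas B -> (forall p, A p -> B p -> False) ->
  area (fun p => A p \/ B p) = (area A + area B)%coqR.
Proof.
move=> mA mB AB; apply: EFin_inj; rewrite EFinD -!areaE //; last by apply: meas_or.
rewrite -[X in mu2 X = _]/((A `|` B) `&` unit_square) setIUl measureU //.
- by apply: measurableI => //; exact: meas_sq.
- by apply: measurableI => //; exact: meas_sq.
- by rewrite -subset0 => p [[Ap _] [Bp _]]; exact: AB Ap Bp.
Qed.

Lemma area_sigma (F : nat -> set2) : (forall n, meas (F n)) ->
  (forall m n p, m <> n -> F m p -> F n p -> False) ->
  infinite_sum (fun n => area (F n)) (area (fun p => exists n, F n p)).
Proof.
move=> mF dF.
pose H n : set (RR * RR) := (F n : set (RR * RR)) `&` unit_square.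
have mH n : measurable (H n) by apply: measurableI; [exact: mF|exact: meas_sq].
have tH : trivIset setT H.
  move=> i j _ _ [p [[Fi _] [Fj _]]]; apply/eqP/negPn/negP => /eqP ij.
  exact: dF ij Fi Fj.
have UH : mu2 (\bigcup_n H n) = (area (fun p => exists n, F n p))%:E.
  rewrite -(areaE _ (meas_ex _ mF)).
  congr (mu2 _); apply/predeqP => p; split.
    by move=> [n _ [Fn sp]]; split => //; exists n.
  by move=> [[n Fn] sp]; exists n.
have : ((fun n => (\sum_(0 <= i < n) mu2 (H i))%E) @ \oo --> mu2 (\bigcup_n H n)).
  by apply: measure_semi_sigma_additive => //; exact: bigcupT_measurable.
rewrite UH.
have -> : (fun n => (\sum_(0 <= i < n) mu2 (H i))%E) =
   (fun n => (\sum_(0 <= i < n) area (F i))%:E).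
  by apply/funext => n; rewrite -sumEFin; apply: eq_bigr => i _; rewrite areaE.
move/fine_cvgP => [_ /cvgrPdist_lt Hc] e /RltP e0.
have [N _ HN] := Hc _ e0.
exists N => n /ssrnat.leP nN.
rewrite sum_f_R0E RdistE distrC.
by apply/RltP; apply: (HN n.+1) => /=; exact: leqW.
Qed.

Lemma mu2_shearR (A : set2) (e f g : R) : e <> 0%coqR -> meas A ->
  mu2 (fun p => A (snd p, e * fst p + f * snd p + g)%coqR) = ((Rabs e)^-1%:E * mu2 A)%E.
Proof. by move=> /eqP e0 mA; rewrite RabsE -(mu2_shear R e f g A). Qed.

(** Only an inequality, as part of the preimage may lie outside the square. *)
Lemma area_shear_le (A : set2) (e f g : R) : e <> 0%coqR -> meas A ->
  (forall p, A p -> unit_square p) ->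
  (area (fun p => A (snd p, e * fst p + f * snd p + g)) <= area A / Rabs e)%coqR.
Proof.
move=> e0 mA As; apply/RleP; rewrite -lee_fin -areaE; last exact: meas_shear.
rewrite RdivE mulrC EFinM -areaE // (setIidl As) -(mu2_shearR A e f g e0 mA).
by apply: le_measure; rewrite ?inE //; [apply: measurableI; [exact: meas_shear|exact: meas_sq]|exact: meas_shear].
Qed.

Lemma area_shear (A : set2) (e f g : R) : e <> 0%coqR -> meas A ->
  (forall p, A p -> unit_square p) ->
  (forall p, A (snd p, e * fst p + f * snd p + g)%coqR -> unit_square p) ->
  area (fun p => A (snd p, e * fst p + f * snd p + g)%coqR) = (area A / Rabs e)%coqR.
Proof.
move=> e0 mA As Bs; apply: EFin_inj; rewrite -areaE; last exact: meas_shear.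
rewrite (setIidl Bs) mu2_shearR // RdivE mulrC EFinM -areaE // (setIidl As) //.
Qed.

Lemma meas_translate (A : set2) (v : R * R) : meas A ->
  meas (fun p => A (fst p + fst v, snd p + snd v)%coqR).
Proof.
move=> mA; apply: (meas_ext _ _ (meas_shear _ 1 0 (fst v) (meas_shear A 1 0 (snd v) mA))).
move=> -[x y] /=.
suff -> : (1 * x + 0 * y + fst v)%coqR = (x + fst v)%coqR by
  suff -> : (1 * y + 0 * (x + fst v) + snd v)%coqR = (y + snd v)%coqR by []; Lra.lra.
Lra.lra.
Qed.

Lemma area_translate (A : set2) (v : R * R) : meas A ->
  (forall p, A p -> unit_square p) ->
  (forall p, A (fst p + fst v, snd p + snd v)%coqR -> unit_square p) ->
  area (fun p => A (fst p + fst v, snd p + snd v)%coqR) = area A.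
Proof.
move=> mA As Bs; apply: EFin_inj; rewrite -areaE; last exact: meas_translate.
rewrite -areaE // (setIidl Bs) (setIidl As).
have n0 : (1 <> 0)%coqR by exact: R1_neq_R0.
have := mu2_shearR _ 1 0 (fst v) n0 (meas_shear A 1 0 (snd v) mA).
rewrite mu2_shearR // Rabs_R1 invr1 !mul1e => <-.
congr (mu2 _); apply/funext => -[x y] /=.
suff -> : (1 * x + 0 * y + fst v)%coqR = (x + fst v)%coqR by
  suff -> : (1 * y + 0 * (x + fst v) + snd v)%coqR = (y + snd v)%coqR by []; Lra.lra.
Lra.lra.
Qed.

Lemma meas_rect (a b c d : R) :
  meas (fun p => a <= fst p <= b /\ c <= snd p <= d)%coqR.
Proof.
have H : meas (fun p => (((-1 * fst p + 0 * snd p <= - a) /\ (1 * fst p + 0 * snd p <= b)) /\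
    ((0 * fst p + -1 * snd p <= - c) /\ (0 * fst p + 1 * snd p <= d)))%coqR).
  by do 2?apply: meas_and; exact: meas_le.
apply: (meas_ext _ _ H) => -[x y] /=.
by split => [[[? ?] [? ?]]|[[? ?] [? ?]]]; repeat split; Lra.lra.
Qed.

Lemma area_rect_le (a b c d : R) : (a <= b)%coqR -> (c <= d)%coqR ->
  (area (fun p => a <= fst p <= b /\ c <= snd p <= d) <= (b - a) * (d - c))%coqR.
Proof.
move=> ab cd; apply/RleP; rewrite -lee_fin -areaE -?mu2_rect //; last exact: meas_rect.
by apply: le_measure; rewrite ?inE //; [apply: measurableI; [exact: meas_rect|exact: meas_sq]|exact: meas_rect].
Qed.

Lemma area_rect (a b c d : R) : (0 <= a <= b)%coqR -> (b <= 1)%coqR ->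
  (0 <= c <= d)%coqR -> (d <= 1)%coqR ->
  area (fun p => a <= fst p <= b /\ c <= snd p <= d)%coqR = ((b - a) * (d - c))%coqR.
Proof.
move=> [a0 ab] b1 [c0 cd] d1; apply: EFin_inj; rewrite -areaE -?mu2_rect //; last exact: meas_rect.
congr (mu2 _); apply: setIidl => -[x y] /= [[? ?] [? ?]].
by rewrite /unit_square /=; repeat split; Lra.lra.
Qed.

Lemma area_null (A : set2) : meas A -> lebesgue_null A -> area A = 0%coqR.
Proof.
move=> mA nA; apply: Rle_antisym; last exact: area_ge0.
apply: Rnot_lt_le => A0.
have [a [b [c [d [abcd [cov tot]]]]]] := nA (area A / 2)%coqR ltac:(Lra.lra).
pose F n : set (RR * RR) := (fun p => a n <= fst p <= b n /\ c n <= snd p <= d n)%coqR.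
have mF n : measurable (F n) by exact: meas_rect.
have H : (mu2 ((A : set (RR * RR)) `&` unit_square) <= \sum_(n <oo) mu2 (F n))%E.
  apply: measure_sigma_subadditive => //.
  - by apply: measurableI => //; exact: meas_sq.
  - by move=> p [/cov [n Fn] _]; exists n.
have E n : mu2 (F n) = ((b n - a n) * (d n - c n))%coqR%:E.
  by rewrite mu2_rect //; have [] := abcd n.
have : (\sum_(n <oo) mu2 (F n) <= (area A / 2)%coqR%:E)%E.
  apply: lime_le; first by apply: is_cvg_nneseries => n _ _; exact: measure_ge0.
  apply: nearW => -[|n].
    rewrite big_nil lee_fin; apply/RleP; change (0 <= area A / 2)%coqR; Lra.lra.
  rewrite (eq_bigr _ (fun i _ => E i)) sumEFin lee_fin; apply/RleP.
  by rewrite -(sum_f_R0E (fun n => ((b n - a n) * (d n - c n))%coqR)); exact: tot.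
move/(le_trans H); rewrite areaE // lee_fin => /RleP; Lra.lra.
Qed.

(** The limit along an ultrafilter finer than the filter at infinity; it exists for bounded
    sequences because segments are compact. *)
Lemma bounded_ultralimit (K : realType) : exists LIM : (nat -> K) -> K,
  [/\ (forall u v M, (forall n, `|u n| <= M) -> (forall n, `|v n| <= M) ->
        LIM (fun n => u n + v n) = LIM u + LIM v),
      (forall u a b, (forall n, a <= u n <= b) -> a <= LIM u <= b) &
      (forall u v M, (forall n, `|u n| <= M) -> (forall n, `|v n| <= M) ->
        (u n - v n @[n --> \oo] --> 0) -> LIM u = LIM v)].
Proof.
have [U [UU sU]] := ultraFilterLemma (F := \oo) _.
have UP : ProperFilter U := ultra_proper.
have cv (u : nat -> K) M : (forall n, `|u n| <= M) -> u @ U --> lim (u @ U).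
  move=> uM.
  have UuU : UltraFilter (u @ U).
    split; first exact: fmap_proper_filter.
    move=> G PG uG; apply/predeqP => A; split; last exact: uG.
    move=> GA; have [//|UA] := in_ultra_setVsetC (u @^-1` A) UU.
    have GcA : G (~` A) by exact: uG.
    by have /filter_ex [? []] : G (A `&` ~` A) by exact: filterI.
  have := @segment_compact K (- M) M; rewrite compact_ultra => /(_ (u @ U) UuU).
  case=> [|p [_ pu]].
    apply: (@filterS _ U _ setT) => [n _|]; last exact: filterT.
    by rewrite /= in_itv /= -ler_norml.
  by apply/cvg_ex; exists p.
exists (fun u => lim (u @ U)); split.
- move=> u v M uM vM; apply: cvg_lim => //.
  by apply: cvgD; [exact: cv uM|exact: cv vM].
- move=> u a b uab.
  have uM n : `|u n| <= `|a| + `|b|.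
    have /andP[au ub] := uab n.
    rewrite ler_norml; apply/andP; split.
      by rewrite opprD; apply: le_trans au; rewrite lerBlDr ler_wpDr // lerNl -normrN ler_norm.
    by apply: (le_trans ub); rewrite ler_wpDl // ler_norm.
  apply/andP; split; [apply: limr_ge|apply: limr_le]; (try exact: cv uM);
    by apply: nearW => n; have /andP[] := uab n.
- move=> u v M uM vM uv.
  have duv : u n - v n @[n --> U] --> (0 : K).
    by move=> A /uv; exact: sU.
  have duv' : u n - v n @[n --> U] --> lim (u @ U) - lim (v @ U).
    by apply: cvgB; [exact: cv uM|exact: cv vM].
  by apply/eqP; rewrite -subr_eq0; apply/eqP; exact: (cvg_unique _ duv' duv).
Qed.

Lemma generalized_limit : exists LIM : (nat -> R) -> R,
  (forall u v M, (forall n, Rabs (u n) <= M)%coqR -> (forall n, Rabs (v n) <= M)%coqR ->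
        LIM (fun n => u n + v n)%coqR = (LIM u + LIM v)%coqR) /\
  (forall u a b, (forall n, a <= u n <= b)%coqR -> (a <= LIM u <= b)%coqR) /\
  (forall u v M, (forall n, Rabs (u n) <= M)%coqR -> (forall n, Rabs (v n) <= M)%coqR ->
        Un_cv (fun n => u n - v n)%coqR 0 -> LIM u = LIM v).
Proof.
have [LIM [HD Hle Hcv]] := bounded_ultralimit R.
have b (u : nat -> R) M : (forall n, Rabs (u n) <= M)%coqR -> forall n, `|u n| <= M.
  by move=> H n; rewrite -RabsE; apply/RleP.
exists LIM; split=> [u v M /b uM /b vM|]; first exact: HD uM vM.
split=> [u a c uac|u v M /b uM /b vM uv].
  have /andP[/RleP ? /RleP ?] : a <= LIM u <= c.
    by apply: Hle => n; have [/RleP -> /RleP ->] := uac n.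
  by split.
apply: Hcv uM vM _; apply/cvgrPdist_lt => e /RltP /uv [N HN].
exists N => // n /= /ssrnat.leP /HN; rewrite RdistE distrC => /RltP.
by [].
Qed.

End Area.
Import Area.

From Stdlib Require Import ZArith List Bool FinFun Lra Lia Psatz Classical.
Import ListNotations.
Open Scope R_scope.

(** * Dynamics *)

Definition level (a : R) (p : R * R) : R := a * snd p + (1 - a) * fst p.
Definition det (a : R) : R := 2 * (1 - a).
Definition plus (a : R) (p : R * R) : bool := if Rlt_dec (level a p) (1/2) then true else false.
Definition sign (b : bool) : R := if b then 1 else -1.

(** With s = [sign b], the inverse of the matrix with rows (0, 1) and (2(1 - a)s, 2as), which is the
    derivative of [G] on one branch. *)
Definition dinv (a : R) (b : bool) (v : R * R) : R * R :=
  ((sign b * snd v - 2 * a * fst v) / det a, fst v).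

Fixpoint iterG (a : R) (n : nat) (p : R * R) : R * R :=
  match n with
  | O => p
  | S n' => iterG a n' (G a p)
  end.

(* [back a n p] is the inverse of the derivative of [G a ^ n] at [p]. *)
Fixpoint back (a : R) (n : nat) (p : R * R) (v : R * R) : R * R :=
  match n with
  | O => v
  | S n' => dinv a (plus a p) (back a n' (G a p) v)
  end.

Definition norm1 (v : R * R) : R := Rabs (fst v) + Rabs (snd v).

(** The bound on [level] keeps orbits away from the fixed point (0, 0). Of the two alternatives, the
    first is produced by a minus and the second by a plus. *)
Definition Lam (a : R) (p : R * R) : Prop :=
  unit_square p /\ 2 * a ^ 2 <= level a p /\
  (2 * a * (1 - fst p) <= snd p \/ 4 * a ^ 2 <= snd p).

Lemma G_plus (a : R) (p : R * R) : plus a p = true -> G a p = (snd p, 2 * level a p).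
Proof.
unfold plus, G, tau; change (a * snd p + (1 - a) * fst p) with (level a p).
destruct (Rlt_dec (level a p) (1 / 2)); easy.
Qed.

Lemma G_minus (a : R) (p : R * R) : plus a p = false -> G a p = (snd p, 2 - 2 * level a p).
Proof.
unfold plus, G, tau; change (a * snd p + (1 - a) * fst p) with (level a p).
destruct (Rlt_dec (level a p) (1 / 2)); easy.
Qed.

Lemma plus_true (a : R) (p : R * R) : plus a p = true -> level a p < 1 / 2.
Proof. unfold plus; destruct (Rlt_dec (level a p) (1 / 2)); easy. Qed.

Lemma plus_false (a : R) (p : R * R) : plus a p = false -> 1 / 2 <= level a p.
Proof. unfold plus; destruct (Rlt_dec (level a p) (1 / 2)); [easy|lra]. Qed.

Lemma iterG_succ (a : R) (n : nat) (p : R * R) : iterG a (S n) p = G a (iterG a n p).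
Proof. revert p; induction n as [|n IH]; intros p; [easy|]. exact (IH (G a p)). Qed.

Lemma iterG_add (a : R) (m n : nat) (p : R * R) : iterG a (m + n) p = iterG a n (iterG a m p).
Proof. revert p; induction m as [|m IH]; intros p; [easy|]. exact (IH (G a p)). Qed.

Lemma back_add (a : R) (m n : nat) (p v : R * R) :
  back a (m + n) p v = back a m p (back a n (iterG a m p) v).
Proof. revert p; induction m as [|m IH]; intros p; [easy|]. simpl. now rewrite IH. Qed.

Section Dynamics.
Variable a : R.
Hypotheses (a_pos : 0 < a) (a_lt : a < 1 / 2).

Lemma det_bounds : 1 < det a < 2.
Proof. unfold det; lra. Qed.

Lemma G_square (p : R * R) : unit_square p -> unit_square (G a p).
Proof.
intros [[h1 h2] [h3 h4]]; unfold unit_square.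
destruct (plus a p) eqn:e.
- rewrite (G_plus _ _ e); apply plus_true in e; unfold level in *; simpl; nra.
- rewrite (G_minus _ _ e); apply plus_false in e; unfold level in *; simpl; nra.
Qed.

Lemma G_Lam (p : R * R) : Lam a p -> Lam a (G a p).
Proof.
intros [sq [lv H]]; split; [now apply G_square|].
destruct p as [x y]; destruct sq as [[x0 x1] [y0 y1]]; cbn [fst snd] in *.
destruct (plus a (x, y)) eqn:e.
- rewrite (G_plus _ _ e); apply plus_true in e; unfold level in *; cbn [fst snd] in *.
  split; [|right; nra].
  destruct H as [H|H].
  + assert (2 * a * (1 - x) * (2 * a ^ 2 + 1 - a) <= y * (2 * a ^ 2 + 1 - a)) by (apply Rmult_le_compat_r; nra).
    assert (0 <= (1 - x) * (2 * a * (1 - a) - 2 * a ^ 2 + 4 * a ^ 3)).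
    { apply Rmult_le_pos; [lra|]. assert (0 <= a * (1 - 2 * a)) by nra. assert (0 <= a ^ 3) by nra. nra. }
    assert (0 <= x * (2 * a * (1 - 2 * a))) by (apply Rmult_le_pos; nra).
    nra.
  + assert (4 * a ^ 2 * (1 - a) <= y * (1 - a)) by (apply Rmult_le_compat_r; lra).
    nra.
- rewrite (G_minus _ _ e); apply plus_false in e; unfold level in *; cbn [fst snd] in *.
  assert (0 <= a * (1 - x)) by nra.
  assert (0 <= (1 - a) * (1 - x)) by nra.
  assert (0 <= y * ((1 - 2 * a) * (1 + a))) by (apply Rmult_le_pos; nra).
  split; [nra|left; nra].
Qed.

Lemma iterG_Lam (n : nat) (p : R * R) : Lam a p -> Lam a (iterG a n p).
Proof. revert p; induction n as [|n IH]; intros p H; [easy|]. apply IH, G_Lam, H. Qed.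

End Dynamics.

(** * Certificates of contraction *)

Module Certificate.
Local Open Scope Z_scope.

(* [andb] is strict under call-by-value reduction; this conjunction is not. *)
Local Notation "a &&& b" := (if a then b else false) (at level 40, left associativity).

Fixpoint every {X : Type} (f : X -> bool) (l : list X) : bool :=
  match l with
  | nil => true
  | x :: l' => f x &&& every f l'
  end.

Fixpoint every2 {X Y : Type} (f : X -> Y -> bool) (l : list X) (m : list Y) : bool :=
  match l, m with
  | nil, _ => true
  | x :: l', y :: m' => f x y &&& every2 f l' m'
  | _ :: _, nil => false
  end.

Definition znth {X : Type} (l : list X) (i : Z) : option X := nth_error l (Z.to_nat i).

(** * Polynomial models with error bounds *)

Definition zpoly := list Z.

Fixpoint padd (p q : zpoly) : zpoly :=
  match p, q with
  | nil, _ => q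
  | _, nil => p
  | a :: p', b :: q' => a + b :: padd p' q'
  end.

Definition pscal (k : Z) (p : zpoly) : zpoly := map (Z.mul k) p.

Fixpoint pmul (p q : zpoly) : zpoly :=
  match p with
  | nil => nil
  | a :: p' => padd (pscal a q) (0 :: pmul p' q)
  end.

(** An upper bound for t p(t) when 0 <= t <= 1, since all powers of t lie between 0 and 1. *)
Fixpoint possum (p : zpoly) : Z :=
  match p with
  | nil => 0
  | c :: p' => Z.max 0 c + possum p'
  end.

Fixpoint mag (p : zpoly) : Z :=
  match p with
  | nil => 0
  | c :: p' => Z.abs c + mag p'
  end.

(* A polynomial in the parameter of a cell, with a bound for the error. *)
Definition model := (zpoly * Z)%type.

Definition madd (s t : model) : model := (padd (fst s) (fst t), snd s + snd t).
Definition mscal (k : Z) (t : model) : model := (pscal k (fst t), Z.abs k * snd t).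
Definition msub (s t : model) : model := madd s (mscal (-1) t).
Definition mmul (s t : model) : model :=
  (pmul (fst s) (fst t), snd s * (mag (fst t) + snd t) + mag (fst s) * snd t).
(** Removes the factor 2^k left by a fixed-point product. Cutting at degree 3 keeps models small
    along a word; the error receives the discarded coefficients and 1 for each floor taken. *)
Definition mround (k : Z) (t : model) : model :=
  let p := firstn 4 (fst t) in
  (map (fun c => Z.shiftr c k) p,
   Z.shiftr (snd t + mag (skipn 4 (fst t))) k + 1 + Z.of_nat (length p)).
Definition upper (t : model) : Z :=
  match fst t with
  | nil => snd t
  | c :: p => c + possum p + snd t
  end.
Definition certified_nonneg (t : model) : bool := upper (mscal (-1) t) <=? 0.

(** * Half-planes and their incompatibility *)

Definition affine := (model * model * model)%type.
Definition halfplane := (Z * Z * Z)%type.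

Definition amap2 (f : model -> model -> model) (a b : affine) : affine :=
  let '(a1, a2, a3) := a in let '(b1, b2, b3) := b in (f a1 b1, f a2 b2, f a3 b3).
Definition amap (f : model -> model) (a : affine) : affine :=
  let '(a1, a2, a3) := a in (f a1, f a2, f a3).

(** The ends of the cells are multiples of 2^-14, which makes [ma], [m2a], [md] and [m1a] exact;
    quantities computed along a word carry 45 binary digits. *)
Definition lscale := 14.
Definition lunit := 45.
Definition scale := Z.shiftl 1 lscale.
Definition unity := Z.shiftl 1 lunit.

(** The point has nonnegative coordinates, so replacing each coefficient by an upper bound over the
    cell only weakens the inequality. Integers at scale 2^17 keep the later determinants cheap. *)
Definition enclose (k : Z) (a : affine) : halfplane :=
  let r t := Z.shiftr (Z.shiftl (upper t) 17) k + 1 in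
  let '(a1, a2, a3) := a in (r a1, r a2, r a3).

(** The multipliers are the minors that eliminate both variables. If they share one sign, the three
    inequalities add up to a statement about the constant [g] alone, which is then false. *)
Definition farkas (h1 h2 h3 : halfplane) : bool :=
  let '(a1, b1, c1) := h1 in let '(a2, b2, c2) := h2 in let '(a3, b3, c3) := h3 in
  let l1 := a2 * b3 - a3 * b2 in
  let l2 := a3 * b1 - a1 * b3 in
  let l3 := a1 * b2 - a2 * b1 in
  let g := l1 * c1 + l2 * c2 + l3 * c3 in
  if l1 <? 0 then (l2 <=? 0) &&& (l3 <=? 0) &&& (0 <? g)
  else (0 <=? l2) &&& (0 <=? l3) &&& (g <? 0).

Definition infeasible (h : halfplane) (hs : list halfplane) (i j : Z) : bool :=
  match znth hs i, znth hs j with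
  | Some h1, Some h2 => farkas h1 h2 h
  | _, _ => false
  end.

(* [CA]: the word is accepted, each image of an atom being decomposed along the pair of atoms
   given by two decimal digits; [CT]: accepted with any number of further minuses; [CP], [CM]: the next symbol is forced,
   the other one being excluded by the given pair of half-planes; [CB]: both are explored. *)
Inductive cert :=
| CA (l : list Z)
| CT
| CP (i j : Z) (c : cert)
| CM (i j : Z) (c : cert)
| CB (c1 c2 : cert)
| CE (i j : Z).

(* The parameters (cA + cW t) / 2^14 with 0 <= t <= 1. The unit ball of the norm adapted to this
   cell is the symmetric convex hull of the atoms, counted in thousandths. The
   inverse derivative of the plus branch maps this ball into {quad <= cK / 1000}, where [quad] is
   a form contracted by that of the minus branch. *)
Record cell := Cell {
  cA : Z; cW : Z; cK : Z; catoms : list (Z * Z); cminus : cert; cplus : cert }.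

(** * The certificate checker *)

Section Cell.
Variable c : cell.

Let N := scale.
Definition ma : model := ([cA c; cW c], 0).
Definition m2a : model := ([2 * cA c; 2 * cW c], 0).
Definition md : model := ([2 * N - 2 * cA c; -2 * cW c], 0).
Definition m1a : model := ([N - cA c; - cW c], 0).
Definition mconst (z : Z) : model := ([z], 0).
Definition times (s t : model) : model := mround lscale (mmul s t).

(** The state after a word: the current point as an affine function of the starting one, and the
    matrix of the inverse derivative. To avoid divisions its entries are multiplied by [ndk], a
    power of [det]. *)
Record node := Node {
  nx : affine; ny : affine;
  n11 : model; n12 : model; n21 : model; n22 : model;
  ndk : model;
  nhs : list halfplane }.

(** The bound on [quad] after a plus is checked at the atoms only: the square root of [quad] is a
    norm, so they decide for the whole ball. The inequality is that of [quad_plus] with denominators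
    cleared. *)
Definition kap_ok : bool :=
  every (fun '(a, b) =>
    certified_nonneg (msub (mscal (cK c * 1000) md)
      (madd (mconst (N * b * b)) (madd (mscal (- (a * b)) m2a) (mscal (a * a) md)))))
    (catoms c).

(** Cramer's rule: up to the factors 10000, [D] and [dk], [c1] and [c2] are the coordinates of the
    vector in the basis (p, q). The four inequalities say that the absolute values of the
    coordinates add up to at most 9999/10000. *)
Definition decomposes (v1 v2 dk : model) (p q : Z * Z) : bool :=
  let D := fst p * snd q - snd p * fst q in
  let c1 := mscal 10000 (msub (mscal (snd q) v1) (mscal (fst q) v2)) in
  let c2 := mscal 10000 (msub (mscal (fst p) v2) (mscal (snd p) v1)) in
  let B := mscal (9999 * Z.abs D) dk in
  let s := madd c1 c2 in let r := msub c1 c2 in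
  negb (D =? 0) &&& certified_nonneg (madd B s) &&& certified_nonneg (madd B r) &&&
  certified_nonneg (msub B s) &&& certified_nonneg (msub B r).

Definition accept (n : node) (hints : list Z) : bool :=
  every2 (fun '(x, y) h =>
    let v1 := madd (mscal x (n11 n)) (mscal y (n12 n)) in
    let v2 := madd (mscal x (n21 n)) (mscal y (n22 n)) in
    match znth (catoms c) (h / 10), znth (catoms c) (h mod 10) with
    | Some p, Some q => decomposes v1 v2 (ndk n) p q
    | _, _ => false
    end) (catoms c) hints.

(** By [row_bound], the square of the linear form (r1, r2) is at most [quad] times (r1^2 - 2a r1 r2
    + d r2^2) / (d - a^2). This quotient times [cK] / 1000 is certified to be at most
    (9999/10000)^2. *)
Definition tail_row (n : node) (r1 r2 : model) : bool :=
  let R := mmul (msub (mscal N md) (mmul ma ma)) (mmul (ndk n) (ndk n)) in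
  let q := madd (mscal (N * N) (mmul r1 r1))
    (madd (mscal (- N) (mmul m2a (mmul r1 r2))) (mscal N (mmul md (mmul r2 r2)))) in
  certified_nonneg (msub (mscal (9999 * 9999 * 1000) R) (mscal (10000 * 10000 * cK c) q)).

(** [norm1] is the larger of the absolute values of the sum and of the difference of the
    coordinates; these are the two rows. *)
Definition accept_tail (n : node) : bool :=
  tail_row n (madd (n11 n) (n21 n)) (madd (n12 n) (n22 n)) &&&
  tail_row n (msub (n11 n) (n21 n)) (msub (n12 n) (n22 n)).

Definition const (z : Z) : affine := (mconst 0, mconst 0, mconst z).

Definition nlevel (n : node) : affine :=
  amap2 madd (amap (times ma) (ny n)) (amap (times m1a) (nx n)).

Definition sgn (b : bool) : Z := if b then 1 else -1.

Definition half (level : affine) (b : bool) : halfplane :=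
  enclose lunit (amap (mscal (- sgn b)) (amap2 msub (amap (mscal 2) level) (const unity))).

Definition child (n : node) (level : affine) (b : bool) (hs : list halfplane) : node :=
  Node (ny n)
    (amap2 madd (amap (mscal (2 * sgn b)) level) (const (if b then 0 else 2 * unity)))
    (msub (times md (n12 n)) (times m2a (n11 n))) (mscal (sgn b) (n11 n))
    (msub (times md (n22 n)) (times m2a (n21 n))) (mscal (sgn b) (n21 n))
    (times md (ndk n))
    hs.

(* [last] is the last symbol read, if any. *)
Fixpoint verify (t : cert) (last : option bool) (n : node) : bool :=
  match t, last with
  | CA hints, Some true => accept n hints
  | CT, Some false => accept_tail n
  | CP i j t1, _ =>
      let l := nlevel n in
      infeasible (half l false) (nhs n) i j &&& verify t1 (Some true) (child n l true (nhs n))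
  | CM i j t1, _ =>
      let l := nlevel n in
      infeasible (half l true) (nhs n) i j &&& verify t1 (Some false) (child n l false (nhs n))
  | CB t1 t2, _ =>
      let l := nlevel n in
      verify t1 (Some true) (child n l true (half l true :: nhs n)) &&&
      verify t2 (Some false) (child n l false (half l false :: nhs n))
  | _, _ => false
  end.

(** Inequalities for X = G q with q in [Lam] on the plus side. The last two hold because the second
    coordinate of X is 2a [fst X] + 2(1 - a) [fst q], with [fst q] between 0 and 1. *)
Definition base : list affine :=
  let one := mconst (N * N) in let zero := mconst 0 in
  [ (one, zero, zero);
    (zero, one, zero);
    (mscal (-1) one, zero, one);
    (zero, mscal (-1) one, one);
    (zero, one, mscal (-4) (mmul ma ma));
    (mscal (- 2 * N) ma, one, zero);
    (mscal (2 * N) ma, mscal (-1) one, mscal (2 * N) m1a) ].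

(** The first alternative of [Lam] at q, rewritten in the coordinates of X = G q; [after_plus] is
    the second one. Each is the extra constraint at the root of one tree of the cell. *)
Definition after_minus : affine :=
  (madd (mscal N m1a) (mscal (-2) (mmul ma ma)), mscal N ma, mscal (-2) (mmul ma m1a)).
Definition after_plus : affine :=
  (mconst (N * N), mconst 0, mscal (-4) (mmul ma ma)).

Definition root (extra : affine) (t : cert) : bool :=
  let hs := map (enclose (2 * lscale)) base in
  let h := enclose (2 * lscale) extra in
  match t with
  | CE i j => infeasible h hs i j
  | _ =>
      verify t None
        (Node (mconst unity, mconst 0, mconst 0) (mconst 0, mconst unity, mconst 0)
          (mconst unity) (mconst 0) (mconst 0) (mconst unity) (mconst unity) (h :: hs))
  end.

Definition has_atom (x y : Z) : bool :=
  negb (every (fun p => negb ((fst p =? x) && (snd p =? y))) (catoms c)).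

(** The two compulsory atoms make the ball contain that of [norm1], so that a bound on [norm1] after
    a run of minuses is also one in the adapted norm. *)
Definition cell_ok : bool :=
  (0 <? cW c) &&& kap_ok &&& has_atom 1000 0 &&& has_atom 0 1000 &&&
  root after_minus (cminus c) &&& root after_plus (cplus c).

End Cell.

Fixpoint covers (lo : Z) (l : list cell) (hi : Z) : bool :=
  match l with
  | nil => hi <=? lo
  | c :: l' => (cA c =? lo) &&& covers (lo + cW c) l' hi
  end.

Definition cells : list cell := [
  Cell 0 2000 1004 [(1000, 0); (0, 1000)] (CB (CB (CA [1;1]) CT) (CB (CA [1;1]) CT)) (CB (CB (CA
    [1;1]) CT) (CB (CA [1;1]) CT));
  Cell 2000 1184 1004 [(1000, 0); (0, 1000)] (CB (CB (CA [1;1]) (CB (CA [1;1]) CT)) (CB (CA [1;1])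
    CT)) (CB (CB (CA [1;1]) (CB (CA [1;1]) CT)) (CB (CA [1;1]) CT));
  Cell 3184 467 1004 [(1000, 0); (0, 1000)] (CB (CB (CM 2 4 (CM 1 7 CT)) (CB (CA [1;1]) CT)) (CB
    (CA [1;1]) CT)) (CB (CB (CB (CB (CA [1;1]) (CM 0 4 CT)) (CM 2 8 CT)) (CM 2 6 CT)) (CB (CA
    [1;1]) CT));
  Cell 3651 414 1004 [(1000, 0); (0, 1000)] (CB (CB (CM 2 4 (CM 0 7 CT)) (CM 2 6 CT)) (CB (CA
    [1;1]) CT)) (CB (CB (CB (CM 3 8 (CM 3 5 CT)) (CM 0 9 CT)) (CM 1 2 CT)) (CB (CA [1;1]) CT));
  Cell 4065 552 1004 [(1000, 0); (0, 1000)] (CB (CB (CM 2 4 (CM 0 7 (CB (CB (CA [1;1]) (CB (CA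
    [1;1]) CT)) (CM 0 3 CT)))) (CM 2 6 (CB (CB (CA [1;1]) CT) CT))) (CB (CA [1;1]) (CB (CB (CA
    [1;1]) CT) CT))) (CB (CB (CM 2 7 (CM 0 7 (CB (CB (CA [1;1]) (CB (CA [1;1]) CT)) (CB (CA [1;1])
    CT)))) (CM 1 2 (CB (CB (CA [1;1]) CT) CT))) (CB (CA [1;1]) (CB (CB (CA [1;1]) CT) CT)));
  Cell 4617 326 1004 [(1000, 0); (0, 1000); (-625, 542)] (CB (CM 1 6 (CM 1 5 (CB (CA [12;1;1])
    CT))) (CB (CA [1;12;1]) (CB (CA [12;1;1]) CT))) (CB (CB (CM 2 7 (CM 0 7 (CB (CB (CA [1;1;1])
    (CB (CA [1;1;1]) CT)) (CB (CA [1;1;1]) CT)))) (CM 1 2 (CB (CA [12;1;1]) CT))) (CB (CA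
    [1;12;1]) (CB (CA [12;1;1]) CT)));
  Cell 4943 289 1004 [(1000, 0); (0, 1000); (-670, 596)] (CB (CM 0 1 (CM 1 5 (CB (CA [2;1;12]) (CB
    (CA [1;1;1]) CT)))) (CB (CA [1;12;1]) (CB (CA [2;1;1]) CT))) (CB (CB (CM 2 7 (CM 0 7 (CP 2 7
    (CB (CA [1;2;2]) (CM 0 8 (CM 3 8 CT)))))) (CM 1 2 (CB (CA [2;1;12]) (CB (CA [1;1;1]) CT))))
    (CB (CA [1;12;1]) (CB (CA [2;1;1]) CT)));
  Cell 5232 256 1053 [(1000, 0); (0, 1000); (-712, 644)] (CB (CM 0 1 (CM 1 5 (CP 0 1 (CA
    [2;1;12])))) (CB (CB (CM 0 6 (CB (CA [1;1;1]) CT)) (CM 1 8 CT)) (CB (CA [2;1;1]) (CB (CA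
    [1;1;1]) CT)))) (CB (CM 1 6 (CM 0 1 (CB (CA [2;1;12]) (CB (CA [1;2;1]) (CM 0 3 CT))))) (CB (CB
    (CM 0 6 (CB (CA [1;1;1]) CT)) (CM 1 8 CT)) (CB (CA [2;1;1]) (CB (CA [1;1;1]) CT))));
  Cell 5488 227 1154 [(1000, 0); (0, 1000); (-734, 672)] (CB (CM 0 1 (CM 1 5 (CP 0 1 (CA
    [12;1;12])))) (CB (CB (CM 0 6 (CM 1 6 (CP 0 6 (CA [1;1;1])))) (CM 1 8 (CB (CA [1;1;1]) CT)))
    (CB (CA [2;1;1]) (CB (CA [1;1;12]) (CB (CA [1;1;1]) CT))))) (CB (CM 1 6 (CM 0 1 (CB (CA
    [12;1;12]) (CB (CA [1;2;2]) (CM 0 3 (CM 1 3 CT)))))) (CB (CB (CM 0 6 (CM 1 6 (CP 0 6 (CA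
    [1;1;1])))) (CM 1 8 (CB (CA [1;1;1]) CT))) (CB (CA [2;1;1]) (CB (CA [1;1;12]) (CB (CA [1;1;1])
    CT)))));
  Cell 5715 134 1236 [(1000, 0); (0, 1000); (-753, 694)] (CM 0 4 (CM 3 6 (CB (CA [2;1;1]) (CB (CA
    [1;1;12]) (CB (CA [1;1;1]) CT))))) (CB (CM 1 6 (CM 0 1 (CB (CA [12;1;12]) (CB (CA [1;2;2]) (CM
    0 3 (CM 1 3 CT)))))) (CM 4 7 (CB (CA [2;1;1]) (CB (CA [1;1;12]) (CB (CA [1;1;1]) CT)))));
  Cell 5849 178 1004 [(1000, 0); (0, 1000); (-750, 489)] (CM 0 4 (CM 3 6 (CB (CA [2;1;1]) (CB (CA
    [1;1;12]) (CB (CA [1;1;1]) CT))))) (CM 0 5 (CM 3 6 (CB (CA [2;1;1]) (CB (CA [1;1;12]) (CB (CA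
    [1;1;1]) CT)))));
  Cell 6027 158 1017 [(1000, 0); (0, 1000); (-363, 788); (-782, 471)] (CM 0 4 (CM 3 6 (CB (CA
    [3;1;1;1]) (CB (CA [1;1;2;2]) (CB (CA [1;1;1;1]) CT))))) (CM 0 5 (CM 3 6 (CB (CA [3;1;1;1])
    (CM 1 6 (CB (CA [1;1;1;1]) CT)))));
  Cell 6185 210 1069 [(1000, 0); (0, 1000); (-415, 829); (-816, 449)] (CM 0 4 (CM 3 6 (CB (CA
    [13;1;1;1]) (CB (CA [1;1;23;2]) (CB (CA [1;1;1;1]) (CB (CA [2;1;1;1]) CT)))))) (CM 0 5 (CM 3 6
    (CB (CA [13;1;1;1]) (CM 1 6 (CB (CA [1;1;1;1]) (CB (CA [2;1;1;1]) CT))))));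
  Cell 6395 105 1056 [(1000, 0); (0, 1000); (-426, 796); (-825, 418)] (CM 0 4 (CM 3 6 (CB (CA
    [13;1;1;1]) (CB (CM 1 2 (CM 2 6 (CB (CA [2;1;1;1]) (CM 0 3 (CM 3 7 (CB (CA [2;1;1;1]) (CM 0 4
    CT))))))) (CM 2 8 (CB (CA [2;1;1;1]) CT)))))) (CM 0 5 (CM 3 6 (CB (CA [13;1;1;1]) (CM 1 6 (CM
    1 7 (CB (CA [2;1;1;1]) CT))))));
  Cell 6500 30 1016 [(1000, 0); (0, 1000); (-436, 790); (-816, 398)] (CM 0 4 (CM 3 6 (CB (CA
    [13;1;1;1]) (CB (CM 1 2 (CM 2 6 (CB (CA [2;1;1;1]) (CM 2 3 (CM 3 7 (CP 3 7 (CA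
    [2;1;1;1]))))))) (CM 0 8 (CB (CA [2;1;1;1]) CT)))))) (CM 0 5 (CM 3 6 (CB (CA [13;1;1;1]) (CM 1
    6 (CM 1 7 (CB (CA [2;1;1;1]) CT))))));
  Cell 6530 60 1049 [(1000, 0); (0, 1000); (-453, 807); (-832, 396)] (CM 0 4 (CM 3 6 (CB (CA
    [13;1;1;1]) (CB (CM 1 2 (CM 2 6 (CB (CA [2;1;1;1]) (CM 2 3 (CM 3 7 (CP 3 7 (CA
    [2;1;1;2]))))))) (CM 0 8 (CB (CA [2;1;1;2]) (CB (CA [1;1;1;1]) CT))))))) (CM 0 5 (CM 3 6 (CB
    (CA [13;1;1;1]) (CM 1 6 (CM 1 7 (CB (CA [2;1;1;2]) (CM 0 2 CT)))))));
  Cell 6590 120 1118 [(1000, 0); (0, 1000); (693, 309); (-488, 837); (-860, 388)] (CM 0 4 (CM 3 6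
    (CB (CA [14;1;1;1;1]) (CB (CM 1 2 (CM 2 6 (CB (CA [3;1;1;1;13]) (CM 2 3 (CM 3 7 (CP 3 7 (CA
    [3;1;1;1;3]))))))) (CM 0 8 (CB (CA [3;1;1;1;3]) (CB (CA [1;1;1;3;1]) (CM 0 9 CT)))))))) (CM 0
    5 (CM 3 6 (CB (CA [14;1;1;1;1]) (CM 1 6 (CM 1 7 (CB (CA [3;1;1;1;3]) (CM 0 2 (CM 2 7
    CT))))))));
  Cell 6710 160 1329 [(1000, 0); (0, 1000); (779, 363); (-547, 886); (-905, 374)] (CM 0 4 (CM 3 6
    (CB (CA [14;1;3;12;1]) (CB (CM 1 2 (CM 2 6 (CB (CA [3;1;3;1;13]) (CM 2 3 (CM 3 7 (CB (CA
    [3;1;1;1;3]) (CM 0 4 (CM 4 8 (CP 4 8 (CA [3;1;1;3;3])))))))))) (CM 0 8 (CB (CA [3;1;1;1;3])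
    (CB (CA [1;3;1;3;13]) (CM 9 10 (CB (CA [1;1;1;1;3]) (CB (CA [1;1;1;1;1]) CT)))))))))) (CM 0 5
    (CM 3 6 (CB (CA [14;1;3;12;1]) (CM 1 6 (CM 1 7 (CB (CA [3;1;1;1;3]) (CM 0 2 (CM 7 8 (CB (CA
    [1;1;1;1;3]) (CB (CA [1;1;1;1;1]) CT))))))))));
  Cell 6870 142 1511 [(1000, 0); (0, 1000); (835, 411); (-601, 916); (-931, 347)] (CM 0 4 (CM 3 6
    (CB (CA [14;1;3;12;3]) (CB (CM 1 2 (CM 2 6 (CP 2 6 (CA [3;1;3;1;13])))) (CM 0 8 (CB (CA
    [3;1;1;1;3]) (CB (CA [1;3;1;3;13]) (CM 1 9 (CB (CA [3;1;1;1;3]) (CB (CA [1;1;1;3;1]) (CM 6 11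
    (CB (CA [1;1;1;1;1]) (CB (CA [1;1;1;1;1]) CT))))))))))))) (CM 0 5 (CM 3 6 (CB (CA
    [14;1;3;12;3]) (CM 1 6 (CM 1 7 (CB (CA [3;1;1;1;3]) (CM 2 4 (CM 0 7 (CB (CA [3;1;1;1;3]) (CB
    (CA [1;1;1;3;1]) (CM 4 9 (CB (CA [1;1;1;1;1]) (CB (CA [1;1;1;1;1]) CT)))))))))))));
  Cell 7012 84 1576 [(1000, 0); (0, 1000); (870, 379); (836, 430); (-628, 915); (-679, 865);
    (-927, 317)] (CM 0 4 (CM 3 5 (CB (CA [16;1;4;4;13;3;1]) (CB (CM 1 2 (CM 2 6 (CP 2 6 (CA
    [4;1;5;4;1;1;14])))) (CM 1 8 (CB (CA [4;1;4;1;1;1;4]) (CB (CM 2 4 (CM 0 8 (CB (CA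
    [14;1;4;4;1;1;1]) (CM 3 5 (CM 3 4 (CB (CA [4;1;4;1;1;1;4]) (CM 4 6 (CM 4 5 (CB (CA
    [4;1;1;1;1;1;4]) (CM 0 7 (CM 5 6 (CB (CA [1;1;1;1;1;1;1]) (CM 0 8 (CM 6 8 CT)))))))))))))) (CM
    1 9 (CB (CA [4;1;1;1;1;4;4]) (CB (CA [1;1;1;1;4;14;1]) (CM 0 11 (CB (CA [1;1;1;1;4;4;1]) (CB
    (CA [1;1;1;1;1;1;1]) (CM 1 8 CT)))))))))))))) (CM 0 5 (CM 3 5 (CB (CA [16;1;4;4;13;3;1]) (CM 1
    6 (CM 0 7 (CB (CA [4;1;4;1;1;1;4]) (CM 2 4 (CM 0 7 (CB (CA [4;1;1;1;1;4;4]) (CM 0 3 (CM 3 8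
    (CB (CA [1;1;1;1;4;4;1]) (CB (CA [1;1;1;1;1;1;1]) (CM 5 10 CT))))))))))))));
  Cell 7096 74 1186 [(1000, 0); (0, 1000); (555, 476); (-356, 826); (-939, 301)] (CM 0 4 (CM 3 5
    (CB (CA [14;1;1;12;3]) (CB (CM 1 2 (CM 2 6 (CP 2 6 (CM 0 2 (CM 0 1 (CM 2 6 (CM 0 2 (CM 0 1 (CB
    (CA [3;1;1;3;34]) (CM 1 3 (CM 1 2 (CB (CA [1;1;1;1;1]) CT)))))))))))) (CM 1 8 (CB (CA
    [34;1;1;1;14]) (CB (CM 0 2 (CM 0 8 (CB (CA [3;1;1;1;1]) (CM 3 5 (CM 3 4 (CB (CM 1 6 (CM 1 5
    (CB (CA [3;1;1;1;3]) (CM 2 7 (CM 2 6 (CB (CA [1;1;1;1;3]) CT)))))) (CM 4 6 (CM 3 4 (CB (CA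
    [3;1;1;1;3]) (CM 5 7 (CM 0 5 (CB (CA [1;1;1;1;3]) (CM 0 8 CT))))))))))))) (CM 1 9 (CB (CA
    [3;1;1;1;14]) (CB (CA [1;1;1;3;1]) (CM 0 11 (CB (CA [1;1;1;1;3]) CT)))))))))))) (CM 0 5 (CM 3
    5 (CB (CA [14;1;1;12;3]) (CM 1 6 (CM 0 7 (CB (CA [34;1;1;1;14]) (CM 2 4 (CM 0 7 (CB (CA
    [3;1;1;1;14]) (CM 0 3 (CM 3 8 (CB (CA [1;1;1;1;3]) CT))))))))))));
  Cell 7170 65 1194 [(1000, 0); (0, 1000); (591, 501); (-394, 848); (-949, 287)] (CM 0 4 (CM 0 3
    (CB (CA [14;1;1;12;3]) (CM 1 5 (CM 0 7 (CB (CA [34;1;1;1;14]) (CB (CM 3 4 (CM 0 7 (CB (CA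
    [3;1;1;1;13]) (CM 4 5 (CM 3 11 (CB (CM 1 5 (CM 0 3 (CB (CA [3;1;1;1;3]) (CM 2 6 (CM 2 5 (CB
    (CA [1;1;1;1;3]) (CM 3 7 CT))))))) (CM 4 5 (CM 5 9 (CB (CA [34;1;1;1;34]) (CM 5 6 (CM 6 10 (CP
    6 10 (CA [3;1;1;1;3]))))))))))))) (CM 0 9 (CB (CA [3;1;1;1;14]) (CB (CA [1;3;1;3;1]) (CM 1 5
    (CB (CA [1;1;1;1;3]) (CB (CA [1;1;1;1;1]) CT))))))))))))) (CM 0 5 (CM 3 5 (CB (CA
    [14;1;1;12;3]) (CM 1 6 (CM 0 7 (CB (CA [34;1;1;1;14]) (CM 2 4 (CM 0 7 (CB (CA [3;1;1;1;14])
    (CM 0 3 (CM 0 8 (CB (CA [1;1;1;1;3]) (CM 0 4 CT)))))))))))));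
  Cell 7235 57 1199 [(1000, 0); (0, 1000); (623, 525); (-428, 867); (-958, 273)] (CM 0 4 (CM 0 3
    (CB (CA [14;1;1;2;3]) (CM 1 5 (CM 0 7 (CB (CA [34;1;1;1;14]) (CB (CM 3 4 (CM 0 7 (CB (CA
    [3;1;3;1;13]) (CM 4 5 (CM 2 11 (CP 4 8 (CM 0 4 (CM 0 3 (CB (CA [3;1;1;1;34]) (CM 1 5 (CM 1 3
    (CB (CA [3;1;1;1;3]) (CM 2 6 (CM 2 5 CT)))))))))))))) (CM 0 9 (CB (CA [3;1;1;1;14]) (CB (CA
    [1;3;1;3;1]) (CM 1 5 (CB (CA [3;1;1;1;3]) (CB (CA [1;1;1;1;1]) (CM 0 12 CT)))))))))))))) (CM 0
    5 (CM 3 5 (CB (CA [14;1;1;2;3]) (CM 1 6 (CM 0 7 (CB (CA [34;1;1;1;14]) (CM 2 4 (CM 0 7 (CB (CA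
    [3;1;1;1;14]) (CM 3 5 (CM 0 8 (CB (CA [3;1;1;1;3]) (CM 0 4 (CM 4 9 CT))))))))))))));
  Cell 7292 33 1199 [(1000, 0); (0, 1000); (628, 527); (-447, 868); (-950, 259)] (CM 0 4 (CM 0 3
    (CB (CA [14;1;3;12;3]) (CM 1 5 (CM 0 7 (CB (CA [34;1;1;1;14]) (CB (CM 2 3 (CM 0 7 (CP 3 7 (CA
    [3;1;3;1;13])))) (CM 0 9 (CB (CA [3;1;1;1;34]) (CB (CA [1;3;1;34;1]) (CM 1 5 (CB (CA
    [3;1;1;1;3]) (CB (CA [1;1;1;3;1]) (CM 0 12 CT)))))))))))))) (CM 0 5 (CM 3 5 (CB (CA
    [14;1;3;12;3]) (CM 1 6 (CM 0 7 (CB (CA [34;1;1;1;14]) (CM 2 4 (CM 0 7 (CB (CA [3;1;1;1;34])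
    (CM 3 5 (CM 0 8 (CP 3 8 (CA [3;1;1;1;3])))))))))))));
  Cell 7325 44 1265 [(1000, 0); (0, 1000); (648, 543); (-470, 879); (-955, 250)] (CM 0 4 (CM 0 3
    (CB (CA [14;1;3;12;3]) (CM 1 5 (CM 0 7 (CB (CA [34;1;1;1;14]) (CB (CM 3 4 (CM 0 7 (CP 3 7 (CA
    [3;1;3;1;13])))) (CM 0 9 (CB (CA [3;1;1;1;34]) (CB (CM 2 5 (CM 0 4 (CB (CA [13;1;3;1;1]) (CM 3
    6 (CM 3 4 (CB (CA [3;1;1;1;1]) (CM 4 7 (CM 3 4 (CB (CA [3;1;1;1;3]) (CM 5 8 (CM 0 5 (CB (CA
    [3;1;1;1;3]) (CM 6 9 (CM 0 6 (CB (CA [1;1;1;1;1]) CT))))))))))))))) (CM 1 5 (CB (CA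
    [3;1;1;1;3]) (CB (CA [1;1;1;3;1]) (CM 0 12 (CB (CA [1;1;1;1;3]) (CB (CA [1;1;1;1;1])
    CT)))))))))))))))) (CM 0 5 (CM 3 5 (CB (CA [14;1;3;12;3]) (CM 1 6 (CM 0 7 (CB (CA
    [34;1;1;1;14]) (CM 2 4 (CM 0 7 (CB (CA [3;1;1;1;34]) (CM 3 5 (CM 0 8 (CP 3 8 (CA
    [3;1;1;1;3])))))))))))));
  Cell 7369 58 1356 [(1000, 0); (0, 1000); (675, 565); (-500, 894); (-962, 239)] (CM 0 4 (CM 0 3
    (CB (CA [14;1;3;12;3]) (CM 1 5 (CM 0 7 (CB (CA [34;1;1;2;14]) (CB (CM 3 4 (CM 0 7 (CP 3 7 (CM
    0 3 (CM 0 1 (CB (CA [13;1;1;3;3]) (CM 1 4 (CM 1 2 (CB (CA [1;1;1;3;3]) (CM 2 5 (CM 2 3 (CB (CA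
    [1;1;1;3;1]) (CM 3 6 (CM 0 3 CT)))))))))))))) (CM 0 9 (CB (CA [3;1;1;1;34]) (CB (CM 2 5 (CM 0
    4 (CB (CA [13;1;3;1;1]) (CM 3 6 (CM 3 4 (CB (CA [3;1;1;1;3]) (CM 4 7 (CM 3 4 (CB (CA
    [3;1;1;1;3]) (CM 5 8 (CM 0 5 (CB (CA [3;1;1;1;3]) (CM 6 9 (CM 0 6 (CB (CA [1;1;1;1;3]) (CM 0
    10 (CM 0 7 (CB (CA [1;1;1;1;1]) (CB (CA [1;1;1;1;1]) CT))))))))))))))))))) (CM 1 5 (CB (CA
    [3;1;1;1;3]) (CB (CA [1;3;1;3;1]) (CM 0 12 (CB (CA [1;1;1;1;3]) (CB (CA [1;1;1;1;1]) (CM 0 14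
    (CB (CA [1;1;1;1;1]) CT)))))))))))))))))) (CM 0 5 (CM 3 5 (CB (CA [14;1;3;12;3]) (CM 1 6 (CM 0
    7 (CB (CA [34;1;1;2;14]) (CM 2 4 (CM 0 7 (CB (CA [3;1;1;1;34]) (CM 3 5 (CM 0 8 (CP 3 8 (CA
    [3;1;1;1;3])))))))))))));
  Cell 7427 32 1435 [(1000, 0); (0, 1000); (699, 585); (-527, 906); (-681, 689); (-968, 228)] (CM
    0 4 (CM 0 3 (CB (CA [15;1;3;2;2;3]) (CM 1 5 (CM 0 7 (CB (CA [35;1;1;2;1;15]) (CB (CM 2 3 (CM 0
    7 (CP 3 7 (CA [3;1;4;1;1;13])))) (CM 0 9 (CB (CA [3;1;1;1;1;4]) (CB (CM 0 2 (CM 0 4 (CB (CA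
    [13;1;3;1;1;1]) (CM 3 6 (CM 2 3 (CB (CA [3;1;3;1;1;3]) (CM 4 7 (CM 0 4 (CB (CA [3;1;1;1;1;3])
    (CM 5 8 (CM 0 5 (CP 5 8 (CA [3;1;1;1;1;3]))))))))))))) (CM 0 11 (CB (CA [3;1;1;1;1;3]) (CB (CA
    [1;3;1;3;3;1]) (CM 1 7 (CB (CA [3;1;1;1;3;3]) (CB (CA [1;1;1;3;1;1]) (CM 0 14 (CB (CA
    [1;1;1;1;1;1]) (CB (CA [1;1;1;1;1;1]) CT))))))))))))))))))) (CM 0 5 (CM 3 5 (CB (CA
    [15;1;3;2;2;3]) (CM 1 6 (CM 0 7 (CB (CA [35;1;1;2;1;15]) (CM 2 4 (CM 0 7 (CP 2 7 (CA
    [3;1;1;1;1;4]))))))))));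
  Cell 7459 18 1454 [(1000, 0); (0, 1000); (699, 585); (-538, 904); (-691, 686); (-961, 219)] (CM
    0 4 (CM 0 3 (CB (CA [15;1;3;2;2;3]) (CM 1 5 (CM 0 7 (CB (CA [35;1;1;2;1;15]) (CB (CM 2 3 (CM 0
    7 (CP 3 7 (CA [3;1;4;1;1;13])))) (CM 0 9 (CB (CA [3;1;1;1;1;4]) (CB (CM 0 2 (CM 0 4 (CB (CA
    [13;1;3;1;1;1]) (CM 1 3 (CM 2 3 (CB (CA [3;1;3;1;1;3]) (CM 4 7 (CM 0 4 (CP 4 7 (CA
    [3;1;1;1;1;3])))))))))) (CM 0 11 (CB (CA [3;1;1;1;3;3]) (CB (CA [1;3;1;3;3;1]) (CM 1 7 (CB (CA
    [3;1;1;1;3;3]) (CB (CA [1;1;1;3;1;1]) (CM 0 14 (CB (CA [1;1;1;1;1;1]) (CB (CA [1;1;1;1;1;1])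
    (CM 0 11 CT)))))))))))))))))))) (CM 0 5 (CM 3 5 (CB (CA [15;1;3;2;2;3]) (CM 1 6 (CM 0 7 (CB
    (CA [35;1;1;2;1;15]) (CM 2 4 (CM 0 7 (CP 2 7 (CA [3;1;1;1;1;4]))))))))));
  Cell 7477 24 1198 [(1000, 0); (0, 1000); (937, 104); (507, 581); (-351, 830); (-886, 374);
    (-973, 216)] (CM 0 4 (CM 0 3 (CB (CA [16;1;5;1;3;12;5]) (CM 1 5 (CM 0 7 (CB (CA
    [15;1;15;1;1;4;5]) (CB (CM 2 3 (CM 0 7 (CP 3 7 (CM 0 3 (CM 0 1 (CM 3 7 (CM 0 3 (CM 0 1 (CB (CM
    4 8 (CM 0 3 (CB (CA [4;1;4;1;1;1;4]) (CM 5 9 (CM 0 12 (CP 5 9 (CM 0 5 (CM 0 3 (CB (CA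
    [4;1;4;1;1;4;45]) (CM 1 6 (CM 1 4 (CB (CA [4;1;1;1;1;4;4]) (CM 2 7 (CM 2 5 CT))))))))))))))
    (CM 1 4 (CM 0 1 (CP 1 4 (CA [1;1;1;1;4;4;1]))))))))))))) (CM 0 9 (CB (CA [45;1;15;1;1;5;15])
    (CB (CM 0 2 (CM 0 4 (CB (CA [4;1;45;1;1;1;1]) (CM 3 6 (CM 2 3 (CP 6 10 (CM 0 6 (CM 0 4 (CB (CM
    4 7 (CM 0 14 (CB (CM 1 8 (CM 0 4 (CB (CA [4;1;4;1;1;4;4]) (CM 2 9 (CM 2 5 (CB (CA
    [1;1;1;1;1;4;4]) (CM 3 10 (CM 3 6 CT)))))))) (CM 5 8 (CM 4 5 (CB (CA [45;1;4;1;1;4;45]) (CM 6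
    9 (CM 0 6 (CB (CA [4;1;4;1;1;4;4]) (CM 7 10 (CM 0 7 (CB (CA [1;1;1;1;1;4;4]) (CM 8 11 (CM 0 8
    CT)))))))))))))) (CM 1 7 (CM 1 3 (CB (CA [1;1;1;1;1;4;4]) (CM 2 8 (CM 2 4 CT)))))))))))))) (CM
    0 11 (CB (CA [15;1;4;1;1;15;15]) (CB (CA [1;4;1;1;4;4;1]) (CM 1 7 (CB (CA [4;1;1;1;1;4;15])
    (CB (CA [1;1;1;1;1;1;1]) (CM 0 14 (CB (CA [1;1;1;1;1;4;4]) CT)))))))))))))))))) (CM 0 5 (CM 3
    5 (CB (CA [16;1;5;1;3;12;5]) (CM 1 6 (CM 0 7 (CB (CA [15;1;15;1;1;4;5]) (CM 2 4 (CM 0 7 (CP 2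
    7 (CA [45;1;15;1;1;5;15]))))))))));
  Cell 7501 24 1205 [(1000, 0); (0, 1000); (943, 104); (552, 563); (525, 593); (-370, 841); (-404,
    813); (-894, 366); (-976, 210)] (CM 0 4 (CM 0 3 (CB (CA [18;1;7;1;1;4;3;12;7]) (CM 1 5 (CM 0 7
    (CB (CA [17;1;17;1;1;1;1;5;7]) (CM 2 6 (CM 0 2 (CB (CA [57;1;17;1;1;1;1;7;17]) (CB (CM 4 5 (CM
    0 3 (CB (CA [5;1;6;5;5;1;1;1;15]) (CM 5 6 (CM 2 12 (CP 5 9 (CM 0 5 (CM 0 3 (CB (CM 6 10 (CM 0
    13 (CB (CM 1 7 (CM 0 4 (CB (CA [5;1;5;1;1;1;1;5;5]) (CM 2 8 (CM 2 5 (CB (CA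
    [5;1;1;1;1;1;1;5;5]) (CM 3 9 (CM 3 6 (CB (CA [1;1;1;1;1;1;1;1;1]) CT))))))))) (CM 7 11 (CM 6 8
    (CB (CA [57;1;5;1;1;1;1;5;6]) (CM 8 12 (CM 8 12 (CB (CA [5;1;5;1;1;1;1;5;5]) (CM 9 13 (CM 9 13
    (CB (CA [5;1;1;1;1;1;1;5;5]) (CM 10 11 (CM 10 14 (CB (CA [1;1;1;1;1;1;1;5;1])
    CT))))))))))))))) (CM 1 6 (CM 1 3 (CB (CA [5;1;1;1;1;1;1;5;5]) (CM 2 7 (CM 2 4 (CB (CA
    [1;1;1;1;1;1;1;5;1]) CT))))))))))))))) (CM 0 10 (CB (CA [17;1;5;1;1;1;1;17;17]) (CB (CA
    [1;5;1;1;1;57;57;5;1]) (CM 1 6 (CB (CA [5;1;1;1;1;1;1;6;17]) (CB (CA [1;1;1;1;1;5;5;1;1]) (CM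
    0 13 (CB (CA [1;1;1;1;1;1;1;5;5]) (CB (CA [1;1;1;1;1;1;1;1;1]) CT))))))))))))))))))) (CM 0 5
    (CM 3 5 (CB (CA [18;1;7;1;1;4;3;12;7]) (CM 1 6 (CM 0 7 (CB (CA [17;1;17;1;1;1;1;5;7]) (CM 2 4
    (CM 0 7 (CP 2 7 (CA [57;1;17;1;1;1;1;7;17]))))))))));
  Cell 7525 12 1183 [(1000, 0); (0, 1000); (929, 101); (528, 591); (-381, 840); (-890, 356);
    (-968, 204)] (CM 0 4 (CM 0 3 (CB (CA [16;1;5;1;3;12;4]) (CM 1 5 (CM 0 7 (CB (CA
    [15;1;15;1;1;4;5]) (CM 2 6 (CM 0 2 (CB (CA [45;1;15;1;1;5;15]) (CB (CM 4 5 (CM 0 3 (CB (CA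
    [4;1;4;4;1;1;14]) (CM 5 6 (CM 2 12 (CP 5 9 (CM 0 5 (CM 0 3 (CM 5 9 (CM 0 5 (CM 0 2 (CB (CA
    [4;1;1;1;1;4;4]) (CM 1 6 (CM 0 1 (CP 1 6 (CA [1;1;1;1;1;4;1])))))))))))))))) (CM 0 10 (CB (CA
    [15;1;4;1;1;15;15]) (CB (CA [1;4;1;1;45;4;1]) (CM 0 12 (CB (CA [4;1;1;1;1;4;15]) (CB (CA
    [1;4;1;1;4;1;1]) (CM 0 13 (CB (CA [1;1;1;1;1;4;4]) (CB (CA [1;1;1;1;1;1;1])
    CT))))))))))))))))))) (CM 0 5 (CM 3 5 (CB (CA [16;1;5;1;3;12;4]) (CM 1 6 (CM 0 7 (CP 1 6 (CA
    [15;1;15;1;1;4;5])))))))].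

Lemma cells_ok : every cell_ok cells = true.
Proof. vm_cast_no_check (eq_refl true). Qed.

(** 7537 is the least integer above 0.46 times 2^14. *)
Lemma cells_cover : covers 0 cells 7537 = true.
Proof. reflexivity. Qed.

End Certificate.

(** * Contraction of the inverse derivatives *)

Module Expansion.
Import Certificate.

Lemma every_In {X : Type} (f : X -> bool) (l : list X) (x : X) :
  every f l = true -> In x l -> f x = true.
Proof.
induction l as [|y l IH]; simpl; [easy|].
destruct (f y) eqn:e; [|easy]. intros H [<-|H']; auto.
Qed.

Lemma every2_In {X Y : Type} (f : X -> Y -> bool) (l : list X) (m : list Y) (x : X) :
  every2 f l m = true -> In x l -> exists y, f x y = true.
Proof.
revert m; induction l as [|z l IH]; simpl; [easy|].
intros [|y m]; [easy|]. destruct (f z y) eqn:e; [|easy].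
intros H [<-|H']; [now exists y|]. exact (IH m H H').
Qed.

Lemma Rabs_le_bounds (x b : R) : Rabs x <= b -> - b <= x <= b.
Proof. intros h. pose proof (Rle_abs x). pose proof (Rle_abs (- x)). rewrite Rabs_Ropp in *. lra. Qed.

Lemma shiftr_bounds (c k : Z) : (0 <= k)%Z ->
  IZR (Z.shiftr c k) * IZR (Z.shiftl 1 k) <= IZR c < (IZR (Z.shiftr c k) + 1) * IZR (Z.shiftl 1 k).
Proof.
intros hk. rewrite Z.shiftr_div_pow2, Z.shiftl_1_l by easy.
assert (h : (0 < 2 ^ k)%Z) by (apply Z.pow_pos_nonneg; lia).
pose proof (Z.div_mod c (2 ^ k)) as e. pose proof (Z.mod_pos_bound c (2 ^ k) h) as b.
replace (IZR (c / 2 ^ k) + 1) with (IZR (c / 2 ^ k + 1)) by (rewrite plus_IZR; easy).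
rewrite <- !mult_IZR. split; [apply IZR_le|apply IZR_lt]; lia.
Qed.

(** * Soundness of the models *)

Section Models.
Variable t : R.
Hypothesis t01 : 0 <= t <= 1.

Fixpoint peval (p : zpoly) : R :=
  match p with
  | nil => 0
  | c :: p' => IZR c + t * peval p'
  end.

Lemma peval_add (p q : zpoly) : peval (padd p q) = peval p + peval q.
Proof.
revert q; induction p as [|a p IH]; intros [|b q]; simpl; try lra.
rewrite IH, plus_IZR; lra.
Qed.

Lemma peval_scal (k : Z) (p : zpoly) : peval (pscal k p) = IZR k * peval p.
Proof. induction p as [|a p IH]; simpl; [lra|]. rewrite IH, mult_IZR; lra. Qed.

Lemma peval_mul (p q : zpoly) : peval (pmul p q) = peval p * peval q.
Proof.
induction p as [|a p IH]; simpl; [lra|].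
rewrite peval_add, peval_scal; simpl; rewrite IH; lra.
Qed.

Lemma peval_mag (p : zpoly) : Rabs (peval p) <= IZR (mag p).
Proof.
induction p as [|a p IH]; simpl; [rewrite Rabs_R0; lra|].
rewrite plus_IZR, abs_IZR.
eapply Rle_trans; [apply Rabs_triang|].
rewrite Rabs_mult, (Rabs_pos_eq t) by lra.
pose proof (Rabs_pos (peval p)). nra.
Qed.

Lemma peval_possum (p : zpoly) : t * peval p <= IZR (possum p).
Proof.
assert (H : forall q, 0 <= IZR (possum q)).
{ intros q; apply IZR_le; induction q; simpl; lia. }
induction p as [|a p IH]; simpl; [lra|].
rewrite plus_IZR.
assert (IZR a <= IZR (Z.max 0 a)) by (apply IZR_le; lia).
assert (0 <= IZR (Z.max 0 a)) by (apply IZR_le; lia).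
specialize (H p). nra.
Qed.

(** The scale [S] is explicit because products of models multiply their scales. *)
Definition approx (S x : R) (m : model) : Prop := Rabs (S * x - peval (fst m)) <= IZR (snd m).

Lemma approx_add (S x y : R) (m n : model) :
  approx S x m -> approx S y n -> approx S (x + y) (madd m n).
Proof.
unfold approx, madd; simpl; intros h1 h2. rewrite peval_add, plus_IZR.
replace (S * (x + y) - (peval (fst m) + peval (fst n)))
  with ((S * x - peval (fst m)) + (S * y - peval (fst n))) by ring.
eapply Rle_trans; [apply Rabs_triang|lra].
Qed.

Lemma approx_scal (S x : R) (k : Z) (m : model) :
  approx S x m -> approx S (IZR k * x) (mscal k m).
Proof.
unfold approx, mscal; simpl; intros h. rewrite peval_scal, mult_IZR, abs_IZR.
replace (S * (IZR k * x) - IZR k * peval (fst m)) with (IZR k * (S * x - peval (fst m))) by ring.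
rewrite Rabs_mult. apply Rmult_le_compat_l; [apply Rabs_pos|easy].
Qed.

Lemma approx_sub (S x y : R) (m n : model) :
  approx S x m -> approx S y n -> approx S (x - y) (msub m n).
Proof.
intros h1 h2. replace (x - y) with (x + IZR (-1) * y) by (simpl; ring).
apply approx_add; [easy|]. now apply approx_scal.
Qed.

Lemma approx_mul (S S' x y : R) (m n : model) :
  approx S x m -> approx S' y n -> approx (S * S') (x * y) (mmul m n).
Proof.
unfold approx, mmul; simpl; intros h1 h2. rewrite peval_mul, plus_IZR, !mult_IZR, plus_IZR.
replace (S * S' * (x * y) - peval (fst m) * peval (fst n))
  with ((S * x - peval (fst m)) * (S' * y - peval (fst n) + peval (fst n))
        + peval (fst m) * (S' * y - peval (fst n))) by ring.
eapply Rle_trans; [apply Rabs_triang|]. rewrite !Rabs_mult.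
apply Rplus_le_compat; apply Rmult_le_compat; try apply Rabs_pos; try easy.
- eapply Rle_trans; [apply Rabs_triang|]. pose proof (peval_mag (fst n)). lra.
- apply peval_mag.
Qed.

Lemma peval_split (k : nat) (p : zpoly) :
  Rabs (peval p - peval (firstn k p)) <= IZR (mag (skipn k p)).
Proof.
revert p; induction k as [|k IH]; intros p.
- simpl. rewrite Rminus_0_r. apply peval_mag.
- destruct p as [|a p]; simpl; [rewrite Rminus_0_r, Rabs_R0; lra|].
  replace (IZR a + t * peval p - (IZR a + t * peval (firstn k p)))
    with (t * (peval p - peval (firstn k p))) by ring.
  rewrite Rabs_mult, (Rabs_pos_eq t) by lra.
  specialize (IH p). pose proof (Rabs_pos (peval p - peval (firstn k p))). nra.
Qed.

Lemma peval_shiftr (k : Z) (p : zpoly) : (0 <= k)%Z ->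
  0 <= peval p - IZR (Z.shiftl 1 k) * peval (map (fun c => Z.shiftr c k) p)
    <= IZR (Z.shiftl 1 k) * IZR (Z.of_nat (length p)).
Proof.
intros hk.
assert (h : 0 <= IZR (Z.shiftl 1 k)) by (apply IZR_le; rewrite Z.shiftl_1_l; apply Z.pow_nonneg; lia).
induction p as [|c p IH]; cbn [map peval length]; [simpl; lra|].
pose proof (shiftr_bounds c k hk) as b.
rewrite Nat2Z.inj_succ, succ_IZR.
assert (0 <= IZR (Z.of_nat (length p))) by (apply IZR_le; lia).
set (e := peval p - _) in IH.
replace (IZR c + t * peval p -
  IZR (Z.shiftl 1 k) * (IZR (Z.shiftr c k) + t * peval (map (fun c => Z.shiftr c k) p)))
  with (IZR c - IZR (Z.shiftr c k) * IZR (Z.shiftl 1 k) + t * e) by (unfold e; ring).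
nra.
Qed.

Lemma approx_round (S x : R) (k : Z) (m : model) : (0 <= k)%Z ->
  approx (S * IZR (Z.shiftl 1 k)) x m -> approx S x (mround k m).
Proof.
intros hk h. unfold approx, mround in *; cbn [fst snd].
set (s := IZR (Z.shiftl 1 k)) in *.
assert (hs : 1 <= s) by (apply IZR_le; rewrite Z.shiftl_1_l; pose proof (Z.pow_pos_nonneg 2 k); lia).
pose proof (peval_split 4 (fst m)) as h1.
pose proof (peval_shiftr k (firstn 4 (fst m)) hk) as h2. fold s in h2.
set (p := firstn 4 (fst m)) in *.
set (q := map _ p) in *.
pose proof (shiftr_bounds (snd m + mag (skipn 4 (fst m))) k hk) as h3. fold s in h3.
rewrite !plus_IZR in *.
apply Rabs_le_bounds in h. apply Rabs_le_bounds in h1.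
apply Rabs_le. split; apply (Rmult_le_reg_r s); nra.
Qed.

Lemma approx_upper (S x : R) (m : model) : approx S x m -> S * x <= IZR (upper m).
Proof.
unfold approx, upper; intros h. apply Rabs_le_bounds in h.
destruct (fst m) as [|c p]; simpl in *; [lra|].
pose proof (peval_possum p). rewrite !plus_IZR. lra.
Qed.

Lemma approx_nonneg (S x : R) (m : model) : 0 < S ->
  approx S x m -> certified_nonneg m = true -> 0 <= x.
Proof.
intros hS h hn. apply Z.leb_le, IZR_le in hn.
pose proof (approx_upper _ _ _ (approx_scal _ _ (-1) _ h)). simpl in *. nra.
Qed.

Lemma approx_const (S x : R) (z : Z) : S * x = IZR z -> approx S x (mconst z).
Proof.
intros e; unfold approx; simpl. rewrite e.
replace (IZR z - (IZR z + t * 0)) with 0 by ring. rewrite Rabs_R0; lra.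
Qed.

Lemma approx_linear (S x : R) (z w : Z) : S * x = IZR z + IZR w * t -> approx S x ([z; w], 0%Z).
Proof.
intros e; unfold approx; simpl. rewrite e.
replace (_ - _) with 0 by ring. rewrite Rabs_R0; lra.
Qed.

End Models.

(** * Polyhedral balls *)

Definition comb (c1 : R) (v1 : R * R) (c2 : R) (v2 : R * R) : R * R :=
  (c1 * fst v1 + c2 * fst v2, c1 * snd v1 + c2 * snd v2).

Definition atom (p : Z * Z) : R * R := (IZR (fst p) / 1000, IZR (snd p) / 1000).

(* [Ball atoms r v]: [v] lies in [r] times the symmetric convex hull of the atoms. *)
Inductive Ball (atoms : list (Z * Z)) : R -> R * R -> Prop :=
| Ball_atom p : In p atoms -> Ball atoms 1 (atom p)
| Ball_comb c1 r1 v1 c2 r2 v2 : Ball atoms r1 v1 -> Ball atoms r2 v2 ->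
    Ball atoms (Rabs c1 * r1 + Rabs c2 * r2) (comb c1 v1 c2 v2)
| Ball_weak r r' v : Ball atoms r v -> r <= r' -> Ball atoms r' v.

Definition linear_map (f : R * R -> R * R) : Prop :=
  forall c1 v1 c2 v2, f (comb c1 v1 c2 v2) = comb c1 (f v1) c2 (f v2).

Lemma linear_comp (f g : R * R -> R * R) : linear_map f -> linear_map g -> linear_map (fun v => f (g v)).
Proof. intros hf hg c1 v1 c2 v2. now rewrite hg, hf. Qed.

Lemma linear_dinv (a : R) (b : bool) : linear_map (dinv a b).
Proof. intros c1 v1 c2 v2. unfold dinv, comb, Rdiv; simpl. f_equal; ring. Qed.

Lemma norm1_nonneg (v : R * R) : 0 <= norm1 v.
Proof. unfold norm1. pose proof (Rabs_pos (fst v)). pose proof (Rabs_pos (snd v)). lra. Qed.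

Lemma Ball_nonneg (atoms : list (Z * Z)) (r : R) (v : R * R) : Ball atoms r v -> 0 <= r.
Proof.
induction 1; [lra| |lra].
pose proof (Rabs_pos c1). pose proof (Rabs_pos c2). nra.
Qed.

(** This turns the contraction of a ball into a finite check, one condition per atom. *)
Lemma Ball_linear (atoms : list (Z * Z)) (f : R * R -> R * R) (k : R) :
  linear_map f -> (forall p, In p atoms -> Ball atoms k (f (atom p))) ->
  forall r v, Ball atoms r v -> Ball atoms (k * r) (f v).
Proof.
intros hf hp r v. induction 1 as [p hpi|c1 r1 v1 c2 r2 v2 _ IH1 _ IH2|r r' v hb IH hr].
- rewrite Rmult_1_r. auto.
- rewrite hf. replace (k * _) with (Rabs c1 * (k * r1) + Rabs c2 * (k * r2)) by ring.
  now apply Ball_comb.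
- apply Ball_weak with (1 := IH).
  destruct (Rle_lt_dec 0 k) as [hk|hk]; [now apply Rmult_le_compat_l|].
  (* a negative [k] forces every radius to vanish *)
  pose proof (Ball_nonneg _ _ _ hb). pose proof (Ball_nonneg _ _ _ IH).
  exfalso. assert (H1 : exists p, In p atoms).
  { clear -hb. induction hb; eauto. }
  destruct H1 as [p hpi]. pose proof (Ball_nonneg _ _ _ (hp p hpi)). lra.
Qed.

Lemma Ball_norm1 (atoms : list (Z * Z)) (v : R * R) :
  In (1000, 0)%Z atoms -> In (0, 1000)%Z atoms -> Ball atoms (norm1 v) v.
Proof.
intros h1 h2. destruct v as [x y].
pose proof (Ball_comb _ x _ _ y _ _ (Ball_atom _ _ h1) (Ball_atom _ _ h2)) as h.
unfold comb, atom, norm1 in *; simpl in *.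
replace (x * (1000 / 1000) + y * (0 / 1000)) with x in h by field.
replace (x * (0 / 1000) + y * (1000 / 1000)) with y in h by field.
now rewrite !Rmult_1_r in h.
Qed.

Lemma norm1_comb (c1 : R) (v1 : R * R) (c2 : R) (v2 : R * R) :
  norm1 (comb c1 v1 c2 v2) <= Rabs c1 * norm1 v1 + Rabs c2 * norm1 v2.
Proof.
unfold norm1, comb; simpl.
pose proof (Rabs_triang (c1 * fst v1) (c2 * fst v2)).
pose proof (Rabs_triang (c1 * snd v1) (c2 * snd v2)).
rewrite !Rabs_mult in *. lra.
Qed.

Lemma norm1_Ball (atoms : list (Z * Z)) : exists B, 0 < B /\
  forall r v, Ball atoms r v -> norm1 v <= B * r.
Proof.
assert (hB : exists B, 0 < B /\ forall p, In p atoms -> norm1 (atom p) <= B).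
{ induction atoms as [|p l [B [hB IH]]].
  - exists 1; split; [lra|easy].
  - exists (B + norm1 (atom p)). pose proof (norm1_nonneg (atom p)). split; [lra|].
    intros q [<-|hq]; [lra|]. specialize (IH q hq). lra. }
destruct hB as [B [hB H]]. exists B; split; [easy|].
intros r v. induction 1 as [p hp|c1 r1 v1 c2 r2 v2 _ IH1 _ IH2|r r' v hb IH hr].
- specialize (H p hp). lra.
- eapply Rle_trans; [apply norm1_comb|].
  pose proof (Rabs_pos c1). pose proof (Rabs_pos c2). nra.
- nra.
Qed.

(** * The form adapted to the minus branch *)

Section Quadratic.
Variable a : R.
Hypotheses (a_pos : 0 < a) (a_lt : a < 1 / 2).

Let d := det a.

(* The quadratic form which the derivative of the minus branch multiplies by [det a]. *)
Definition quad (v : R * R) : R := d * fst v ^ 2 + 2 * a * fst v * snd v + snd v ^ 2.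

Let polar (v w : R * R) : R :=
  d * fst v * fst w + a * (fst v * snd w + snd v * fst w) + snd v * snd w.

Lemma d_bounds : 1 < d < 2.
Proof. unfold d, det; lra. Qed.

Lemma quad_disc : 3 / 4 <= d - a ^ 2.
Proof. unfold d, det; nra. Qed.

Lemma quad_nonneg (v : R * R) : 0 <= quad v.
Proof.
pose proof d_bounds. pose proof quad_disc. destruct v as [x y]; unfold quad; simpl.
assert (0 <= (y + a * x) ^ 2) by apply pow2_ge_0. assert (0 <= (d - a ^ 2) * x ^ 2) by nra. nra.
Qed.

Lemma quad_minus (v : R * R) : quad (dinv a false v) = quad v / d.
Proof.
pose proof d_bounds. destruct v as [x y]; unfold quad, dinv, sign; fold d; simpl. field. lra.
Qed.

Lemma quad_plus (v : R * R) :
  quad (dinv a true v) * d = d * fst v ^ 2 - 2 * a * fst v * snd v + snd v ^ 2.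
Proof.
pose proof d_bounds. destruct v as [x y]; unfold quad, dinv, sign; fold d; simpl. field. lra.
Qed.

(** The triangle inequality for the square root of [quad], a positive definite form because d >
    a^2. *)
Lemma quad_comb (c1 r1 c2 r2 : R) (v1 v2 : R * R) : 0 <= r1 -> 0 <= r2 ->
  quad v1 <= r1 ^ 2 -> quad v2 <= r2 ^ 2 ->
  quad (comb c1 v1 c2 v2) <= (Rabs c1 * r1 + Rabs c2 * r2) ^ 2.
Proof.
intros hr1 hr2 h1 h2.
(* Cauchy-Schwarz: the defect is d - a^2 times the square of a determinant. *)
assert (hp : Rabs (polar v1 v2) <= r1 * r2).
{ apply Rsqr_incr_0_var; [|nra].
  rewrite <- Rsqr_abs. unfold Rsqr.
  assert (e : quad v1 * quad v2 - polar v1 v2 * polar v1 v2 =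
    (d - a ^ 2) * (fst v1 * snd v2 - snd v1 * fst v2) ^ 2) by (unfold quad, polar; ring).
  pose proof quad_disc. pose proof (pow2_ge_0 (fst v1 * snd v2 - snd v1 * fst v2)).
  pose proof (quad_nonneg v1). pose proof (quad_nonneg v2).
  assert (quad v1 * quad v2 <= r1 ^ 2 * r2 ^ 2) by (apply Rmult_le_compat; easy). nra. }
replace (quad (comb c1 v1 c2 v2)) with
  (c1 ^ 2 * quad v1 + 2 * (c1 * c2 * polar v1 v2) + c2 ^ 2 * quad v2)
  by (unfold quad, polar, comb; simpl; ring).
assert (c1 * c2 * polar v1 v2 <= Rabs c1 * Rabs c2 * (r1 * r2)).
{ eapply Rle_trans; [apply Rle_abs|]. rewrite !Rabs_mult.
  apply Rmult_le_compat_l; [|easy]. apply Rmult_le_pos; apply Rabs_pos. }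
assert (e1 : c1 ^ 2 = Rabs c1 ^ 2) by (rewrite RPow_abs, Rabs_pos_eq; [easy|apply pow2_ge_0]).
assert (e2 : c2 ^ 2 = Rabs c2 ^ 2) by (rewrite RPow_abs, Rabs_pos_eq; [easy|apply pow2_ge_0]).
rewrite e1, e2. pose proof (pow2_ge_0 (Rabs c1)). pose proof (pow2_ge_0 (Rabs c2)). nra.
Qed.

Lemma quad_le_norm1 (v : R * R) : quad v <= 2 * norm1 v ^ 2.
Proof.
pose proof d_bounds as hd. destruct v as [x y]; unfold quad, norm1; cbn [fst snd].
pose proof (Rabs_pos x). pose proof (Rabs_pos y).
rewrite <- (pow2_abs x), <- (pow2_abs y).
assert (h : 2 * a * x * y <= Rabs x * Rabs y).
{ apply Rle_trans with (2 * a * (Rabs x * Rabs y)).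
  - rewrite <- Rabs_mult, Rmult_assoc. apply Rmult_le_compat_l; [lra|apply Rle_abs].
  - assert (0 <= Rabs x * Rabs y) by now apply Rmult_le_pos. nra. }
assert (d * Rabs x ^ 2 <= 2 * Rabs x ^ 2) by (apply Rmult_le_compat_r; [apply pow2_ge_0|lra]).
pose proof (pow2_ge_0 (Rabs x)). pose proof (pow2_ge_0 (Rabs y)).
assert (0 <= Rabs x * Rabs y) by now apply Rmult_le_pos. nra.
Qed.

Lemma norm1_le_quad (v : R * R) : norm1 v ^ 2 <= 8 * quad v.
Proof.
pose proof d_bounds. destruct v as [x y]; unfold quad, norm1; cbn [fst snd].
apply Rle_trans with (2 * (x ^ 2 + y ^ 2)).
- rewrite <- (pow2_abs x), <- (pow2_abs y). pose proof (pow2_ge_0 (Rabs x - Rabs y)). nra.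
(* Completing the square in 8 [quad] - 2(x^2 + y^2). *)
- pose proof (pow2_ge_0 (3 * y + 4 * a * x)).
  assert (0 <= (d - 4 / 3 * a ^ 2 - 1/4) * x ^ 2) by
    (apply Rmult_le_pos; [unfold d, det in *; nra|apply pow2_ge_0]).
  nra.
Qed.

(* Cauchy-Schwarz for the form dual to [quad]. *)
Lemma row_bound (r1 r2 : R) (v : R * R) :
  (r1 * fst v + r2 * snd v) ^ 2 * (d - a ^ 2) <=
  (r1 ^ 2 - 2 * a * r1 * r2 + d * r2 ^ 2) * quad v.
Proof.
destruct v as [x y]; unfold quad; simpl.
assert (H : (r1 ^ 2 - 2 * a * r1 * r2 + d * r2 ^ 2) * (d * x ^ 2 + 2 * a * x * y + y ^ 2)
  - (r1 * x + r2 * y) ^ 2 * (d - a ^ 2) = (a * (r1 * x - r2 * y) + (r1 * y - d * r2 * x)) ^ 2) by ring.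
pose proof (pow2_ge_0 (a * (r1 * x - r2 * y) + (r1 * y - d * r2 * x))). simpl in *. nra.
Qed.

Fixpoint minuses (n : nat) (v : R * R) : R * R :=
  match n with
  | O => v
  | S n' => dinv a false (minuses n' v)
  end.

Lemma quad_minuses (th : R) (n : nat) (v : R * R) : 1 <= d * th ^ 2 ->
  quad (minuses n v) <= (th ^ n) ^ 2 * quad v.
Proof.
intros h. pose proof d_bounds. induction n as [|n IH]; simpl; [lra|].
rewrite quad_minus. apply (Rmult_le_reg_l d); [lra|].
replace (d * (quad (minuses n v) / d)) with (quad (minuses n v)) by (field; lra).
eapply Rle_trans; [exact IH|].
pose proof (quad_nonneg v). pose proof (pow2_ge_0 (th ^ n)).
assert (0 <= (th ^ n) ^ 2 * quad v) by nra. simpl in *. nra.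
Qed.

(** The constant 4 is the square root of 2 times 8, the price of passing from [norm1] to [quad] and
    back. *)
Lemma norm1_minuses (th : R) (n : nat) (v : R * R) : 0 <= th -> 1 <= d * th ^ 2 ->
  norm1 (minuses n v) <= 4 * th ^ n * norm1 v.
Proof.
intros h0 h.
assert (0 <= th ^ n) by now apply pow_le.
pose proof (norm1_nonneg v). pose proof (norm1_nonneg (minuses n v)).
apply Rsqr_incr_0_var; [unfold Rsqr|nra].
pose proof (norm1_le_quad (minuses n v)). pose proof (quad_minuses th n v h).
pose proof (quad_le_norm1 v).
assert ((th ^ n) ^ 2 * quad v <= (th ^ n) ^ 2 * (2 * norm1 v ^ 2)) by
  (apply Rmult_le_compat_l; [apply pow2_ge_0|easy]).
simpl in *. nra.
Qed.

Lemma norm1_dinv (b : bool) (v : R * R) : norm1 (dinv a b v) <= 3 * norm1 v.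
Proof.
pose proof d_bounds. destruct v as [x y]; unfold norm1, dinv; fold d; simpl.
assert (hs : Rabs (sign b) = 1) by (destruct b; simpl; [apply Rabs_R1|rewrite Rabs_left; lra]).
unfold Rdiv. rewrite Rabs_mult, (Rabs_pos_eq (/ d)) by (apply Rlt_le, Rinv_0_lt_compat; lra).
assert (h : Rabs (sign b * y - 2 * a * x) <= Rabs y + Rabs x).
{ unfold Rminus. eapply Rle_trans; [apply Rabs_triang|].
  rewrite Rabs_Ropp, !Rabs_mult, hs, (Rabs_pos_eq 2), (Rabs_pos_eq a) by lra.
  pose proof (Rabs_pos x). nra. }
assert (h2 : / d <= 1) by (rewrite <- Rinv_1; apply Rinv_le_contravar; lra).
assert (0 < / d) by (apply Rinv_0_lt_compat; lra).
pose proof (Rabs_pos x). pose proof (Rabs_pos y).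
pose proof (Rabs_pos (sign b * y - 2 * a * x)). nra.
Qed.

End Quadratic.

Local Notation N := (IZR scale).
Local Notation U := (IZR unity).

Lemma scale_pos : 0 < N.
Proof. now apply IZR_lt. Qed.

Lemma unity_pos : 0 < U.
Proof. now apply IZR_lt. Qed.

(** * Soundness of the checker *)

Definition sat (X : R * R) (h : halfplane) : Prop :=
  let '(a, b, c) := h in 0 <= IZR a * fst X + IZR b * snd X + IZR c.

Lemma farkas_sound (X : R * R) (h1 h2 h3 : halfplane) :
  sat X h1 -> sat X h2 -> sat X h3 -> farkas h1 h2 h3 = true -> False.
Proof.
destruct h1 as [[a1 b1] c1], h2 as [[a2 b2] c2], h3 as [[a3 b3] c3], X as [x y].
unfold sat, farkas; simpl; intros s1 s2 s3 H.
set (l1 := (a2 * b3 - a3 * b2)%Z) in *. set (l2 := (a3 * b1 - a1 * b3)%Z) in *.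
set (l3 := (a1 * b2 - a2 * b1)%Z) in *. set (g := (l1 * c1 + l2 * c2 + l3 * c3)%Z) in *.
assert (e : IZR l1 * (IZR a1 * x + IZR b1 * y + IZR c1) + IZR l2 * (IZR a2 * x + IZR b2 * y + IZR c2)
  + IZR l3 * (IZR a3 * x + IZR b3 * y + IZR c3) = IZR g).
{ unfold g, l1, l2, l3. rewrite !plus_IZR, !mult_IZR, !minus_IZR, !mult_IZR. ring. }
destruct (l1 <? 0)%Z eqn:h1.
- destruct (l2 <=? 0)%Z eqn:h2; [|easy]. destruct (l3 <=? 0)%Z eqn:h3; [|easy].
  apply Z.ltb_lt, IZR_lt in h1. apply Z.leb_le, IZR_le in h2, h3. apply Z.ltb_lt, IZR_lt in H. nra.
- destruct (0 <=? l2)%Z eqn:h2; [|easy]. destruct (0 <=? l3)%Z eqn:h3; [|easy].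
  apply Z.ltb_ge, IZR_le in h1. apply Z.leb_le, IZR_le in h2, h3. apply Z.ltb_lt, IZR_lt in H. nra.
Qed.

Lemma infeasible_sound (X : R * R) (h : halfplane) (hs : list halfplane) (i j : Z) :
  sat X h -> (forall h', In h' hs -> sat X h') -> infeasible h hs i j = true -> False.
Proof.
unfold infeasible, znth; intros s H.
destruct (nth_error hs (Z.to_nat i)) as [h1|] eqn:e1; [|easy].
destruct (nth_error hs (Z.to_nat j)) as [h2|] eqn:e2; [|easy].
exact (farkas_sound X h1 h2 h (H _ (nth_error_In _ _ e1)) (H _ (nth_error_In _ _ e2)) s).
Qed.

Section Verify.
Variables (c : cell) (a t : R).
Hypotheses (a_pos : 0 < a) (a_lt : a < 1 / 2) (t01 : 0 <= t <= 1).
Hypothesis a_cell : N * a = IZR (cA c) + IZR (cW c) * t.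

Local Notation ap := (approx t).

Lemma ap_ma : ap N a (ma c).
Proof. now apply approx_linear. Qed.

Lemma ap_m2a : ap N (2 * a) (m2a c).
Proof. apply approx_linear. rewrite !mult_IZR. lra. Qed.

Lemma ap_md : ap N (det a) (md c).
Proof.
apply approx_linear. rewrite minus_IZR, !mult_IZR.
change (IZR (-2)) with (-2). unfold det. lra.
Qed.

Lemma ap_m1a : ap N (1 - a) (m1a c).
Proof. apply approx_linear. rewrite minus_IZR, opp_IZR. lra. Qed.

Lemma ap_times (x y : R) (m n : model) : ap N x m -> ap U y n -> ap U (x * y) (times m n).
Proof.
intros h1 h2. apply (approx_round t t01); [easy|].
change (IZR (Z.shiftl 1 lscale)) with N.
rewrite (Rmult_comm U). now apply (approx_mul t t01).
Qed.

Lemma ap_shift (S x : R) (k : Z) (m : model) : ap S x m -> ap (S * IZR k) x (mscal k m).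
Proof.
intros h. apply (approx_scal t S x k) in h. unfold approx in *.
now rewrite Rmult_assoc.
Qed.

Lemma ap_conv (S S' x x' : R) (m : model) : S * x = S' * x' -> ap S x m -> ap S' x' m.
Proof. unfold approx. now intros ->. Qed.

Section Point.
Variable X : R * R.
Hypothesis X_nonneg : 0 <= fst X /\ 0 <= snd X.

Definition aff (S : R) (A : affine) (x : R) : Prop :=
  let '(m1, m2, m3) := A in
  exists x1 x2 x3, ap S x1 m1 /\ ap S x2 m2 /\ ap S x3 m3 /\
    x = x1 * fst X + x2 * snd X + x3.

Lemma aff_map2 (S x y : R) (A B : affine) : aff S A x -> aff S B y -> aff S (amap2 madd A B) (x + y).
Proof.
destruct A as [[m1 m2] m3], B as [[n1 n2] n3].
intros [x1 [x2 [x3 [h1 [h2 [h3 e]]]]]] [y1 [y2 [y3 [k1 [k2 [k3 f]]]]]].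
exists (x1 + y1), (x2 + y2), (x3 + y3). repeat split; try now apply approx_add.
rewrite e, f; ring.
Qed.

Lemma aff_sub (S x y : R) (A B : affine) : aff S A x -> aff S B y -> aff S (amap2 msub A B) (x - y).
Proof.
destruct A as [[m1 m2] m3], B as [[n1 n2] n3].
intros [x1 [x2 [x3 [h1 [h2 [h3 e]]]]]] [y1 [y2 [y3 [k1 [k2 [k3 f]]]]]].
exists (x1 - y1), (x2 - y2), (x3 - y3). repeat split; try now apply approx_sub.
rewrite e, f; ring.
Qed.

Lemma aff_scal (S x : R) (k : Z) (A : affine) : aff S A x -> aff S (amap (mscal k) A) (IZR k * x).
Proof.
destruct A as [[m1 m2] m3].
intros [x1 [x2 [x3 [h1 [h2 [h3 e]]]]]].
exists (IZR k * x1), (IZR k * x2), (IZR k * x3). repeat split; try now apply approx_scal.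
rewrite e; ring.
Qed.

Lemma aff_times (x y : R) (m : model) (A : affine) : ap N x m -> aff U A y ->
  aff U (amap (times m) A) (x * y).
Proof.
destruct A as [[m1 m2] m3].
intros h [x1 [x2 [x3 [h1 [h2 [h3 e]]]]]].
exists (x * x1), (x * x2), (x * x3). repeat split; try now apply ap_times.
rewrite e; ring.
Qed.

Lemma aff_const (S x : R) (z : Z) : S * x = IZR z -> aff S (const z) x.
Proof.
intros e. exists 0, 0, x.
repeat split; try (apply approx_const; simpl; lra). ring.
Qed.

Lemma enclose_sound (k : Z) (x : R) (A : affine) : (0 <= k)%Z -> 0 <= x ->
  aff (IZR (Z.shiftl 1 k)) A x -> sat X (enclose k A).
Proof.
destruct A as [[m1 m2] m3]. intros hk hx [x1 [x2 [x3 [h1 [h2 [h3 e]]]]]].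
assert (H : forall y m, ap (IZR (Z.shiftl 1 k)) y m ->
  131072 * y <= IZR (Z.shiftr (Z.shiftl (upper m) 17) k + 1)).
{ intros y m h. apply (approx_upper t t01) in h.
  pose proof (shiftr_bounds (Z.shiftl (upper m) 17) k hk) as b.
  rewrite Z.shiftl_mul_pow2 in b by easy. rewrite mult_IZR in b.
  change (IZR (2 ^ 17)) with 131072 in b. rewrite Z.shiftl_mul_pow2 by easy.
  rewrite plus_IZR.
  assert (0 < IZR (Z.shiftl 1 k)) by (apply IZR_lt; rewrite Z.shiftl_1_l; apply Z.pow_pos_nonneg; lia).
  apply (Rmult_le_reg_r (IZR (Z.shiftl 1 k))); [easy|]. lra. }
unfold sat, enclose. pose proof (H _ _ h1). pose proof (H _ _ h2). pose proof (H _ _ h3).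
nra.
Qed.

(** [X] is the start of the word, [p] the point reached, [f] the inverse derivative of the word and
    [k] the power of [det] clearing its denominators. The half-planes constrain [X], so those
    collected at earlier symbols remain valid. *)
Record inv (p : R * R) (f : R * R -> R * R) (k : R) (n : node) : Prop := {
  inv_x : aff U (nx n) (fst p);
  inv_y : aff U (ny n) (snd p);
  inv_k : 0 < k;
  inv_dk : ap U k (ndk n);
  inv_11 : ap U (k * fst (f (1, 0))) (n11 n);
  inv_12 : ap U (k * fst (f (0, 1))) (n12 n);
  inv_21 : ap U (k * snd (f (1, 0))) (n21 n);
  inv_22 : ap U (k * snd (f (0, 1))) (n22 n);
  inv_lin : linear_map f;
  inv_hs : forall h, In h (nhs n) -> sat X h }.

Lemma level_sound (p : R * R) (f : R * R -> R * R) (k : R) (n : node) :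
  inv p f k n -> aff U (nlevel c n) (level a p).
Proof.
intros i. apply aff_map2; apply aff_times.
- apply ap_ma.
- apply (inv_y _ _ _ _ i).
- apply ap_m1a.
- apply (inv_x _ _ _ _ i).
Qed.

Lemma half_sound (p : R * R) (l : affine) : aff U l (level a p) -> sat X (half l (plus a p)).
Proof.
intros h. apply enclose_sound with (IZR (- sgn (plus a p)) * (IZR 2 * level a p - 1)).
- easy.
- destruct (plus a p) eqn:e.
  + apply plus_true in e. simpl. lra.
  + apply plus_false in e. simpl. lra.
- apply aff_scal, aff_sub; [now apply aff_scal|].
  apply aff_const. apply Rmult_1_r.
Qed.

Lemma linear_apply (f : R * R -> R * R) (v : R * R) : linear_map f ->
  f v = comb (fst v) (f (1, 0)) (snd v) (f (0, 1)).
Proof.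
intros h. rewrite <- h. f_equal. destruct v; unfold comb; simpl. f_equal; ring.
Qed.

Lemma child_sound (p : R * R) (f : R * R -> R * R) (k : R) (n : node) (hs : list halfplane) :
  inv p f k n -> (forall h, In h hs -> sat X h) ->
  inv (G a p) (fun v => f (dinv a (plus a p) v)) (det a * k)
    (child c n (nlevel c n) (plus a p) hs).
Proof.
intros i hhs. pose proof (det_bounds a a_pos a_lt) as hd.
assert (e1 : f (dinv a (plus a p) (1, 0)) =
  comb (- (2 * a) / det a) (f (1, 0)) 1 (f (0, 1))).
{ rewrite (linear_apply f _ (inv_lin _ _ _ _ i)). unfold dinv, comb; simpl. f_equal; field; lra. }
assert (e2 : f (dinv a (plus a p) (0, 1)) =
  comb (sign (plus a p) / det a) (f (1, 0)) 0 (f (0, 1))).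
{ rewrite (linear_apply f _ (inv_lin _ _ _ _ i)). unfold dinv, comb; simpl. f_equal; field; lra. }
assert (hs' : sign (plus a p) = IZR (sgn (plus a p))) by (now destruct (plus a p)).
pose proof (inv_k _ _ _ _ i).
split; cbn [nx ny n11 n12 n21 n22 ndk nhs child].
- replace (fst (G a p)) with (snd p) by easy. apply (inv_y _ _ _ _ i).
- replace (snd (G a p)) with
    (IZR (2 * sgn (plus a p)) * level a p + (if plus a p then 0 else 2)).
  + apply aff_map2; [apply aff_scal, (level_sound _ _ _ _ i)|].
    destruct (plus a p); apply aff_const; [lra|]. rewrite mult_IZR. lra.
  + destruct (plus a p) eqn:e; [rewrite (G_plus _ _ e)|rewrite (G_minus _ _ e)]; simpl; lra.
- nra.
- apply ap_times; [apply ap_md|apply (inv_dk _ _ _ _ i)].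
- rewrite e1. replace (det a * k * _) with
    (det a * (k * fst (f (0, 1))) - 2 * a * (k * fst (f (1, 0)))) by (simpl; field; lra).
  apply approx_sub; apply ap_times; [apply ap_md|apply (inv_12 _ _ _ _ i)|apply ap_m2a|apply (inv_11 _ _ _ _ i)].
- rewrite e2, hs'. replace (det a * k * _) with
    (IZR (sgn (plus a p)) * (k * fst (f (1, 0)))) by (simpl; field; lra).
  apply approx_scal, (inv_11 _ _ _ _ i).
- rewrite e1. replace (det a * k * _) with
    (det a * (k * snd (f (0, 1))) - 2 * a * (k * snd (f (1, 0)))) by (simpl; field; lra).
  apply approx_sub; apply ap_times; [apply ap_md|apply (inv_22 _ _ _ _ i)|apply ap_m2a|apply (inv_21 _ _ _ _ i)].
- rewrite e2, hs'. replace (det a * k * _) with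
    (IZR (sgn (plus a p)) * (k * snd (f (1, 0)))) by (simpl; field; lra).
  apply approx_scal, (inv_21 _ _ _ _ i).
- apply linear_comp; [apply (inv_lin _ _ _ _ i)|apply linear_dinv].
- easy.
Qed.

Lemma accept_sound (p : R * R) (f : R * R -> R * R) (k : R) (n : node) (hints : list Z) :
  inv p f k n -> accept c n hints = true ->
  forall r v, Ball (catoms c) r v -> Ball (catoms c) (9999 / 10000 * r) (f v).
Proof.
intros i H. apply Ball_linear; [apply (inv_lin _ _ _ _ i)|].
intros [x y] hin. destruct (every2_In _ _ _ _ H hin) as [h H1].
unfold znth in H1.
destruct (nth_error (catoms c) (Z.to_nat (h / 10))) as [[p1 p2]|] eqn:n1; [|easy].
destruct (nth_error (catoms c) (Z.to_nat (h mod 10))) as [[q1 q2]|] eqn:n2; [|easy].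
apply nth_error_In in n1, n2.
pose proof (inv_k _ _ _ _ i) as hk.
set (w1 := IZR x * (k * fst (f (1, 0))) + IZR y * (k * fst (f (0, 1)))).
set (w2 := IZR x * (k * snd (f (1, 0))) + IZR y * (k * snd (f (0, 1)))).
set (v1 := madd (mscal x (n11 n)) (mscal y (n12 n))) in H1.
set (v2 := madd (mscal x (n21 n)) (mscal y (n22 n))) in H1.
assert (a1 : ap U w1 v1) by (apply approx_add; apply approx_scal; [apply (inv_11 _ _ _ _ i)|apply (inv_12 _ _ _ _ i)]).
assert (a2 : ap U w2 v2) by (apply approx_add; apply approx_scal; [apply (inv_21 _ _ _ _ i)|apply (inv_22 _ _ _ _ i)]).
unfold decomposes in H1; cbn [fst snd] in H1.
set (D := (p1 * q2 - p2 * q1)%Z) in H1.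
set (c1 := mscal 10000 (msub (mscal q2 v1) (mscal q1 v2))) in H1.
set (c2 := mscal 10000 (msub (mscal p1 v2) (mscal p2 v1))) in H1.
set (B := mscal (9999 * Z.abs D) (ndk n)) in H1.
assert (b1 : ap U (IZR 10000 * (IZR q2 * w1 - IZR q1 * w2)) c1) by
  (apply approx_scal, approx_sub; now apply approx_scal).
assert (b2 : ap U (IZR 10000 * (IZR p1 * w2 - IZR p2 * w1)) c2) by
  (apply approx_scal, approx_sub; now apply approx_scal).
assert (b3 : ap U (IZR (9999 * Z.abs D) * k) B) by (apply approx_scal, (inv_dk _ _ _ _ i)).
destruct (negb (D =? 0)%Z) eqn:g0; [|easy].
destruct (certified_nonneg (madd B (madd c1 c2))) eqn:g1; [|easy].
destruct (certified_nonneg (madd B (msub c1 c2))) eqn:g2; [|easy].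
destruct (certified_nonneg (msub B (madd c1 c2))) eqn:g3; [|easy].
pose proof (approx_nonneg t t01 U _ _ unity_pos (approx_add t _ _ _ _ _ b3 (approx_add t _ _ _ _ _ b1 b2)) g1) as f1.
pose proof (approx_nonneg t t01 U _ _ unity_pos (approx_add t _ _ _ _ _ b3 (approx_sub t _ _ _ _ _ b1 b2)) g2) as f2.
pose proof (approx_nonneg t t01 U _ _ unity_pos (approx_sub t _ _ _ _ _ b3 (approx_add t _ _ _ _ _ b1 b2)) g3) as f3.
pose proof (approx_nonneg t t01 U _ _ unity_pos (approx_sub t _ _ _ _ _ b3 (approx_sub t _ _ _ _ _ b1 b2)) H1) as f4.
rewrite mult_IZR, abs_IZR in *.
assert (hD : IZR D <> 0).
{ apply eq_IZR_contrapositive. intros e. rewrite e in g0. easy. }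
assert (eD : IZR D = IZR p1 * IZR q2 - IZR p2 * IZR q1) by
  (unfold D; rewrite minus_IZR, !mult_IZR; ring).
set (s1 := (IZR q2 * w1 - IZR q1 * w2) / (IZR D * k)).
set (s2 := (IZR p1 * w2 - IZR p2 * w1) / (IZR D * k)).
apply Ball_weak with (Rabs s1 * 1 + Rabs s2 * 1).
- replace (f (atom (x, y))) with (comb s1 (atom (p1, p2)) s2 (atom (q1, q2))).
  + apply Ball_comb; now apply Ball_atom.
  + rewrite (linear_apply f (atom (x, y)) (inv_lin _ _ _ _ i)).
    unfold comb, atom, s1, s2, w1, w2; cbn [fst snd]. rewrite eD. rewrite eD in hD.
    f_equal; field; split; lra.
- assert (hDp : 0 < Rabs (IZR D)) by now apply Rabs_pos_lt.
  unfold s1, s2, Rdiv. rewrite !Rabs_mult, Rabs_inv, Rabs_mult, (Rabs_pos_eq k) by lra.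
  set (z1 := IZR q2 * w1 - IZR q1 * w2) in *. set (z2 := IZR p1 * w2 - IZR p2 * w1) in *.
  apply (Rmult_le_reg_r (Rabs (IZR D) * k)); [nra|].
  replace ((Rabs z1 * / (Rabs (IZR D) * k) * 1 + Rabs z2 * / (Rabs (IZR D) * k) * 1) * (Rabs (IZR D) * k))
    with (Rabs z1 + Rabs z2) by (field; lra).
  assert (Rabs z1 + Rabs z2 <= 9999 / 10000 * (Rabs (IZR D) * k)); [|lra].
  unfold Rabs at 1 2. destruct (Rcase_abs z1), (Rcase_abs z2); lra.
Qed.

Lemma tail_row_sound (k x1 x2 : R) (n : node) (r1 r2 : model) (v : R * R) :
  0 < k -> ap U k (ndk n) -> ap U (k * x1) r1 -> ap U (k * x2) r2 -> 0 <= IZR (cK c) ->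
  tail_row c n r1 r2 = true ->
  IZR (cK c) / 1000 * (x1 * fst v + x2 * snd v) ^ 2 <= (9999 / 10000) ^ 2 * quad a v.
Proof.
intros hk h0 h1 h2 hK H.
pose proof (approx_mul t t01 _ _ _ _ _ _ h0 h0) as h00.
pose proof (approx_mul t t01 _ _ _ _ _ _ h1 h1) as h11.
pose proof (approx_mul t t01 _ _ _ _ _ _ h1 h2) as h12.
pose proof (approx_mul t t01 _ _ _ _ _ _ h2 h2) as h22.
pose proof (approx_mul t t01 _ _ _ _ _ _
  (approx_sub t _ _ _ _ _ (ap_shift _ _ scale _ ap_md) (approx_mul t t01 _ _ _ _ _ _ ap_ma ap_ma)) h00) as hR.
pose proof (approx_scal t _ _ (scale * scale) _ h11) as k11.
pose proof (approx_scal t _ _ (- scale) _ (approx_mul t t01 _ _ _ _ _ _ ap_m2a h12)) as k12.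
pose proof (approx_scal t _ _ scale _ (approx_mul t t01 _ _ _ _ _ _ ap_md h22)) as k22.
set (S := N * N * (U * U)) in *.
assert (j11 : ap S (k * x1 * (k * x1)) (mscal (scale * scale) (mmul r1 r1))) by
  (refine (ap_conv _ _ _ _ _ _ k11); unfold S; rewrite mult_IZR; ring).
assert (j12 : ap S (- (2 * a * (k * x1 * (k * x2)))) (mscal (- scale) (mmul (m2a c) (mmul r1 r2)))) by
  (refine (ap_conv _ _ _ _ _ _ k12); unfold S; rewrite opp_IZR; ring).
assert (j22 : ap S (det a * (k * x2 * (k * x2))) (mscal scale (mmul (md c) (mmul r2 r2)))) by
  (refine (ap_conv _ _ _ _ _ _ k22); unfold S; ring).
pose proof (approx_sub t _ _ _ _ _ (approx_scal t _ _ (9999 * 9999 * 1000) _ hR)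
  (approx_scal t _ _ (10000 * 10000 * cK c) _ (approx_add t _ _ _ _ _ j11 (approx_add t _ _ _ _ _ j12 j22)))) as hf.
assert (hS : 0 < S) by exact (Rmult_lt_0_compat _ _ (Rmult_lt_0_compat _ _ scale_pos scale_pos)
  (Rmult_lt_0_compat _ _ unity_pos unity_pos)).
pose proof (approx_nonneg t t01 S _ _ hS hf H) as g. clear - hk hK g a_pos a_lt.
rewrite !mult_IZR in g.
pose proof (row_bound a x1 x2 v) as rb. pose proof (quad_disc a a_pos a_lt) as hd.
pose proof (quad_nonneg a a_pos a_lt v) as hq.
set (q := x1 ^ 2 - 2 * a * x1 * x2 + det a * x2 ^ 2) in *.
assert (g1 : 10000 * 10000 * IZR (cK c) * q <= 9999 * 9999 * 1000 * (det a - a ^ 2)).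
{ apply (Rmult_le_reg_r (k * k)); [nra|]. unfold q. simpl in *. lra. }
set (w := (x1 * fst v + x2 * snd v) ^ 2) in *.
assert (g2 : IZR (cK c) * (w * (det a - a ^ 2)) <= IZR (cK c) * (q * quad a v)) by
  (now apply Rmult_le_compat_l).
assert (g3 : 10000 * 10000 * IZR (cK c) * q * quad a v <= 9999 * 9999 * 1000 * (det a - a ^ 2) * quad a v) by
  (now apply Rmult_le_compat_r).
apply (Rmult_le_reg_r (det a - a ^ 2)); [lra|]. simpl in *. lra.
Qed.

Lemma tail_sound (p : R * R) (f : R * R -> R * R) (k : R) (n : node) :
  inv p f k n -> 0 <= IZR (cK c) -> accept_tail c n = true ->
  forall v, IZR (cK c) / 1000 * norm1 (f v) ^ 2 <= (9999 / 10000) ^ 2 * quad a v.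
Proof.
intros i hK H v. unfold accept_tail in H.
destruct (tail_row c n (madd (n11 n) (n21 n)) (madd (n12 n) (n22 n))) eqn:H1; [|easy].
pose proof (inv_k _ _ _ _ i) as hk. pose proof (inv_dk _ _ _ _ i) as hdk.
pose proof (approx_add t _ _ _ _ _ (inv_11 _ _ _ _ i) (inv_21 _ _ _ _ i)) as p1.
pose proof (approx_add t _ _ _ _ _ (inv_12 _ _ _ _ i) (inv_22 _ _ _ _ i)) as p2.
pose proof (approx_sub t _ _ _ _ _ (inv_11 _ _ _ _ i) (inv_21 _ _ _ _ i)) as m1.
pose proof (approx_sub t _ _ _ _ _ (inv_12 _ _ _ _ i) (inv_22 _ _ _ _ i)) as m2.
rewrite <- Rmult_plus_distr_l in p1, p2. rewrite <- Rmult_minus_distr_l in m1, m2.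
pose proof (tail_row_sound _ _ _ _ _ _ v hk hdk p1 p2 hK H1) as g1.
pose proof (tail_row_sound _ _ _ _ _ _ v hk hdk m1 m2 hK H) as g2.
assert (e : norm1 (f v) = Rabs (fst (f v) + snd (f v)) \/ norm1 (f v) = Rabs (fst (f v) - snd (f v))).
{ unfold norm1, Rabs. destruct (Rcase_abs (fst (f v))), (Rcase_abs (snd (f v))),
  (Rcase_abs (fst (f v) + snd (f v))), (Rcase_abs (fst (f v) - snd (f v))); lra. }
rewrite (linear_apply f v (inv_lin _ _ _ _ i)) in e at 2 3 5 6. unfold comb in e; cbn [fst snd] in e.
destruct e as [e|e]; rewrite e, pow2_abs.
- eapply Rle_trans; [|exact g1]. right. ring.
- eapply Rle_trans; [|exact g2]. right. ring.
Qed.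

End Point.


(** Orbits are cut into blocks at such points, which follow a plus. *)
Definition arrived (p : R * R) : Prop :=
  exists q, Lam a q /\ plus a q = true /\ p = G a q.

Lemma first_plus (n : nat) (p : R * R) :
  (exists i, (i < n)%nat /\ plus a (iterG a i p) = true /\
     forall v, back a (S i) p v = minuses a i (dinv a true v)) \/
  (forall v, back a n p v = minuses a n v).
Proof.
revert p; induction n as [|n IH]; intros p; [now right|].
destruct (plus a p) eqn:e.
- left. exists 0%nat. repeat split; [lia|easy|]. intros v. simpl. now rewrite e.
- destruct (IH (G a p)) as [[i [hi [h1 h2]]]|h].
  + left. exists (S i). repeat split; [lia|easy|]. intros v.
    change (dinv a (plus a p) (back a (S i) (G a p) v) = dinv a false (minuses a i (dinv a true v))).
    now rewrite e, h2.
  + right. intros v. simpl. now rewrite e, h.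
Qed.

(** * From certificates to contracting blocks *)

Section Outcome.
Variables (th C : R) (L : nat).
Hypotheses (th_range : 0 < th < 1) (th_det : 1 <= det a * th ^ 2)
  (th_L : 9999 / 10000 <= th ^ L)
  (C_L : forall m, (m <= L)%nat -> 3 ^ S m <= C * th ^ m).

Let K : R := IZR (cK c) / 1000.
Hypotheses (atom1 : In (1000, 0)%Z (catoms c)) (atom2 : In (0, 1000)%Z (catoms c))
  (K_half : 1 / 2 <= K)
  (K_ball : forall r v, Ball (catoms c) r v -> quad a (dinv a true v) <= K * r ^ 2).

(* After the first [m] symbols, with inverse derivative [f]: within the next [n] steps the orbit
   completes a contracting block, or these [n] steps contract up to the constant [C]. *)
Definition outcome (m : nat) (f : R * R -> R * R) (p : R * R) : Prop :=
  forall n,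
  (exists j, (j <= n)%nat /\ (1 <= m + j)%nat /\ arrived (iterG a j p) /\
     forall r v, Ball (catoms c) r v -> Ball (catoms c) (th ^ (m + j) * r) (f (back a j p v))) \/
  (forall v, norm1 (f (back a n p v)) <= C * th ^ (m + n) * norm1 v).

Definition tame (m : nat) (f : R * R -> R * R) : Prop :=
  forall v, norm1 (f v) <= 3 ^ m * norm1 v.

Lemma th_le (m n : nat) : (m <= n)%nat -> th ^ n <= th ^ m.
Proof.
intros h. replace n with (m + (n - m))%nat by lia. rewrite pow_add.
rewrite <- (Rmult_1_r (th ^ m)) at 2. apply Rmult_le_compat_l; [apply pow_le; lra|].
rewrite <- (pow1 (n - m)). apply pow_incr; lra.
Qed.

Lemma th_pow (m : nat) : 0 < th ^ m.
Proof. apply pow_lt; lra. Qed.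

Lemma tame_dinv (m : nat) (f : R * R -> R * R) (b : bool) :
  tame m f -> tame (S m) (fun v => f (dinv a b v)).
Proof.
intros h v. eapply Rle_trans; [apply h|].
pose proof (norm1_dinv a a_pos a_lt b v). assert (0 < 3 ^ m) by (apply pow_lt; lra).
simpl. nra.
Qed.

Lemma outcome_step (m : nat) (f : R * R -> R * R) (p : R * R) : (m <= L)%nat -> tame m f ->
  outcome (S m) (fun v => f (dinv a (plus a p) v)) (G a p) -> outcome m f p.
Proof.
intros hm hf H [|n].
(* With no step left, the crude factor 3 per symbol is absorbed by [C], since m <= L. *)
- right. intros v. rewrite Nat.add_0_r. eapply Rle_trans; [apply hf|].
  apply Rmult_le_compat_r; [apply norm1_nonneg|].
  pose proof (C_L m hm). assert (0 < 3 ^ m) by (apply pow_lt; lra). simpl in *. lra.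
- destruct (H n) as [[j [h1 [h2 [h3 h4]]]]|h].
  + left. exists (S j). repeat split; [lia|lia|easy|]. intros r v hv.
    rewrite Nat.add_succ_r. exact (h4 r v hv).
  + right. intros v. rewrite Nat.add_succ_r. exact (h v).
Qed.

(** The hypothesis bounds [norm1] by [quad], the run of minuses contracts [quad], and the plus which
    ends the run sends the ball into [quad] <= K. The factor K cancels, so the block contracts at
    rate [th] however long the run is. *)
Lemma tail_outcome (m : nat) (f : R * R -> R * R) (p : R * R) : (m + 1 <= L)%nat -> Lam a p ->
  (forall v, K * norm1 (f v) ^ 2 <= (9999 / 10000) ^ 2 * quad a v) -> outcome m f p.
Proof.
intros hm hp H n.
assert (H' : forall i v, K * norm1 (f (minuses a i v)) ^ 2 <= (9999 / 10000 * th ^ i) ^ 2 * quad a v).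
{ intros i v. eapply Rle_trans; [apply H|]. rewrite Rpow_mult_distr, Rmult_assoc.
  apply Rmult_le_compat_l; [apply pow2_ge_0|]. now apply quad_minuses. }
destruct (first_plus n p) as [[i [hi [h1 h2]]]|h].
- left. exists (S i). repeat split; [lia|lia| |].
  + exists (iterG a i p). repeat split; [now apply iterG_Lam..|easy|apply iterG_succ].
  + intros r v hv. rewrite h2. pose proof (Ball_nonneg _ _ _ hv) as hr.
    apply Ball_weak with (norm1 (f (minuses a i (dinv a true v)))); [now apply Ball_norm1|].
    apply Rle_trans with (9999 / 10000 * th ^ i * r).
    * apply Rsqr_incr_0_var; [|pose proof (th_pow i); nra].
      apply (Rmult_le_reg_l K); [lra|]. specialize (H' i (dinv a true v)).
      specialize (K_ball r v hv). pose proof (pow2_ge_0 (9999 / 10000 * th ^ i)).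
      assert ((9999 / 10000 * th ^ i) ^ 2 * quad a (dinv a true v) <=
        (9999 / 10000 * th ^ i) ^ 2 * (K * r ^ 2)) by (now apply Rmult_le_compat_l).
      unfold Rsqr. simpl in *. lra.
    (* The run supplies th^i, and 9999/10000 pays for the remaining m + 1 <= L symbols. *)
    * apply Rmult_le_compat_r; [easy|]. replace (m + S i)%nat with ((m + 1) + i)%nat by lia.
      rewrite pow_add. apply Rmult_le_compat_r; [apply Rlt_le, th_pow|].
      eapply Rle_trans; [exact th_L|now apply th_le].
(* Only minuses follow: as K >= 1/2 the constant is at most 2, which is below C th^m. *)
- right. intros v. rewrite h.
  apply Rle_trans with (2 * th ^ n * norm1 v).
  + pose proof (th_pow n). pose proof (norm1_nonneg v).
    apply Rsqr_incr_0_var; [|nra].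
    specialize (H' n v). pose proof (quad_le_norm1 a a_pos a_lt v).
    pose proof (pow2_ge_0 (9999 / 10000 * th ^ n)). pose proof (pow2_ge_0 (norm1 (f (minuses a n v)))).
    pose proof (pow2_ge_0 (th ^ n * norm1 v)).
    assert ((9999 / 10000 * th ^ n) ^ 2 * quad a v <= (9999 / 10000 * th ^ n) ^ 2 * (2 * norm1 v ^ 2)) by
      (now apply Rmult_le_compat_l).
    unfold Rsqr. simpl in *. nra.
  + apply Rmult_le_compat_r; [apply norm1_nonneg|]. rewrite pow_add, <- Rmult_assoc.
    apply Rmult_le_compat_r; [apply Rlt_le, th_pow|].
    pose proof (C_L m ltac:(lia)). pose proof (pow_R1_Rle 3 m ltac:(lra)). simpl in *. lra.
Qed.

Fixpoint depth (s : cert) : nat :=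
  match s with
  | CP _ _ s' | CM _ _ s' => S (depth s')
  | CB s1 s2 => S (Nat.max (depth s1) (depth s2))
  | _ => 1
  end.

Section Walk.
Variable X : R * R.
Hypotheses (X_nonneg : 0 <= fst X /\ 0 <= snd X).

(** A symbol excluded by Farkas' lemma is not that of the point, so the certificate follows the
    actual orbit down to a leaf. There [outcome] holds, and [outcome_step] carries it back to the
    root. *)
Lemma verify_sound (s : cert) (last : option bool) (m : nat) (p : R * R)
    (f : R * R -> R * R) (k : R) (n : node) :
  verify c s last n = true -> inv X p f k n -> Lam a p ->
  (last = Some true -> arrived p) -> (last = None \/ 1 <= m)%nat ->
  (m + depth s <= L)%nat -> tame m f -> outcome m f p.
Proof.
revert last m p f k n.
induction s as [hints| |i j s IH|i j s IH|s1 IH1 s2 IH2|i j]; intros last m p f k n hv hi hp hl h1 hm hf.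
- destruct last as [[|]|]; try easy. destruct h1 as [h1|h1]; [easy|].
  intros n'. left. exists 0%nat. repeat split; [lia|lia|now apply hl|].
  intros r v hr. apply Ball_weak with (9999 / 10000 * r).
  + eapply accept_sound; eassumption.
  + apply Rmult_le_compat_r; [exact (Ball_nonneg _ _ _ hr)|].
    eapply Rle_trans; [exact th_L|apply th_le; simpl in hm; lia].
- destruct last as [[|]|]; try easy.
  apply tail_outcome; [simpl in hm; lia|easy|].
  eapply tail_sound; try eassumption. unfold K in K_half; lra.
- simpl in hv, hm. destruct (infeasible _ _ i j) eqn:e; [|easy].
  apply outcome_step; [lia|easy|].
  assert (hs : plus a p = true).
  { destruct (plus a p) eqn:hs; [easy|]. exfalso.
    pose proof (half_sound X X_nonneg p _ (level_sound X p f k n hi)) as hh. rewrite hs in hh.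
    exact (infeasible_sound X _ _ i j hh (inv_hs _ _ _ _ _ hi) e). }
  apply (IH (Some true) (S m) (G a p) _ (det a * k) (child c n (nlevel c n) (plus a p) (nhs n))).
  + now rewrite hs.
  + apply child_sound; [easy|apply (inv_hs _ _ _ _ _ hi)].
  + now apply G_Lam.
  + intros _. now exists p.
  + right; lia.
  + lia.
  + now apply tame_dinv.
- simpl in hv, hm. destruct (infeasible _ _ i j) eqn:e; [|easy].
  apply outcome_step; [lia|easy|].
  assert (hs : plus a p = false).
  { destruct (plus a p) eqn:hs; [|easy]. exfalso.
    pose proof (half_sound X X_nonneg p _ (level_sound X p f k n hi)) as hh. rewrite hs in hh.
    exact (infeasible_sound X _ _ i j hh (inv_hs _ _ _ _ _ hi) e). }
  apply (IH (Some false) (S m) (G a p) _ (det a * k) (child c n (nlevel c n) (plus a p) (nhs n))).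
  + now rewrite hs.
  + apply child_sound; [easy|apply (inv_hs _ _ _ _ _ hi)].
  + now apply G_Lam.
  + easy.
  + right; lia.
  + lia.
  + now apply tame_dinv.
- simpl in hv, hm. destruct (verify c s1 _ _) eqn:e; [|easy].
  apply outcome_step; [lia|easy|].
  pose proof (half_sound X X_nonneg p _ (level_sound X p f k n hi)) as hh.
  assert (hhs : forall h, In h (half (nlevel c n) (plus a p) :: nhs n) -> sat X h).
  { intros h [<-|h2]; [easy|]. now apply (inv_hs _ _ _ _ _ hi). }
  pose proof (child_sound X p f k n _ hi hhs) as hc.
  assert (hl' : Some (plus a p) = Some true -> arrived (G a p)).
  { intros h. injection h as h. now exists p. }
  destruct (plus a p) eqn:hs.
  + apply (IH1 (Some true) (S m) (G a p) _ _ _ e hc); [now apply G_Lam|easy|right; lia|lia|now apply tame_dinv].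
  + apply (IH2 (Some false) (S m) (G a p) _ _ _ hv hc); [now apply G_Lam|easy|right; lia|lia|now apply tame_dinv].
- now destruct last as [[|]|].
Qed.

End Walk.
End Outcome.
End Verify.

Lemma covers_sound (x : R) (lo : Z) (l : list cell) (hi : Z) : covers lo l hi = true ->
  IZR lo <= x <= IZR hi ->
  l <> nil -> exists c, In c l /\ IZR (cA c) <= x <= IZR (cA c) + IZR (cW c).
Proof.
revert lo; induction l as [|c l IH]; intros lo H hx hl; [easy|].
simpl in H. destruct (cA c =? lo)%Z eqn:e; [|easy]. apply Z.eqb_eq in e. subst lo.
destruct (Rle_lt_dec x (IZR (cA c) + IZR (cW c))) as [h|h].
- exists c. split; [now left|lra].
- destruct l as [|c' l].
  + simpl in H. apply Z.leb_le, IZR_le in H. rewrite plus_IZR in H. lra.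
  + destruct (IH _ H) as [c'' [h1 h2]]; [rewrite plus_IZR; lra|easy|].
    exists c''. split; [now right|easy].
Qed.

Lemma bernoulli (x : R) (n : nat) : 0 <= x <= 1 -> 1 - INR n * x <= (1 - x) ^ n.
Proof.
intros hx. induction n as [|n IH]; [simpl; lra|].
rewrite S_INR; simpl. pose proof (pos_INR n).
assert (0 <= INR n * x * x) by (repeat apply Rmult_le_pos; lra). nra.
Qed.

(** A block is only known to gain 1/10000, over up to L symbols besides a run of minuses, so th must
    be very close to 1. It must also dominate the factor d^(-1/2) of each minus. *)
Lemma rate (d : R) (L : nat) : 1 < d -> exists th, 0 < th < 1 /\ 1 <= d * th ^ 2 /\
  9999 / 10000 <= th ^ L.
Proof.
intros hd.
assert (hi : 0 < / d < 1) by (split; [apply Rinv_0_lt_compat; lra|rewrite <- Rinv_1; apply Rinv_lt_contravar; lra]).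
pose proof (pos_INR L) as hL.
set (x := / (10000 * (INR L + 1))).
assert (hx : 0 < x) by (apply Rinv_0_lt_compat; lra).
assert (ex : x * (10000 * (INR L + 1)) = 1) by (unfold x; field; lra).
(* The first term keeps th^L above 9999/10000 by Bernoulli's inequality; the second gives d th^2 >=
   1, because ((1 + u)/2)^2 >= u for u = 1/d. *)
set (th := Rmax (1 - x) ((1 + / d) / 2)).
assert (h1 : 1 - x <= th) by apply Rmax_l. assert (h2 : (1 + / d) / 2 <= th) by apply Rmax_r.
assert (h3 : th < 1) by (apply Rmax_lub_lt; lra).
exists th. repeat split; [lra|easy| |].
- assert (0 <= (1 - / d) ^ 2) by apply pow2_ge_0.
  assert (/ d <= th ^ 2) by (simpl in *; nra).
  replace 1 with (d * / d) by (field; lra). apply Rmult_le_compat_l; lra.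
- apply Rle_trans with ((1 - x) ^ L); [|apply pow_incr; nra].
  eapply Rle_trans; [|apply bernoulli; nra]. nra.
Qed.

Lemma has_atom_sound (c : cell) (x y : Z) : has_atom c x y = true -> In (x, y) (catoms c).
Proof.
unfold has_atom. intros H. apply negb_true_iff in H.
induction (catoms c) as [|[u v] l IH]; simpl in *; [easy|].
destruct ((u =? x)%Z && (v =? y)%Z) eqn:e; simpl in H.
- apply andb_true_iff in e. destruct e as [e1 e2].
  apply Z.eqb_eq in e1, e2. left. now subst.
- right. auto.
Qed.

Section Cell.
Variables (c : cell) (a t : R).
Hypotheses (a_pos : 0 < a) (a_lt : a < 1 / 2) (t01 : 0 <= t <= 1).
Hypothesis a_cell : N * a = IZR (cA c) + IZR (cW c) * t.

Lemma kap_ball : kap_ok c = true ->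
  forall r v, Ball (catoms c) r v -> quad a (dinv a true v) <= IZR (cK c) / 1000 * r ^ 2.
Proof.
intros H. pose proof (det_bounds a a_pos a_lt) as hd.
assert (H1 : forall p, In p (catoms c) -> quad a (dinv a true (atom p)) <= IZR (cK c) / 1000).
{ intros [x y] hp. apply (every_In _ _ _ H) in hp.
  pose proof (ap_ma c a t a_cell) as m1. pose proof (ap_m2a c a t a_cell) as m2.
  pose proof (ap_md c a t a_cell) as m3.
  assert (m4 : approx t N (IZR (y * y)) (mconst (scale * y * y))).
  { apply approx_const. rewrite !mult_IZR. ring. }
  pose proof (approx_nonneg t t01 N _ _ scale_pos (approx_sub t _ _ _ _ _ (approx_scal t _ _ (cK c * 1000) _ m3)
   (approx_add t _ _ _ _ _ m4 (approx_add t _ _ _ _ _ (approx_scal t _ _ (- (x * y)) _ m2)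
     (approx_scal t _ _ (x * x) _ m3)))) hp) as g.
  rewrite opp_IZR, !mult_IZR in g.
  pose proof (quad_plus a a_pos a_lt (atom (x, y))) as e. unfold atom in *; cbn [fst snd] in *.
  apply (Rmult_le_reg_r (det a)); [lra|]. rewrite e. simpl. lra. }
intros r v hv.
assert (hK : 0 <= IZR (cK c) / 1000).
{ clear -hv H1 a_pos a_lt. induction hv as [p hp| |]; [|easy..].
  eapply Rle_trans; [apply (quad_nonneg a a_pos a_lt)|apply (H1 p hp)]. }
(* The bound is stated as a square so that [quad_comb] extends it from the atoms to their
   combinations. *)
assert (H2 : quad a (dinv a true v) <= (sqrt (IZR (cK c) / 1000) * r) ^ 2).
{ induction hv as [p hp|c1 r1 v1 c2 r2 v2 h1 IH1 h2 IH2|r r' v h IH hr].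
  - rewrite Rmult_1_r, pow2_sqrt by easy. auto.
  - rewrite linear_dinv.
    replace (sqrt (IZR (cK c) / 1000) * (Rabs c1 * r1 + Rabs c2 * r2)) with
      (Rabs c1 * (sqrt (IZR (cK c) / 1000) * r1) + Rabs c2 * (sqrt (IZR (cK c) / 1000) * r2)) by ring.
    pose proof (Ball_nonneg _ _ _ h1). pose proof (Ball_nonneg _ _ _ h2).
    pose proof (sqrt_pos (IZR (cK c) / 1000)).
    apply quad_comb; auto; nra.
  - eapply Rle_trans; [exact IH|]. pose proof (Ball_nonneg _ _ _ h).
    apply pow_incr. pose proof (sqrt_pos (IZR (cK c) / 1000)). split; nra. }
rewrite Rpow_mult_distr, pow2_sqrt in H2 by easy. exact H2.
Qed.

Local Notation S2 := (IZR (Z.shiftl 1 (2 * lscale))).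

Lemma S2_eq : S2 = N * N.
Proof. now rewrite <- mult_IZR. Qed.

Lemma ap_one : approx t S2 1 (mconst (scale * scale)).
Proof. apply approx_const. rewrite S2_eq, mult_IZR. ring. Qed.

Lemma ap_zero (S : R) : approx t S 0 (mconst 0).
Proof. apply approx_const. ring. Qed.

Lemma ap_up (x : R) (k : Z) (m : model) : approx t N x m ->
  approx t S2 (IZR k * x) (mscal (k * scale) m).
Proof.
intros h. apply (approx_scal t _ _ (k * scale)) in h.
refine (ap_conv t _ _ _ _ _ _ h). rewrite S2_eq, mult_IZR. ring.
Qed.

Lemma ap_mul2 (x y : R) (m n : model) : approx t N x m -> approx t N y n ->
  approx t S2 (x * y) (mmul m n).
Proof. intros h1 h2. rewrite S2_eq. now apply (approx_mul t t01). Qed.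

Lemma base_sound (q : R * R) (h : halfplane) : Lam a q -> plus a q = true ->
  In h (map (enclose (2 * lscale)) (base c)) -> sat (G a q) h.
Proof.
intros [sq [lv _]] hq hin.
pose proof (G_square a a_pos a_lt q sq) as [[x0 x1] [y0 y1]].
assert (e : snd (G a q) = 2 * level a q) by now rewrite (G_plus _ _ hq).
assert (e' : fst (G a q) = snd q) by easy.
destruct q as [x y]; destruct sq as [[u0 u1] [v0 v1]]; unfold level in *; cbn [fst snd] in *.
pose proof (ap_ma c a t a_cell) as m1. pose proof (ap_m1a c a t a_cell) as m2.
pose proof ap_one as one. pose proof (ap_zero S2) as zero.
pose proof (approx_scal t _ _ (-1) _ one) as mone.
pose proof (approx_scal t _ _ (-4) _ (ap_mul2 _ _ _ _ m1 m1)) as m3.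
pose proof (ap_up _ (-2) _ m1) as m4. pose proof (ap_up _ 2 _ m1) as m5. pose proof (ap_up _ 2 _ m2) as m6.
assert (H : forall z A, aff t (G a (x, y)) S2 A z -> 0 <= z -> sat (G a (x, y)) (enclose (2 * lscale) A)).
{ intros z A hA hz. now apply (enclose_sound t t01 (G a (x, y)) (conj x0 y0) _ z). }
unfold base in hin; cbn [map In] in hin. set (X := G a (x, y)) in *.
repeat (destruct hin as [<-|hin]); try easy.
- apply (H (fst X)); [|easy]. exists 1, 0, 0. repeat split; try easy. ring.
- apply (H (snd X)); [|easy]. exists 0, 1, 0. repeat split; try easy. ring.
- apply (H (1 - fst X)); [|lra]. exists (IZR (-1) * 1), 0, 1. repeat split; try easy. ring.
- apply (H (1 - snd X)); [|lra]. exists 0, (IZR (-1) * 1), 1. repeat split; try easy. ring.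
- apply (H (snd X - 4 * (a * a))); [|simpl in lv; lra].
  exists 0, 1, (IZR (-4) * (a * a)). repeat split; try easy. ring.
- apply (H (snd X - 2 * a * fst X)); [|rewrite e, e'; nra].
  exists (IZR (-2) * a), 1, 0. repeat split; try easy. ring.
- apply (H (2 * a * fst X - snd X + 2 * (1 - a))); [|rewrite e, e'; nra].
  exists (IZR 2 * a), (IZR (-1) * 1), (IZR 2 * (1 - a)). repeat split; try easy. ring.
Qed.

Lemma extra_sound (q : R * R) : Lam a q -> plus a q = true ->
  sat (G a q) (enclose (2 * lscale) (after_minus c)) \/ sat (G a q) (enclose (2 * lscale) (after_plus c)).
Proof.
intros [sq [lv H]] hq.
pose proof (G_square a a_pos a_lt q sq) as [[x0 x1] [y0 y1]].
assert (e : snd (G a q) = 2 * level a q) by now rewrite (G_plus _ _ hq).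
assert (e' : fst (G a q) = snd q) by easy.
destruct q as [x y]; destruct sq as [[u0 u1] [v0 v1]]; unfold level in *; cbn [fst snd] in *.
pose proof (ap_ma c a t a_cell) as m1. pose proof (ap_m1a c a t a_cell) as m2.
set (X := G a (x, y)) in *.
destruct H as [H|H]; [left|right].
- apply (enclose_sound t t01 X (conj x0 y0) _ ((1 - a - 2 * a * a) * fst X + a * snd X - 2 * a * (1 - a))).
  + easy.
  + rewrite e, e'. assert (0 <= (1 - a) * (y - 2 * a * (1 - x))) by (apply Rmult_le_pos; lra). lra.
  + exists (IZR 1 * (1 - a) + IZR (-2) * (a * a)), (IZR 1 * a), (IZR (-2) * (a * (1 - a))).
    split; [|split; [|split]].
    * apply approx_add; [exact (ap_up _ 1 _ m2)|]. apply approx_scal. now apply ap_mul2.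
    * exact (ap_up _ 1 _ m1).
    * apply approx_scal. now apply ap_mul2.
    * ring.
- apply (enclose_sound t t01 X (conj x0 y0) _ (fst X - 4 * (a * a))).
  + easy.
  + rewrite e'. simpl in H. lra.
  + exists 1, 0, (IZR (-4) * (a * a)).
    split; [|split; [|split]].
    * apply ap_one.
    * apply ap_zero.
    * apply approx_scal. now apply ap_mul2.
    * ring.
Qed.

Lemma root_inv (q : R * R) (hs : list halfplane) : (forall h, In h hs -> sat (G a q) h) ->
  inv t (G a q) (G a q) (fun v => v) 1
    (Node (mconst unity, mconst 0, mconst 0) (mconst 0, mconst unity, mconst 0)
      (mconst unity) (mconst 0) (mconst 0) (mconst unity) (mconst unity) hs).
Proof.
intros h.
assert (one : forall x, x = 1 -> approx t (IZR unity) x (mconst unity)) by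
  (intros x ->; apply approx_const; ring).
assert (zero : forall x, x = 0 -> approx t (IZR unity) x (mconst 0)) by
  (intros x ->; apply approx_const; ring).
split; cbn [nx ny n11 n12 n21 n22 ndk nhs fst snd]; auto; try (apply one; ring); try (apply zero; ring).
- exists 1, 0, 0. repeat split; auto. ring.
- exists 0, 1, 0. repeat split; auto. ring.
- lra.
- now intros.
Qed.

End Cell.

Definition max_depth (l : list cell) : nat :=
  fold_right (fun c m => Nat.max (Nat.max (depth (cminus c)) (depth (cplus c))) m) 0%nat l.

(** * Contraction along whole orbits *)

Section Contraction.
Variables (c : cell) (a t : R).
Hypotheses (a_pos : 0 < a) (a_lt : a < 1 / 2) (t01 : 0 <= t <= 1).
Hypothesis a_cell : N * a = IZR (cA c) + IZR (cW c) * t.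
Hypothesis c_ok : cell_ok c = true.

Lemma arrived_contraction : exists C th, 0 < C /\ 0 < th < 1 /\ 1 <= det a * th ^ 2 /\
  forall p, arrived a p -> forall n v, norm1 (back a n p v) <= C * th ^ n * norm1 v.
Proof.
unfold cell_ok in c_ok.
destruct (0 <? cW c)%Z; [|easy].
destruct (kap_ok c) eqn:hk; [|easy].
destruct (has_atom c 1000 0) eqn:h1; [|easy].
destruct (has_atom c 0 1000) eqn:h2; [|easy].
destruct (root c (after_minus c) (cminus c)) eqn:r1; [|easy].
rename c_ok into r2.
apply has_atom_sound in h1, h2.
pose proof (kap_ball c a t a_pos a_lt t01 a_cell hk) as K_ball.
pose proof (det_bounds a a_pos a_lt) as hd.
(* The plus branch sends the atom (0, 1) to a vector whose [quad] is 1/d > 1/2. *)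
assert (K_half : 1 / 2 <= IZR (cK c) / 1000).
{ pose proof (K_ball _ _ (Ball_atom _ _ h2)) as h.
  pose proof (quad_plus a a_pos a_lt (atom (0, 1000)%Z)) as e.
  unfold atom in *; cbn [fst snd] in *.
  apply (Rmult_le_compat_r (det a)) in h; [|lra]. rewrite e in h. simpl in *. nra. }
set (L := (max_depth [c] + 1)%nat).
destruct (rate (det a) L (proj1 hd)) as [th [hth [hdet hL]]].
assert (hpow : forall m, 0 < th ^ m) by (intros m; apply pow_lt; lra).
set (C := 3 ^ S L / th ^ L).
assert (C_L : forall m, (m <= L)%nat -> 3 ^ S m <= C * th ^ m).
{ intros m hm. apply Rle_trans with (3 ^ S L); [apply Rle_pow; [lra|lia]|].
  replace (3 ^ S L) with (C * th ^ L) at 1 by (unfold C; field; apply Rgt_not_eq, hpow).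
  apply Rmult_le_compat_l.
  - unfold C. apply Rlt_le, Rdiv_lt_0_compat; [apply pow_lt; lra|apply hpow].
  - now apply th_le. }
assert (hC : 0 < C) by (apply Rdiv_lt_0_compat; [apply pow_lt; lra|apply hpow]).
assert (O : forall p, arrived a p -> outcome c a th C 0 (fun v => v) p).
{ intros p [q [hq [hs ->]]].
  assert (hX : 0 <= fst (G a q) /\ 0 <= snd (G a q)).
  { destruct hq as [sq _]. now destruct (G_square a a_pos a_lt q sq) as [[? _] [? _]]. }
  assert (go : forall e s, sat (G a q) (enclose (2 * lscale) e) -> root c e s = true ->
    (depth s < L)%nat -> outcome c a th C 0 (fun v => v) (G a q)).
  { intros e s he hr hd'.
    assert (hhs : forall h, In h (enclose (2 * lscale) e :: map (enclose (2 * lscale)) (base c)) ->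
      sat (G a q) h).
    { intros h [<-|hh]; [easy|]. now apply (base_sound c a t a_pos a_lt t01 a_cell). }
    pose proof (root_inv a t t01 q _ hhs) as hi.
    assert (hv : verify c s None (Node (mconst unity, mconst 0, mconst 0) (mconst 0, mconst unity, mconst 0)
      (mconst unity) (mconst 0) (mconst 0) (mconst unity) (mconst unity)
      (enclose (2 * lscale) e :: map (enclose (2 * lscale)) (base c))) = true \/
      exists i j, infeasible (enclose (2 * lscale) e) (map (enclose (2 * lscale)) (base c)) i j = true).
    { unfold root in hr. destruct s; try (left; exact hr). right. exists i, j. exact hr. }
    destruct hv as [hv|[i [j hf]]].
    - refine (verify_sound c a t a_pos a_lt t01 a_cell th C L hth hdet hL C_L h1 h2 K_half K_ball
        (G a q) hX s None 0%nat (G a q) (fun v => v) 1 _ hv hi _ _ _ _ _).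
      + now apply G_Lam.
      + discriminate.
      + now left.
      + lia.
      + intros v. simpl. lra.
    - exfalso. apply (infeasible_sound (G a q) _ _ i j he) in hf; [easy|].
      intros h hh. apply hhs. now right. }
  destruct (extra_sound c a t a_pos a_lt t01 a_cell q hq hs) as [he|he].
  - apply (go _ _ he r1). unfold L; simpl; lia.
  - apply (go _ _ he r2). unfold L; simpl; lia. }
(* Strong induction over blocks: completed blocks contract the ball without any constant, so [C] is
   paid only once, by the last one. *)
assert (I : forall n p v, arrived a p -> Ball (catoms c) (C * th ^ n * norm1 v) (back a n p v)).
{ intros n. induction n as [n IH] using lt_wf_ind. intros p v hp.
  destruct (O p hp n) as [[j [j1 [j2 [j3 j4]]]]|h].
  - simpl in *. replace (back a n p v) with (back a j p (back a (n - j) (iterG a j p) v)).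
    + apply Ball_weak with (th ^ j * (C * th ^ (n - j) * norm1 v)).
      * apply j4, IH; [lia|easy].
      * right. replace n with (j + (n - j))%nat at 2 by lia. rewrite pow_add. ring.
    + rewrite <- back_add. f_equal. lia.
  - simpl in h. eapply Ball_weak; [now apply Ball_norm1|apply h]. }
destruct (norm1_Ball (catoms c)) as [B [hB hB']].
exists (B * C), th. split; [nra|]. split; [easy|]. split; [easy|].
intros p hp n v. rewrite Rmult_assoc, Rmult_assoc. apply hB'. rewrite <- Rmult_assoc. now apply I.
Qed.

Lemma cell_contraction : exists C th, 0 < C /\ 0 < th < 1 /\
  forall p, Lam a p -> forall n v, norm1 (back a n p v) <= C * th ^ n * norm1 v.
Proof.
destruct arrived_contraction as [C [th [hC [hth [hdet H]]]]].
assert (hpow : forall m, 0 < th ^ m) by (intros m; apply pow_lt; lra).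
(* Before the first plus only [quad] is known to contract: 4 is for the run of minuses, 3 for the
   plus, and 1/th because this plus counts as a step. *)
exists (4 + 12 * (C / th)), th. pose proof (Rdiv_lt_0_compat C th hC (proj1 hth)) as hCt.
split; [lra|]. split; [easy|].
intros p hp n v. pose proof (norm1_nonneg v) as hv.
destruct (first_plus a n p) as [[i [hi [h1 h2]]]|h].
- replace n with (S i + (n - S i))%nat by lia. rewrite back_add, h2.
  set (u := back a (n - S i) (iterG a (S i) p) v).
  assert (hu : norm1 u <= C * th ^ (n - S i) * norm1 v).
  { apply H. exists (iterG a i p). repeat split; [now apply iterG_Lam..|easy|apply iterG_succ]. }
  pose proof (norm1_minuses a a_pos a_lt th i (dinv a true u) ltac:(lra) hdet) as g1.
  pose proof (norm1_dinv a a_pos a_lt true u) as g2.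
  pose proof (hpow i). pose proof (hpow (n - S i)%nat).
  apply Rle_trans with (12 * (C / th) * th ^ (S i + (n - S i)) * norm1 v).
  + rewrite pow_add. simpl (th ^ S i).
    replace (12 * (C / th) * (th * th ^ i * th ^ (n - S i)) * norm1 v) with
      (4 * th ^ i * (3 * (C * th ^ (n - S i) * norm1 v))) by (field; lra).
    eapply Rle_trans; [exact g1|]. apply Rmult_le_compat_l; [lra|]. lra.
  + repeat apply Rmult_le_compat_r; [easy|apply Rlt_le, hpow|lra].
- rewrite h. eapply Rle_trans; [apply (norm1_minuses a a_pos a_lt th n v ltac:(lra) hdet)|].
  repeat apply Rmult_le_compat_r; [easy|apply Rlt_le, hpow|lra].
Qed.

End Contraction.

Theorem contraction (a : R) : 0 < a -> a <= 46 / 100 -> exists C th, 0 < C /\ 0 < th < 1 /\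
  forall p, Lam a p -> forall n v, norm1 (back a n p v) <= C * th ^ n * norm1 v.
Proof.
intros h0 h1.
destruct (covers_sound (N * a) 0 cells 7537 cells_cover) as [c [hc hx]].
- change N with 16384. lra.
- discriminate.
- pose proof (every_In _ _ _ cells_ok hc) as ok.
  assert (hW : 0 < IZR (cW c)).
  { unfold cell_ok in ok. destruct (0 <? cW c)%Z eqn:e; [|easy]. apply IZR_lt. now apply Z.ltb_lt. }
  apply (cell_contraction c a ((N * a - IZR (cA c)) / IZR (cW c))); try lra; [|field; lra|easy].
  split; [apply Rmult_le_pos; [lra|apply Rlt_le, Rinv_0_lt_compat; lra]|].
  apply (Rmult_le_reg_r (IZR (cW c))); [easy|].
  replace ((N * a - IZR (cA c)) / IZR (cW c) * IZR (cW c)) with (N * a - IZR (cA c)) by (field; lra). lra.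
Qed.

End Expansion.

(** * Translates *)

Definition vadd (p v : R * R) : R * R := (fst p + fst v, snd p + snd v).
Definition vscal (k : R) (v : R * R) : R * R := (k * fst v, k * snd v).

Lemma meas_forall_list {T : Type} (l : list T) (A : T -> set2) : (forall x, In x l -> meas (A x)) ->
  meas (fun p => forall x, In x l -> A x p).
Proof.
induction l as [|x l IH]; intros H.
- apply (meas_ext (fun _ => True)); [apply meas_const|]. intros p; split; easy.
- apply (meas_ext (fun p => A x p /\ forall y, In y l -> A y p)).
  + apply meas_and; [apply H; now left|]. apply IH. intros y hy. apply H. now right.
  + intros p; split.
    * intros [h1 h2] y [<-|hy]; auto.
    * intros h; split; [apply h; now left|]. intros y hy. apply h. now right.
Qed.

Lemma meas_forall_lt (n : nat) (A : nat -> set2) : (forall k, meas (A k)) ->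
  meas (fun p => forall k, (k < n)%nat -> A k p).
Proof.
intros H. apply (meas_ext (fun p => forall k, In k (seq 0 n) -> A k p)).
- now apply meas_forall_list.
- intros p; split; intros h k hk; apply h; [apply in_seq; lia|apply in_seq in hk; lia].
Qed.

Lemma meas_ex_list {T : Type} (l : list T) (A : T -> set2) : (forall x, In x l -> meas (A x)) ->
  meas (fun p => exists x, In x l /\ A x p).
Proof.
intros H. apply (meas_ext (fun p => ~ forall x, In x l -> ~ A x p)).
- apply meas_compl, meas_forall_list. intros x hx. now apply meas_compl, H.
- intros p; split.
  + intros h. apply not_all_ex_not in h. destruct h as [x h]. exists x.
    apply imply_to_and in h. destruct h as [h1 h2]. split; [easy|now apply NNPP].
  + intros [x [h1 h2]] h. exact (h x h1 h2).
Qed.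

Lemma area_ext (A B : set2) : meas A -> meas B -> (forall p, unit_square p -> (A p <-> B p)) ->
  area A = area B.
Proof. intros hA hB h. apply Rle_antisym; apply area_mono; try easy; intros p hp; now apply h. Qed.

Lemma area_le1 (A : set2) : meas A -> area A <= 1.
Proof. intros h. rewrite <- area_sq. apply area_mono; [easy|apply meas_sq|easy]. Qed.

Lemma area_or_le (A B : set2) : meas A -> meas B -> area (fun p => A p \/ B p) <= area A + area B.
Proof.
intros hA hB.
assert (hd : meas (fun p => B p /\ ~ A p)) by (apply meas_and; [easy|now apply meas_compl]).
rewrite (area_ext _ (fun p => A p \/ (B p /\ ~ A p))); [|now apply meas_or|now apply meas_or|].
- rewrite area_or; [|easy|easy|]; [|intros p h1 [_ h2]; easy].
  apply Rplus_le_compat_l, area_mono; [easy|easy|now intros p _ [h _]].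
- intros p _; split; [intros [h|h]; [now left|destruct (classic (A p)); tauto]|tauto].
Qed.

Lemma area_empty (A : set2) : meas A -> (forall p, ~ A p) -> area A = 0.
Proof.
intros hA h. pose proof (area_or A A hA hA ltac:(intros p hp; exfalso; exact (h p hp))) as e.
rewrite (area_ext _ A) in e; [lra|now apply meas_or|easy|tauto].
Qed.

Definition lsum {T : Type} (f : T -> R) (l : list T) : R := fold_right (fun x s => f x + s) 0 l.

Lemma lsum_le {T : Type} (f g : T -> R) (l : list T) : (forall x, In x l -> f x <= g x) ->
  lsum f l <= lsum g l.
Proof.
induction l as [|x l IH]; simpl; intros H; [lra|].
apply Rplus_le_compat; [apply H; now left|apply IH; intros y hy; apply H; now right].
Qed.

Lemma lsum_add {T : Type} (f g : T -> R) (l : list T) :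
  lsum (fun x => f x + g x) l = lsum f l + lsum g l.
Proof. induction l as [|x l IH]; simpl; [lra|]. rewrite IH; lra. Qed.

Lemma lsum_scal {T : Type} (k : R) (f : T -> R) (l : list T) :
  lsum (fun x => k * f x) l = k * lsum f l.
Proof. induction l as [|x l IH]; simpl; [lra|]. rewrite IH; lra. Qed.

Lemma area_union_list {T : Type} (l : list T) (A : T -> set2) : (forall x, In x l -> meas (A x)) ->
  area (fun p => exists x, In x l /\ A x p) <= lsum (fun x => area (A x)) l.
Proof.
induction l as [|x l IH]; intros H.
- right. apply area_empty; [|now intros p [x [h _]]]. now apply meas_ex_list.
- assert (hl : meas (fun p => exists y, In y l /\ A y p)) by
    (apply meas_ex_list; intros y hy; apply H; now right).
  eapply Rle_trans; [|simpl; apply Rplus_le_compat_l, IH; intros y hy; apply H; now right].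
  eapply Rle_trans; [|apply area_or_le; [apply H; now left|easy]].
  apply area_mono; [now apply meas_ex_list|apply meas_or; [apply H; now left|easy]|].
  intros p _ [y [[<-|hy] h]]; [now left|right; now exists y].
Qed.

Lemma area_disjoint_list {T : Type} (l : list T) (A : T -> set2) (B : set2) : NoDup l -> meas B ->
  (forall x, In x l -> meas (A x)) -> (forall x p, In x l -> A x p -> B p) ->
  (forall x y p, In x l -> In y l -> A x p -> A y p -> x = y) ->
  lsum (fun x => area (A x)) l <= area B.
Proof.
revert B; induction l as [|x l IH]; intros B nd mB mA hB hd; simpl; [apply area_ge0|].
inversion_clear nd as [|? ? nx nd'].
assert (mx : meas (A x)) by (apply mA; now left).
assert (md : meas (fun p => B p /\ ~ A x p)) by (apply meas_and; [easy|now apply meas_compl]).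
apply Rle_trans with (area (A x) + area (fun p => B p /\ ~ A x p)).
- apply Rplus_le_compat_l, IH; [easy|easy|intros y hy; apply mA; now right| |].
  + intros y p hy h. split; [apply (hB y); [now right|easy]|]. intros hx.
    apply nx. rewrite (hd x y p); [easy|now left|now right|easy|easy].
  + intros y z p hy hz. apply hd; now right.
- rewrite <- area_or; [|easy|easy|tauto].
  apply area_mono; [now apply meas_or|easy|].
  intros p _ [h|[h _]]; [apply (hB x); [now left|easy]|easy].
Qed.

Lemma area_shift (A : set2) (v : R * R) : meas A -> (forall p, A p -> unit_square p) ->
  (forall p, A p -> unit_square (vadd p v)) ->
  meas (fun p => A (vadd p (vscal (-1) v))) /\ area (fun p => A (vadd p (vscal (-1) v))) = area A.
Proof.
intros hA h1 h2. split.
- exact (meas_translate A (vscal (-1) v) hA).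
- apply (area_translate A (vscal (-1) v)); [easy|easy|].
  intros p hp. apply h2 in hp. revert hp. unfold vadd, vscal; simpl.
  destruct p as [x y]; simpl.
  replace (x + -1 * fst v + fst v) with x by ring. now replace (y + -1 * snd v + snd v) with y by ring.
Qed.

(* The translates of [E] by the multiples of [u] either stay [J] times in [C], where they are
   pairwise disjoint, or reach a last position in [C], which is in [D]. *)
Lemma sweep (C E D : set2) (u : R * R) (J : nat) : meas C -> meas E -> meas D -> (0 < J)%nat ->
  (forall p, C p -> unit_square p) -> (forall p, E p -> C p) ->
  (forall p i j, E p -> E (vadd p (vscal (INR i - INR j) u)) -> (i <= J)%nat -> (j <= J)%nat -> i = j) ->
  (forall p j, E p -> (j < J)%nat -> C (vadd p (vscal (INR j) u)) ->
     ~ C (vadd p (vscal (INR (S j)) u)) -> D (vadd p (vscal (INR j) u))) ->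
  area E <= area C / INR J + area (fun p => C p /\ D p).
Proof.
intros mC mE mD hJ Csq EC disj exit.
assert (cancel : forall k p, vadd (vadd p (vscal (-1) (vscal k u))) (vscal k u) = p).
{ intros k [x y]. unfold vadd, vscal; simpl. f_equal; ring. }
assert (mCk : forall k, meas (fun p => C (vadd p (vscal k u)))) by (intros k; exact (meas_translate C (vscal k u) mC)).
set (stay := fun n p => E p /\ forall k, (k < n)%nat -> C (vadd p (vscal (INR k) u))).
assert (mstay : forall n, meas (stay n)).
{ intros n. apply meas_and; [easy|]. now apply meas_forall_lt. }
set (last := fun j p => stay (S j) p /\ ~ C (vadd p (vscal (INR (S j)) u))).
assert (mlast : forall j, meas (last j)) by (intros j; apply meas_and; [easy|now apply meas_compl]).
set (tr := fun (A : nat -> set2) j p => A j (vadd p (vscal (-1) (vscal (INR j) u)))).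
assert (tr_disj : forall A : nat -> set2, (forall j p, A j p -> E p) ->
  forall i j p, In i (seq 0 J) -> In j (seq 0 J) -> tr A i p -> tr A j p -> i = j).
{ intros A AE i j p hi hj h1 h2. apply in_seq in hi, hj. unfold tr in *.
  apply AE in h1, h2. apply (disj (vadd p (vscal (-1) (vscal (INR i) u))) i j h1); [|lia|lia].
  revert h2. replace (vadd (vadd p (vscal (-1) (vscal (INR i) u))) (vscal (INR i - INR j) u))
    with (vadd p (vscal (-1) (vscal (INR j) u))); [easy|].
  unfold vadd, vscal; simpl. f_equal; ring. }
(* Translating [A j] by j [u] keeps its area, since it remains in the square, and makes these sets
   disjoint parts of [B]. This is used for [stay J], all of whose J translates fit into [C], and for
   the sets [last j]. *)
assert (key : forall (A : nat -> set2) (B : set2), meas B -> (forall j, meas (A j)) ->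
  (forall j p, (j < J)%nat -> A j p -> E p /\ C (vadd p (vscal (INR j) u)) /\ B (vadd p (vscal (INR j) u))) ->
  (forall j p, A j p -> E p) ->
  lsum (fun j => area (A j)) (seq 0 J) <= area B).
{ intros A B mB mA hA AE.
  apply Rle_trans with (lsum (fun j => area (tr A j)) (seq 0 J)).
  - apply lsum_le. intros j hj. apply in_seq in hj. right. symmetry.
    apply (area_shift (A j) (vscal (INR j) u)); [apply mA| |].
    + intros p hp. now apply Csq, EC, (AE j).
    + intros p hp. apply Csq. apply hA; [lia|easy].
  - apply area_disjoint_list; [apply seq_NoDup|easy| | |].
    + intros j hj. exact (meas_translate (A j) (vscal (-1) (vscal (INR j) u)) (mA j)).
    + intros j p hj h. apply in_seq in hj. destruct (hA j _ ltac:(lia) h) as [_ [_ h']].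
      now rewrite cancel in h'.
    + now apply tr_disj. }
assert (hJ' : 0 < INR J) by (now apply lt_0_INR).
assert (h1 : area (stay J) <= area C / INR J).
{ assert (H : lsum (fun _ => area (stay J)) (seq 0 J) <= area C).
  { apply (key (fun _ => stay J)); [easy|easy| |now intros j p [h _]].
    intros j p hj [hE hC]. repeat split; auto. }
  assert (e : forall m l, lsum (fun _ : nat => area (stay J)) (seq l m) = INR m * area (stay J)).
  { induction m as [|m IH]; intros l; [simpl; lra|]. rewrite S_INR. simpl. rewrite IH. lra. }
  rewrite e in H. apply (Rmult_le_reg_l (INR J)); [easy|].
  replace (INR J * (area C / INR J)) with (area C) by (field; lra). easy. }
assert (h2 : lsum (fun j => area (last j)) (seq 0 J) <= area (fun p => C p /\ D p)).
{ apply key; [now apply meas_and|easy| |now intros j p [[h _] _]].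
  intros j p hj [[hE hC] hN].
  assert (hj' : C (vadd p (vscal (INR j) u))) by (apply hC; lia).
  repeat split; auto. }
eapply Rle_trans; [|apply Rplus_le_compat; [exact h1|exact h2]].
eapply Rle_trans; [|apply Rplus_le_compat_l, area_union_list; now intros].
eapply Rle_trans; [|apply area_or_le; [easy|apply meas_ex_list; now intros]].
apply area_mono; [easy|apply meas_or; [easy|apply meas_ex_list; now intros]|].
intros p _ hp.
assert (H : forall n, (n <= J)%nat -> (0 < n)%nat ->
  stay n p \/ exists j, In j (seq 0 J) /\ last j p).
{ induction n as [|n IH]; intros hn hn0; [lia|].
  destruct n as [|n].
  - left. split; [easy|]. intros k hk. replace k with 0%nat by lia.
    replace (vadd p (vscal (INR 0) u)) with p; [now apply EC|].
    destruct p; unfold vadd, vscal; simpl. f_equal; ring.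
  - destruct (IH ltac:(lia) ltac:(lia)) as [h|h]; [|now right].
    destruct (classic (C (vadd p (vscal (INR (S n)) u)))) as [hc|hc].
    + left. destruct h as [h3 h4]. split; [easy|]. intros k hk.
      destruct (Nat.eq_dec k (S n)) as [->|]; [easy|apply h4; lia].
    + right. exists n. split; [apply in_seq; lia|now split]. }
apply H; lia.
Qed.

(** * Cylinders *)

Section Words.
Variable a : R.
Hypotheses (a_pos : 0 < a) (a_lt : a < 1 / 2).

Fixpoint itin (n : nat) (p : R * R) : list bool :=
  match n with
  | O => nil
  | S n' => plus a p :: itin n' (G a p)
  end.

Definition dfwd (b : bool) (v : R * R) : R * R := (snd v, sign b * (2 * level a v)).

(** The inverse derivative as a function of the word alone: one linear map serves a whole
    cylinder. *)
Fixpoint winv (w : list bool) (v : R * R) : R * R :=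
  match w with
  | nil => v
  | b :: w' => dinv a b (winv w' v)
  end.

Fixpoint wfwd (w : list bool) (v : R * R) : R * R :=
  match w with
  | nil => v
  | b :: w' => wfwd w' (dfwd b v)
  end.

Fixpoint words (n : nat) : list (list bool) :=
  match n with
  | O => [nil]
  | S n' => map (cons true) (words n') ++ map (cons false) (words n')
  end.

Lemma words_complete (w : list bool) : In w (words (length w)).
Proof.
induction w as [|b w IH]; simpl; [now left|].
apply in_or_app. destruct b; [left|right]; now apply in_map.
Qed.

Lemma words_NoDup (n : nat) : NoDup (words n).
Proof.
induction n as [|n IH]; simpl; [constructor; [easy|constructor]|].
apply NoDup_app.
- apply Injective_map_NoDup; [|easy]. intros u v h; now injection h.
- apply Injective_map_NoDup; [|easy]. intros u v h; now injection h.
- intros w h1 h2. apply in_map_iff in h1, h2.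
  destruct h1 as [u [<- _]], h2 as [v [h _]]. discriminate.
Qed.

Lemma itin_length (n : nat) (p : R * R) : length (itin n p) = n.
Proof. revert p; induction n as [|n IH]; intros p; simpl; [easy|now rewrite IH]. Qed.

Lemma skipn_itin (j n : nat) (p : R * R) : skipn j (itin (j + n) p) = itin n (iterG a j p).
Proof. revert p; induction j as [|j IH]; intros p; simpl; [easy|apply IH]. Qed.

Lemma back_winv (n : nat) (p : R * R) (v : R * R) : back a n p v = winv (itin n p) v.
Proof. revert p; induction n as [|n IH]; intros p; simpl; [easy|now rewrite IH]. Qed.

Lemma dfwd_dinv (b : bool) (v : R * R) : dfwd b (dinv a b v) = v.
Proof.
destruct v as [x y]; unfold dfwd, dinv, level, det; simpl.
f_equal. destruct b; simpl; field; lra.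
Qed.

Lemma wfwd_winv (w : list bool) (v : R * R) : wfwd w (winv w v) = v.
Proof. induction w as [|b w IH]; simpl; [easy|]. now rewrite dfwd_dinv. Qed.

Lemma winv_scal (w : list bool) (k : R) (v : R * R) : winv w (vscal k v) = vscal k (winv w v).
Proof.
induction w as [|b w IH]; simpl; [easy|]. rewrite IH.
unfold dinv, vscal, Rdiv; simpl. f_equal; ring.
Qed.

Lemma winv_add (w : list bool) (u v : R * R) : winv w (vadd u v) = vadd (winv w u) (winv w v).
Proof.
induction w as [|b w IH]; simpl; [easy|]. rewrite IH.
unfold dinv, vadd, Rdiv; simpl. f_equal; ring.
Qed.

Lemma G_same (p v : R * R) : plus a (vadd p v) = plus a p ->
  G a (vadd p v) = vadd (G a p) (dfwd (plus a p) v).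
Proof.
intros h. destruct (plus a p) eqn:e.
- rewrite (G_plus _ _ h), (G_plus _ _ e). unfold vadd, dfwd, level; simpl. f_equal; ring.
- rewrite (G_minus _ _ h), (G_minus _ _ e). unfold vadd, dfwd, level; simpl. f_equal; ring.
Qed.

Lemma iterG_same (n : nat) (p v : R * R) : itin n (vadd p v) = itin n p ->
  iterG a n (vadd p v) = vadd (iterG a n p) (wfwd (itin n p) v).
Proof.
revert p v; induction n as [|n IH]; intros p v h; simpl; [easy|].
simpl in h. injection h as h1 h2.
rewrite (G_same p v h1) in *. now apply IH.
Qed.

Lemma iterG_winv (n : nat) (p v : R * R) : itin n (vadd p (winv (itin n p) v)) = itin n p ->
  iterG a n (vadd p (winv (itin n p) v)) = vadd (iterG a n p) v.
Proof. intros h. now rewrite iterG_same, wfwd_winv. Qed.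

(** At time j the displacement is the inverse derivative of the remaining word applied to [v]; as
    long as the symbol is unchanged, the next displacement is again of this form. *)
Lemma same_itin (n : nat) (p v : R * R) :
  (forall j, (j < n)%nat ->
     plus a (vadd (iterG a j p) (winv (skipn j (itin n p)) v)) = plus a (iterG a j p)) ->
  itin n (vadd p (winv (itin n p) v)) = itin n p.
Proof.
revert p; induction n as [|n IH]; intros p h; [easy|].
pose proof (h 0%nat ltac:(lia)) as h0. simpl in h0. simpl.
rewrite h0. f_equal. rewrite (G_same _ _ h0), dfwd_dinv.
apply IH. intros j hj. exact (h (S j) ltac:(lia)).
Qed.

Lemma meas_level_ge (c : R) : meas (fun p => c <= level a p).
Proof.
apply (meas_ext (fun p => - (1 - a) * fst p + - a * snd p <= - c)); [apply meas_le|].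
intros p; unfold level; split; lra.
Qed.

Lemma meas_plus (b : bool) : meas (fun p => plus a p = b).
Proof.
destruct b.
- apply (meas_ext (fun p => ~ 1 / 2 <= level a p)); [apply meas_compl, meas_level_ge|].
  intros p; split.
  + intros h. destruct (plus a p) eqn:e; [easy|]. now apply plus_false in e.
  + intros h h'. apply plus_true in h. lra.
- apply (meas_ext (fun p => 1 / 2 <= level a p)); [apply meas_level_ge|].
  intros p; split.
  + intros h. destruct (plus a p) eqn:e; [|easy]. apply plus_true in e. lra.
  + apply plus_false.
Qed.

Lemma meas_G (A : set2) : meas A -> meas (fun p => A (G a p)).
Proof.
intros hA.
apply (meas_ext (fun p =>
  (plus a p = true /\ A (snd p, 2 * (1 - a) * fst p + 2 * a * snd p + 0)) \/
  (plus a p = false /\ A (snd p, - (2 * (1 - a)) * fst p + - (2 * a) * snd p + 2)))).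
- apply meas_or; apply meas_and; try apply meas_plus; now apply meas_shear.
- intros p. destruct (plus a p) eqn:e.
  + rewrite (G_plus _ _ e). unfold level.
    replace (2 * (a * snd p + (1 - a) * fst p)) with (2 * (1 - a) * fst p + 2 * a * snd p + 0) by ring.
    split; [intros [[_ h]|[h _]]; [easy|discriminate]|intros h; now left].
  + rewrite (G_minus _ _ e). unfold level.
    replace (2 - 2 * (a * snd p + (1 - a) * fst p)) with
      (- (2 * (1 - a)) * fst p + - (2 * a) * snd p + 2) by ring.
    split; [intros [[h _]|[_ h]]; [discriminate|easy]|intros h; now right].
Qed.

Lemma meas_iterG (n : nat) (A : set2) : meas A -> meas (fun p => A (iterG a n p)).
Proof. intros hA. induction n as [|n IH]; [easy|]. exact (meas_G (fun p => A (iterG a n p)) IH). Qed.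

Lemma meas_itin (n : nat) (w : list bool) : meas (fun p => itin n p = w).
Proof.
revert w; induction n as [|n IH]; intros w.
- simpl. apply meas_const.
- destruct w as [|b w].
  + apply (meas_ext (fun _ => False)); [apply meas_const|]. intros p; simpl; split; [easy|discriminate].
  + apply (meas_ext (fun p => plus a p = b /\ itin n (G a p) = w)).
    * apply meas_and; [apply meas_plus|]. exact (meas_G (fun p => itin n p = w) (IH w)).
    * intros p; simpl; split; [now intros [-> ->]|intros h; now injection h].
Qed.

Lemma area_by_words (n : nat) (A : set2) : meas A ->
  lsum (fun w => area (fun p => itin n p = w /\ A p)) (words n) = area A.
Proof.
intros mA. apply Rle_antisym.
- apply area_disjoint_list; [apply words_NoDup|easy| |now intros w p _ [_ h]|].
  + intros w _. apply meas_and; [apply meas_itin|easy].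
  + intros w w' p _ _ [h _] [h' _]. congruence.
- eapply Rle_trans; [|apply area_union_list].
  + apply area_mono; [easy| |].
    * apply meas_ex_list. intros w _. apply meas_and; [apply meas_itin|easy].
    * intros p _ hp. exists (itin n p). split; [|easy].
      rewrite <- (itin_length n p) at 2. apply words_complete.
  + intros w _. apply meas_and; [apply meas_itin|easy].
Qed.

Section SweepWords.
Variable X : set2.
Hypotheses (mX : meas X) (X_sq : forall p, X p -> unit_square p).

(** [sweep] is applied in each cylinder w with the direction [winv a w v], so that the n-th image
    moves by [v]; the bounds then add up over w without loss. The last hypothesis concerns a
    position [q] from which the next step leaves [X] or changes the itinerary. *)
Lemma sweep_words (n J : nat) (Z Q D : set2) (v : R * R) : meas Z -> meas Q -> meas D -> (0 < J)%nat ->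
  (forall u j, Z u -> (j <= J)%nat -> Q (vadd u (vscal (INR j) v))) ->
  (forall u i j, Z u -> Z (vadd u (vscal (INR i - INR j) v)) -> (i <= J)%nat -> (j <= J)%nat -> i = j) ->
  (forall p q j, X p -> Z (iterG a n p) -> (j < J)%nat -> X q -> itin n q = itin n p ->
     iterG a n q = vadd (iterG a n p) (vscal (INR j) v) ->
     ~ (X (vadd q (winv (itin n q) v)) /\ itin n (vadd q (winv (itin n q) v)) = itin n q) -> D q) ->
  area (fun p => X p /\ Z (iterG a n p)) <=
    area (fun p => X p /\ Q (iterG a n p)) / INR J +
    area (fun p => (X p /\ Q (iterG a n p)) /\ D p).
Proof.
intros mZ mQ mD hJ ZQ disj exit.
assert (hJ' : 0 < INR J) by (now apply lt_0_INR).
set (E := fun w p => itin n p = w /\ (X p /\ Z (iterG a n p))).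
set (C := fun w p => itin n p = w /\ (X p /\ Q (iterG a n p))).
assert (mXZ : meas (fun p => X p /\ Z (iterG a n p))) by (apply meas_and; [easy|now apply meas_iterG]).
assert (mXQ : meas (fun p => X p /\ Q (iterG a n p))) by (apply meas_and; [easy|now apply meas_iterG]).
assert (mE : forall w, meas (E w)) by (intros w; apply meas_and; [apply meas_itin|easy]).
assert (mC : forall w, meas (C w)) by (intros w; apply meas_and; [apply meas_itin|easy]).
assert (S1 : forall w, area (E w) <= area (C w) / INR J + area (fun p => C w p /\ D p)).
{ intros w. apply (sweep (C w) (E w) D (winv w v) J); auto.
  - intros p [_ [h _]]. auto.
  - intros p [h1 [h2 h3]]. repeat split; auto.
    replace (iterG a n p) with (vadd (iterG a n p) (vscal (INR 0) v)); [apply ZQ; [easy|lia]|].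
    destruct (iterG a n p); unfold vadd, vscal; simpl. f_equal; ring.
  - intros p i j [h1 [h2 h3]] [h4 [h5 h6]] hi hj.
    apply (disj (iterG a n p) i j h3); [|easy|easy].
    rewrite <- winv_scal in h4, h6. subst w. rewrite iterG_winv in h6; easy.
  - intros p j [h1 [h2 h3]] hj [h4 [h5 h6]] hN.
    rewrite <- winv_scal in h4, h5, h6 |- *. subst w.
    assert (e := iterG_winv n p (vscal (INR j) v) h4).
    apply (exit p _ j); auto.
    intros [h7 h8]. apply hN.
    assert (e' : vadd p (vscal (INR (S j)) (winv (itin n p) v)) =
      vadd (vadd p (winv (itin n p) (vscal (INR j) v))) (winv (itin n p) v)).
    { rewrite winv_scal, S_INR. unfold vadd, vscal; simpl. f_equal; ring. }
    rewrite h4 in h7, h8. rewrite e'. split; [easy|]. split; [easy|].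
    rewrite <- e' , <- winv_scal. rewrite <- e', <- winv_scal in h8.
    rewrite iterG_winv by easy. apply ZQ; [easy|lia]. }
rewrite <- (area_by_words n _ mXZ).
eapply Rle_trans; [apply lsum_le; intros w _; apply S1|].
rewrite lsum_add. apply Rplus_le_compat.
- rewrite <- (area_by_words n _ mXQ). unfold Rdiv. rewrite Rmult_comm, <- lsum_scal.
  apply lsum_le. intros w _. right. unfold C. ring.
- rewrite <- (area_by_words n (fun p => (X p /\ Q (iterG a n p)) /\ D p)) by (now apply meas_and).
  apply lsum_le. intros w _. apply area_mono.
  + apply meas_and; [apply mC|easy].
  + apply meas_and; [apply meas_itin|now apply meas_and].
  + intros p _ [[h1 h2] h3]. easy.
Qed.

End SweepWords.
End Words.

(** * Sweeping directions *)

Lemma common_eps {T : Type} (l : list T) (P : T -> R -> Prop) :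
  (forall x e e', P x e -> 0 < e' <= e -> P x e') ->
  (forall x, In x l -> exists e, 0 < e /\ P x e) ->
  exists e, 0 < e /\ forall x, In x l -> P x e.
Proof.
intros mono; induction l as [|x l IH]; intros H; [exists 1; split; [lra|easy]|].
destruct IH as [e1 [e1_pos h1]]; [intros y hy; apply H; now right|].
destruct (H x) as [e2 [e2_pos h2]]; [now left|].
assert (h : 0 < Rmin e1 e2) by (now apply Rmin_glb_lt).
exists (Rmin e1 e2); split; [easy|]. intros y [<-|hy].
- apply (mono x e2); [easy|split; [easy|apply Rmin_r]].
- apply (mono y e1); [now apply h1|split; [easy|apply Rmin_l]].
Qed.

Lemma separation (l : list R) :
  exists rho, 0 < rho /\ forall x y, In x l -> In y l -> x <> y -> rho <= Rabs (x - y).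
Proof.
destruct (common_eps (list_prod l l) (fun z e => fst z <> snd z -> e <= Rabs (fst z - snd z))) as [e [e_pos H]].
- intros x e e' h h' d. specialize (h d). lra.
- intros [x y] _; simpl. destruct (Req_dec x y) as [->|d]; [exists 1; split; [lra|easy]|].
  exists (Rabs (x - y)). split; [apply Rabs_pos_lt; lra|lra].
- exists e; split; [easy|]. intros x y hx hy d. exact (H (x, y) (in_prod _ _ _ _ hx hy) d).
Qed.

Lemma list_max (l : list R) (P : R -> Prop) : (exists x, In x l /\ P x) ->
  exists x, In x l /\ P x /\ forall y, In y l -> P y -> y <= x.
Proof.
induction l as [|x l IH]; [now intros [x [h _]]|]. intros H.
destruct (classic (exists y, In y l /\ P y)) as [h|h].
- destruct (IH h) as [m [h1 [h2 h3]]]. destruct (classic (P x /\ m <= x)) as [[hx hm]|hx].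
  + exists x; split; [now left|split; [easy|]]. intros y [<-|hy] py; [lra|].
    specialize (h3 y hy py); lra.
  + exists m; split; [now right|split; [easy|]]. intros y [<-|hy] py; [|now apply h3].
    apply Rnot_lt_le. intros d. apply hx; split; [easy|lra].
- destruct H as [y [[<-|hy] py]]; [|exfalso; apply h; now exists y].
  exists x; split; [now left|split; [easy|]]. intros y [<-|hy] py'; [lra|].
  exfalso; apply h; now exists y.
Qed.

(** An affine form in the coordinates near the critical line: the first runs along this line, called
    the axis below, and the second is the height above it. *)
Definition value (f : R * R * R) (z : R * R) : R := fst (fst f) + snd (fst f) * fst z + snd f * snd z.

(* Lines so flat that sweeping in the directions (t, 1), |t| <= T, cannot avoid crossing them. *)
Definition flat (T : R) (f : R * R * R) : Prop := snd (fst f) <> 0 /\ T <= Rabs (snd f / snd (fst f)).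

Definition step (t k : R) : R * R := (k * t, k).

(** The index i carries the direction ([snd i], 1). Points of [U i] sweep upwards inside [V i];
    disjointness of the sets [V i] keeps the losses of different directions from accumulating. *)
Record sweeping (L : list (R * R * R)) (T e : R) (I : list (R * R)) (U V : R * R -> set2) : Prop := {
  sw_nodup : NoDup I;
  sw_measU : forall i, meas (U i);
  sw_measV : forall i, meas (V i);
  sw_dir : forall i, In i I -> Rabs (snd i) <= T;
  sw_stay : forall i z k, In i I -> U i z -> 0 <= k <= e -> V i (vadd z (step (snd i) k));
  sw_disj : forall i j z, In i I -> In j I -> V i z -> V j z -> i = j;
  sw_sign : forall i z k f, In i I -> V i z -> 0 <= snd z <= 2 * e -> 0 <= k <= e ->
    In f L -> ~ flat T f -> value f z <> 0 -> 0 < value f z * value f (vadd z (step (snd i) k)) }.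

Section Fan.
Variables (L : list (R * R * R)) (T : R).
Hypothesis T_pos : 0 < T.

(** The line with equation z1 = P + r z2 is encoded as (P, r), where the vertex P is its
    intersection with the axis; lines parallel to the axis are treated apart. *)
Definition steep (f : R * R * R) : list (R * R) :=
  if Req_EM_T (snd (fst f)) 0 then []
  else if Rlt_dec (Rabs (snd f / snd (fst f))) T
    then [(- fst (fst f) / snd (fst f), - snd f / snd (fst f))] else [].

Let Ls := flat_map steep L.
Let Ps := map fst Ls.

Lemma steep_slope (P r : R) : In (P, r) Ls -> Rabs r < T.
Proof.
intros h. apply in_flat_map in h. destruct h as [[[c al] be] [_ h]]. unfold steep in h; cbn [fst snd] in h.
destruct (Req_EM_T al 0); [easy|]. destruct (Rlt_dec (Rabs (be / al)) T) as [d|]; [|easy].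
destruct h as [h|[]]. injection h as _ <-.
replace (- be / al) with (- (be / al)) by (now field). now rewrite Rabs_Ropp.
Qed.

Lemma steep_value (c al be : R) : In (c, al, be) L -> al <> 0 -> ~ flat T (c, al, be) ->
  exists P r, In (P, r) Ls /\ forall z, value (c, al, be) z = al * (fst z - P - r * snd z).
Proof.
intros hL ha hf. exists (- c / al), (- be / al). split.
- apply in_flat_map. exists (c, al, be). split; [easy|]. unfold steep; cbn [fst snd].
  destruct (Req_EM_T al 0); [easy|]. destruct (Rlt_dec (Rabs (be / al)) T); [now left|].
  exfalso; apply hf; split; cbn; [easy|lra].
- intros z. unfold value; cbn. now field.
Qed.

Definition gap (P r : R) (z : R * R) : R := fst z - P - r * snd z.

Lemma same_side (x y k : R) : k <> 0 -> 0 < x * y -> 0 < k * x * (k * y).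
Proof.
intros hk h. replace (k * x * (k * y)) with (k ^ 2 * (x * y)) by ring.
apply Rmult_lt_0_compat; [|easy]. nra.
Qed.

(** Where the vertical direction t = 0 crosses no steep line at small heights. *)
Definition far (rho : R) : set2 := fun z => forall P, In P Ps -> ~ Rabs (fst z - P) < rho / 4.
(* For i = (P, t): near the vertex P, t is the largest slope r of a line through P with gap P r > 0,
   or - T if there is none. In the direction (t, 1) the gap of the line of slope t is constant, and
   those of the other lines through P move away from 0. *)
Definition chamber (rho : R) (i : R * R) : set2 := fun z =>
  Rabs (fst z - fst i) < rho /\
  (snd i = - T \/ In i Ls /\ 0 < gap (fst i) (snd i) z) /\
  (forall l, In l Ls -> fst l = fst i -> snd i < snd l -> gap (fst i) (snd l) z <= 0).

Lemma pair_eq_dec (x y : R * R) : {x = y} + {x <> y}.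
Proof.
destruct x as [a b], y as [c d]. destruct (Req_EM_T a c) as [->|h]; [|right; congruence].
destruct (Req_EM_T b d) as [->|h]; [left; easy|right; congruence].
Defined.

Definition chambers : list (R * R) :=
  nodup pair_eq_dec (list_prod Ps (- T :: map snd Ls)).

Lemma meas_near (P c : R) : meas (fun z => Rabs (fst z - P) < c).
Proof.
apply (meas_ext (fun z => ~ (1 * fst z + 0 * snd z <= P - c) /\ ~ (-1 * fst z + 0 * snd z <= - P - c))).
- apply meas_and; apply meas_compl, meas_le.
- intros [x y]; cbn. split; [intros [h1 h2]; apply Rabs_def1; lra|].
  intros h; apply Rabs_def2 in h; lra.
Qed.

Lemma meas_gap (P r : R) : meas (fun z => gap P r z <= 0).
Proof.
apply (meas_ext (fun z => 1 * fst z + - r * snd z <= P)); [apply meas_le|].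
intros z; unfold gap; split; lra.
Qed.

Lemma meas_far (rho : R) : meas (far rho).
Proof. apply meas_forall_list. intros P _. apply meas_compl, meas_near. Qed.

Lemma meas_chamber (rho : R) (i : R * R) : meas (chamber rho i).
Proof.
apply meas_and; [apply meas_near|apply meas_and].
- apply meas_or; [apply meas_const|]. apply meas_and; [apply meas_const|].
  apply (meas_ext (fun z => ~ gap (fst i) (snd i) z <= 0)); [apply meas_compl, meas_gap|].
  intros z; split; lra.
- apply (meas_forall_list Ls (fun l z => fst l = fst i -> snd i < snd l -> gap (fst i) (snd l) z <= 0)).
  intros l _.
  apply (meas_ext (fun z => ~ (fst l = fst i /\ snd i < snd l) \/ gap (fst i) (snd l) z <= 0)).
  + apply meas_or; [apply meas_const|apply meas_gap].
  + intros z; tauto.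
Qed.

Lemma chambers_spec (i : R * R) : In i chambers ->
  In (fst i) Ps /\ (snd i = - T \/ exists l, In l Ls /\ snd l = snd i).
Proof.
intros h. apply nodup_In in h. destruct i as [P t]. apply in_prod_iff in h. destruct h as [h1 [h2|h2]].
- split; [easy|left; now subst].
- split; [easy|right]. apply in_map_iff in h2. destruct h2 as [l [<- hl]]. now exists l.
Qed.

Lemma chambers_dir (i : R * R) : In i chambers -> Rabs (snd i) <= T.
Proof.
intros h. apply chambers_spec in h. destruct h as [_ [->|[[P r] [h1 <-]]]].
- rewrite Rabs_Ropp, Rabs_pos_eq; lra.
- apply steep_slope in h1. cbn. lra.
Qed.

Lemma chamber_ex (rho : R) (z : R * R) (P : R) : In P Ps -> Rabs (fst z - P) < rho ->
  exists i, In i chambers /\ chamber rho i z.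
Proof.
intros hP hz.
assert (hin : forall t, In t (- T :: map snd Ls) -> In (P, t) chambers).
{ intros t ht. apply nodup_In. now apply in_prod. }
destruct (classic (exists r, In r (map snd Ls) /\ (In (P, r) Ls /\ 0 < gap P r z))) as [h|h].
- apply list_max in h. destruct h as [t [h1 [[h2 h3] h4]]].
  exists (P, t). split; [apply hin; now right|].
  split; [easy|]. split; [now right|].
  intros [P' r] hl e hr; cbn [fst snd] in *. subst P'. apply Rnot_lt_le. intros hg.
  specialize (h4 r (in_map snd _ _ hl) (conj hl hg)). lra.
- exists (P, - T). split; [apply hin; now left|].
  split; [easy|]. split; [now left|].
  intros [P' r] hl e hr; cbn [fst snd] in *. subst P'. apply Rnot_lt_le. intros hg.
  apply h. exists r. split; [exact (in_map snd _ _ hl)|easy].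
Qed.

(** Lines parallel to the axis: the axis itself (c = 0) is left behind by an upward motion, and the
    others are too far to be reached. *)
Lemma level_sign (c be q k : R) : c + be * q <> 0 -> 0 <= q -> 0 <= k ->
  (c <> 0 -> Rabs be * (q + k) < Rabs c) ->
  0 < (c + be * q) * (c + be * (q + k)).
Proof.
intros h hq hk H. destruct (Req_dec c 0) as [->|hc].
- assert (hb : be <> 0) by (intros ->; apply h; ring).
  assert (hq' : q <> 0) by (intros ->; apply h; ring).
  replace ((0 + be * q) * (0 + be * (q + k))) with (be ^ 2 * (q * (q + k))) by ring.
  apply Rmult_lt_0_compat; nra.
- specialize (H hc).
  assert (h1 : Rabs (be * q) < Rabs c).
  { rewrite Rabs_mult, (Rabs_pos_eq q hq). pose proof (Rabs_pos be). nra. }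
  assert (h2 : Rabs (be * (q + k)) < Rabs c) by (rewrite Rabs_mult, (Rabs_pos_eq (q + k)); [easy|lra]).
  destruct (Rle_lt_dec 0 c) as [c0|c0].
  + rewrite (Rabs_pos_eq c c0) in *. apply Rabs_def2 in h1, h2. apply Rmult_lt_0_compat; lra.
  + rewrite (Rabs_left c c0) in *. apply Rabs_def2 in h1, h2. nra.
Qed.

Lemma gap_step (P r t k : R) (z : R * R) : gap P r (vadd z (step t k)) = gap P r z + k * (t - r).
Proof. unfold gap, vadd, step; cbn. ring. Qed.

Theorem fan : exists e, 0 < e /\ exists Uf Un Vn,
  sweeping L T e [(0, 0)] (fun _ => Uf) (fun _ => Uf) /\
  sweeping L T e chambers Un Vn /\
  forall z, Uf z \/ exists i, In i chambers /\ Un i z.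
Proof.
destruct (separation Ps) as [rho [rho_pos sep]].
destruct (common_eps L (fun f e => fst (fst f) <> 0 -> Rabs (snd f) * (4 * e) < Rabs (fst (fst f))))
  as [e1 [e1_pos hor]].
{ intros f e e' h h' d. specialize (h d). pose proof (Rabs_pos (snd f)). nra. }
{ intros [[c al] be] _; cbn [fst snd]. destruct (Req_dec c 0) as [->|hc]; [exists 1; split; [lra|easy]|].
  assert (0 < Rabs c) by (now apply Rabs_pos_lt). pose proof (Rabs_pos be).
  exists (Rabs c / (8 * (Rabs be + 1))). split; [apply Rdiv_lt_0_compat; nra|]. intros _.
  apply Rmult_lt_reg_r with (2 * (Rabs be + 1)); [lra|].
  replace (Rabs be * (4 * (Rabs c / (8 * (Rabs be + 1)))) * (2 * (Rabs be + 1))) with (Rabs be * Rabs c) by (field; lra).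
  nra. }
(* Small enough that heights up to 3e avoid the other lines parallel to the axis, and that the drift
   T e along the axis is at most 1/40 of the distance between vertices. *)
set (e := Rmin e1 (rho / (40 * T))).
assert (e_pos : 0 < e) by (apply Rmin_glb_lt; [easy|apply Rdiv_lt_0_compat; lra]).
assert (e_1 : e <= e1) by apply Rmin_l.
assert (e_T : 40 * (T * e) <= rho).
{ assert (e <= rho / (40 * T)) by apply Rmin_r.
  apply Rmult_le_compat_r with (r := 40 * T) in H; [|lra].
  replace (rho / (40 * T) * (40 * T)) with rho in H by (field; lra). lra. }
assert (hflat : forall c be z t k, In (c, 0, be) L -> 0 <= snd z <= 2 * e -> 0 <= k <= e -> value (c, 0, be) z <> 0 ->
  0 < value (c, 0, be) z * value (c, 0, be) (vadd z (step t k))).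
{ intros c be [p q] t k hf hq hk. unfold value, vadd, step; cbn [fst snd] in *.
  replace (c + 0 * p + be * q) with (c + be * q) by ring.
  replace (c + 0 * (p + k * t) + be * (q + k)) with (c + be * (q + k)) by ring.
  intros h. apply level_sign; [easy|lra|lra|]. intros hc. specialize (hor _ hf hc); cbn [fst snd] in hor.
  pose proof (Rabs_pos be). nra. }
assert (away : forall P r z, In (P, r) Ls -> 0 <= snd z <= 3 * e -> rho / 4 <= Rabs (fst z - P) ->
  Rabs (r * snd z) < Rabs (fst z - P)).
{ intros P r z hl hz h. apply steep_slope in hl. rewrite Rabs_mult, (Rabs_pos_eq (snd z)) by easy.
  pose proof (Rabs_pos r). nra. }
assert (same : forall P r z z', In (P, r) Ls -> 0 <= snd z <= 3 * e -> 0 <= snd z' <= 3 * e ->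
  rho / 4 <= Rabs (fst z - P) -> Rabs (fst z' - fst z) < rho / 4 -> rho / 4 <= Rabs (fst z' - P) ->
  0 < gap P r z * gap P r z').
{ intros P r z z' hl hz hz' h1 h2 h3.
  pose proof (away P r z hl hz h1) as a1. pose proof (away P r z' hl hz' h3) as a2.
  unfold gap. apply Rabs_def2 in h2. revert h1 h3 a1 a2.
  destruct (Rle_lt_dec 0 (fst z - P)) as [d|d]; destruct (Rle_lt_dec 0 (fst z' - P)) as [d'|d'].
  - rewrite (Rabs_pos_eq (fst z - P)), (Rabs_pos_eq (fst z' - P)) by easy. intros _ _ a1 a2.
    apply Rabs_def2 in a1, a2. apply Rmult_lt_0_compat; lra.
  - rewrite (Rabs_pos_eq (fst z - P)), (Rabs_left (fst z' - P)) by easy. intros; lra.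
  - rewrite (Rabs_left (fst z - P)), (Rabs_pos_eq (fst z' - P)) by easy. intros; lra.
  - rewrite (Rabs_left (fst z - P)), (Rabs_left (fst z' - P)) by easy. intros _ _ a1 a2.
    apply Rabs_def2 in a1, a2.
    replace ((fst z - P - r * snd z) * (fst z' - P - r * snd z')) with
      ((r * snd z - (fst z - P)) * (r * snd z' - (fst z' - P))) by ring.
    apply Rmult_lt_0_compat; lra. }
(* The radius grows from rho/4 to rho/3 to leave room for the drift; neighbourhoods of distinct
   vertices stay disjoint, as 2 rho/3 < rho. *)
exists e; split; [easy|]. exists (far rho), (chamber (rho / 4)), (chamber (rho / 3)). split; [|split].
- split.
  + constructor; [easy|constructor].
  + intros _; apply meas_far.
  + intros _; apply meas_far.
  + intros i [<-|[]]; cbn. rewrite Rabs_R0; lra.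
  + intros i z k [<-|[]] h _ P hP. cbn. rewrite Rmult_0_r, Rplus_0_r. now apply h.
  + intros i j z [<-|[]] [<-|[]]; easy.
  + intros i z k [[c al] be] [<-|[]] hz hq hk hf hn hv. cbn [snd].
    destruct (Req_dec al 0) as [->|ha]; [now apply hflat|].
    destruct (steep_value c al be hf ha hn) as [P [r [hl e0]]]. rewrite !e0.
    apply same_side; [easy|].
    assert (hP : rho / 4 <= Rabs (fst z - P)) by (apply Rnot_lt_le, hz, (in_map fst _ _ hl)).
    apply (same P r); cbn; [easy|lra|lra|easy| |].
    * replace (fst z + k * 0 - fst z) with 0 by ring. rewrite Rabs_R0; lra.
    * replace (fst z + k * 0 - P) with (fst z - P) by ring. easy.
- split.
  + apply NoDup_nodup.
  + intros i; apply meas_chamber.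
  + intros i; apply meas_chamber.
  + apply chambers_dir.
  + intros i z k hi [h1 [h2 h3]] hk. split; [|split].
    * pose proof (chambers_dir i hi) as d. unfold vadd, step; cbn.
      replace (fst z + k * snd i - fst i) with ((fst z - fst i) + k * snd i) by ring.
      eapply Rle_lt_trans; [apply Rabs_triang|].
      rewrite Rabs_mult, (Rabs_pos_eq k) by easy. pose proof (Rabs_pos (snd i)). nra.
    * destruct h2 as [h2|[h2 h4]]; [now left|right; split; [easy|]]. rewrite gap_step. nra.
    * intros l hl e0 hr. rewrite gap_step. specialize (h3 l hl e0 hr). nra.
  + intros i j z hi hj [h1 [h2 h3]] [h4 [h5 h6]].
    assert (e0 : fst i = fst j).
    { destruct (Req_dec (fst i) (fst j)) as [e0|d]; [easy|exfalso].
      apply chambers_spec in hi, hj. pose proof (sep _ _ (proj1 hi) (proj1 hj) d) as d'.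
      apply Rabs_def2 in h1, h4. revert d'. apply Rlt_not_le, Rabs_def1; lra. }
    assert (low : forall x, In x chambers -> - T <= snd x).
    { intros x hx. apply chambers_dir in hx. pose proof (Rle_abs (- snd x)) as h. rewrite Rabs_Ropp in h. lra. }
    pose proof (low i hi). pose proof (low j hj).
    destruct i as [P t], j as [P' t']; cbn [fst snd] in *. subst P'. f_equal.
    destruct (Rtotal_order t t') as [d|[d|d]]; [exfalso|easy|exfalso].
    * destruct h5 as [->|[hl hg]]; [lra|]. specialize (h3 (P, t') hl eq_refl d). cbn in h3. lra.
    * destruct h2 as [->|[hl hg]]; [lra|]. specialize (h6 (P, t) hl eq_refl d). cbn in h6. lra.
  + intros i z k [[c al] be] hi [h1 [h2 h3]] hq hk hf hn hv.
    destruct (Req_dec al 0) as [->|ha]; [now apply hflat|].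
    destruct (steep_value c al be hf ha hn) as [P [r [hl e0]]]. rewrite !e0 in *.
    apply same_side; [easy|]. change (0 < gap P r z * gap P r (vadd z (step (snd i) k))).
    assert (hg : gap P r z <> 0) by (intros hg; unfold gap in hg; apply hv; rewrite hg; ring).
    destruct (Req_dec (fst i) P) as [e1'|d].
    (* Lines through the same vertex: a slope r > t has a negative gap, which decreases, and a slope
       r <= t a positive gap, which does not decrease. *)
    * rewrite gap_step. destruct (Rlt_le_dec (snd i) r) as [d|d].
      -- specialize (h3 _ hl (eq_sym e1') d); cbn [snd] in h3. rewrite e1' in h3.
         assert (gap P r z < 0) by lra. assert (gap P r z + k * (snd i - r) < 0) by nra. nra.
      -- destruct h2 as [h2|[h2 h4]].
         ++ exfalso. apply steep_slope in hl. apply Rabs_def2 in hl. lra.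
         ++ rewrite e1' in h4. assert (0 < gap P r z).
            { replace (gap P r z) with (gap P (snd i) z + (snd i - r) * snd z) by (unfold gap; ring). nra. }
            apply Rmult_lt_0_compat; nra.
    (* The other vertices are at distance at least rho from this one, too far for their lines to be
       met at small heights. *)
    * pose proof (chambers_dir i hi) as dir. apply chambers_spec in hi.
      pose proof (sep _ _ (proj1 hi) (in_map fst _ _ hl) d) as d'; cbn in d'.
      assert (m : Rabs (k * snd i) <= T * e).
      { rewrite Rabs_mult, (Rabs_pos_eq k) by easy. pose proof (Rabs_pos (snd i)). nra. }
      assert (tri : forall x, Rabs x <= rho / 3 + T * e -> rho / 4 <= Rabs (x + (fst i - P))).
      { intros x hx. pose proof (Rabs_triang (x + (fst i - P)) (- x)) as tr. rewrite Rabs_Ropp in tr.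
        replace (x + (fst i - P) + - x) with (fst i - P) in tr by ring. lra. }
      apply same; [easy|cbn; lra|cbn; lra| | |].
      -- replace (fst z - P) with (fst z - fst i + (fst i - P)) by ring. apply tri. nra.
      -- unfold vadd, step; cbn. replace (fst z + k * snd i - fst z) with (k * snd i) by ring. lra.
      -- unfold vadd, step; cbn. replace (fst z + k * snd i - P) with (fst z - fst i + k * snd i + (fst i - P)) by ring.
         apply tri. eapply Rle_trans; [apply Rabs_triang|]. lra.
- intros z. destruct (classic (far rho z)) as [h|h]; [now left|right].
  apply not_all_ex_not in h. destruct h as [P h]. apply imply_to_and in h. destruct h as [hP h].
  apply NNPP in h. now apply (chamber_ex _ z P).
Qed.

End Fan.

(** * Strips around the critical line *)

(** The cost of a crossing k steps back; up to K steps back it is zero. *)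
Definition late_term (th c : R) (K k : nat) : R := if (k <=? K)%nat then 0 else c * th ^ k.

Lemma tail_ge0 (th c : R) (K k : nat) : 0 < th -> 0 <= c -> 0 <= late_term th c K k.
Proof.
intros h1 h2. unfold late_term. destruct (k <=? K)%nat; [lra|]. apply Rmult_le_pos; [easy|].
apply pow_le; lra.
Qed.

Lemma lsum_map {S T : Type} (f : T -> R) (g : S -> T) (l : list S) : lsum f (map g l) = lsum (fun x => f (g x)) l.
Proof. induction l as [|x l IH]; simpl; [easy|now rewrite IH]. Qed.

Lemma tail_sum_le (th c : R) (K n : nat) : 0 < th < 1 -> 0 <= c ->
  lsum (fun j => late_term th c K (n - j)) (seq 0 n) <= c * (th ^ K / (1 - th) * (1 - th ^ (n - K))).
Proof.
intros hth hc. induction n as [|n IH].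
- simpl. right. ring.
- cbn [seq lsum fold_right]. rewrite <- seq_shift.
  change (fold_right _ 0 ?l) with (lsum (fun j => late_term th c K (S n - j)) l).
  rewrite lsum_map. change (lsum (fun x => late_term th c K (S n - S x)) (seq 0 n)) with
    (lsum (fun j => late_term th c K (n - j)) (seq 0 n)).
  rewrite Nat.sub_0_r. unfold late_term at 1. destruct (Nat.leb_spec (S n) K) as [h|h].
  + replace (S n - K)%nat with 0%nat by lia. replace (n - K)%nat with 0%nat in IH by lia. lra.
  + eapply Rle_trans; [apply Rplus_le_compat_l, IH|]. rewrite <- Rmult_plus_distr_l.
    apply Rmult_le_compat_l; [easy|].
    replace (S n - K)%nat with (S (n - K)) by lia. simpl.
    replace (th ^ n) with (th ^ K * th ^ (n - K)) by (rewrite <- pow_add; f_equal; lia).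
    apply Rmult_le_reg_r with (1 - th); [lra|].
    replace (th ^ K / (1 - th) * (1 - th * th ^ (n - K)) * (1 - th)) with
      (th ^ K * (1 - th * th ^ (n - K))) by (field; lra).
    replace ((th * (th ^ K * th ^ (n - K)) + th ^ K / (1 - th) * (1 - th ^ (n - K))) * (1 - th)) with
      (th ^ K * (th * th ^ (n - K) * (1 - th) + (1 - th ^ (n - K)))) by (field; lra).
    assert (0 < th ^ K) by (apply pow_lt; lra). assert (0 < th ^ (n - K)) by (apply pow_lt; lra).
    apply Rmult_le_compat_l; [lra|].
    assert (0 <= th ^ (n - K) * (1 - th) ^ 2) by (apply Rmult_le_pos; [lra|apply pow2_ge_0]). lra.
Qed.

Lemma tail_small (th c s : R) : 0 < th < 1 -> 0 <= c -> 0 < s ->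
  exists K, forall n, lsum (fun j => late_term th c K (n - j)) (seq 0 n) <= s.
Proof.
intros hth hc hs. destruct (pow_lt_1_zero th ltac:(rewrite Rabs_pos_eq; lra) (s * (1 - th) / (c + 1))) as [K hK].
{ apply Rdiv_lt_0_compat; nra. }
exists K. intros n. eapply Rle_trans; [now apply tail_sum_le|].
specialize (hK K (Nat.le_refl K)). rewrite Rabs_pos_eq in hK by (apply pow_le; lra).
assert (0 < th ^ K) by (apply pow_lt; lra). assert (0 < th ^ (n - K)) by (apply pow_lt; lra).
apply Rmult_le_reg_r with (1 - th); [lra|].
replace (c * (th ^ K / (1 - th) * (1 - th ^ (n - K))) * (1 - th)) with (c * th ^ K * (1 - th ^ (n - K))) by (field; lra).
apply Rmult_lt_compat_r with (r := c + 1) in hK; [|lra].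
replace (s * (1 - th) / (c + 1) * (c + 1)) with (s * (1 - th)) in hK by (field; lra).
assert (0 <= c * th ^ K) by nra. nra.
Qed.

Lemma meas_level_abs (a d : R) : meas (fun p => Rabs (level a p - 1 / 2) <= d).
Proof.
apply (meas_ext (fun p => (1 - a) * fst p + a * snd p <= 1 / 2 + d /\ - (1 - a) * fst p + - a * snd p <= d - 1 / 2)).
- apply meas_and; apply meas_le.
- intros p. unfold level. split.
  + intros [h1 h2]. apply Rabs_le. lra.
  + intros h. pose proof (Rle_abs (a * snd p + (1 - a) * fst p - 1 / 2)).
    pose proof (Rle_abs (- (a * snd p + (1 - a) * fst p - 1 / 2))) as h'. rewrite Rabs_Ropp in h'. lra.
Qed.

Definition corner : set2 := fun p => 9 / 10 <= fst p <= 1 /\ 9 / 10 <= snd p <= 1.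

Lemma corner_sq (p : R * R) : corner p -> unit_square p.
Proof. unfold corner, unit_square; lra. Qed.

Lemma meas_corner : meas corner.
Proof. apply meas_rect. Qed.

Lemma sign_cases (b : bool) : sign b = 1 \/ sign b = -1.
Proof. destruct b; cbn; lra. Qed.

Lemma sign_abs (b : bool) : Rabs (sign b) = 1.
Proof. destruct b; cbn; [rewrite Rabs_pos_eq|rewrite Rabs_left]; lra. Qed.

Lemma nat_floor (x : R) : 1 <= x -> exists J, (0 < J)%nat /\ INR J <= x < INR J + 1.
Proof.
intros hx. destruct (INR_unbounded x) as [N hN]. induction N as [|N IH]; [simpl in hN; lra|].
destruct (Rlt_le_dec x (INR N)) as [h|h]; [now apply IH|].
exists N. rewrite S_INR in hN. split; [|lra]. destruct N; [simpl in hN; lra|lia].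
Qed.

Lemma not_flat_list (L : list (R * R * R)) : exists T, 0 < T /\ forall f, In f L -> ~ flat T f.
Proof.
induction L as [|f L [T [T_pos IH]]]; [exists 1; split; [lra|easy]|].
exists (T + Rabs (snd f / snd (fst f)) + 1). pose proof (Rabs_pos (snd f / snd (fst f))).
split; [lra|]. intros g [<-|hg] [h1 h2]; [lra|]. apply (IH g hg). split; [easy|lra].
Qed.

Section Strips.
Variables a C th : R.
Hypotheses (a_pos : 0 < a) (a_le : a <= 46 / 100) (C_pos : 0 < C) (th_bd : 0 < th < 1).
Hypothesis contr : forall p, Lam a p -> forall n v, norm1 (back a n p v) <= C * th ^ n * norm1 v.

Let a_lt : a < 1 / 2.
Proof. lra. Qed.

Lemma corner_Lam (p : R * R) : corner p -> Lam a p.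
Proof.
intros h. split; [now apply corner_sq|]. destruct p as [x y], h as [h1 h2]; cbn [fst snd] in *.
unfold level; cbn [fst snd]. split; [nra|right; nra].
Qed.

Lemma winv_bound (p v : R * R) (j k : nat) : corner p ->
  norm1 (winv a (itin a k (iterG a j p)) v) <= C * th ^ k * norm1 v.
Proof. intros h. rewrite <- back_winv. apply contr. apply iterG_Lam; [easy|easy|]. now apply corner_Lam. Qed.

(** The affine inverse branch along w, extended to the whole plane; the shift comes from the
    constant 2 of the minus branch. *)
Fixpoint anc (w : list bool) (u : R * R) : R * R :=
  match w with
  | nil => u
  | b :: w' => vadd (dinv a b (anc w' u)) ((1 - sign b) / det a, 0)
  end.

Lemma anc_itin (n : nat) (p : R * R) : anc (itin a n p) (iterG a n p) = p.
Proof.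
revert p; induction n as [|n IH]; intros p; [easy|]. cbn [itin iterG anc]. rewrite IH.
destruct p as [x y]. destruct (plus a (x, y)) eqn:e.
- rewrite (G_plus _ _ e). unfold dinv, vadd, level, det; cbn. f_equal; [|lra]. field; lra.
- rewrite (G_minus _ _ e). unfold dinv, vadd, level, det; cbn. f_equal; [|lra]. field; lra.
Qed.

Lemma anc_add (w : list bool) (u v : R * R) : anc w (vadd u v) = vadd (anc w u) (winv a w v).
Proof.
induction w as [|b w IH]; [easy|]. cbn [anc winv]. rewrite IH. unfold dinv, vadd, Rdiv; cbn. f_equal; ring.
Qed.

(* [dir s t] has level [s] and second coordinate [t]. *)
Definition dir (s t : R) : R * R := ((s - a * t) / (1 - a), t).
(** The sign makes the height nonnegative on the side considered. Here [true] stands for the side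
    where the level is at least 1/2, not for the plus symbol. *)
Definition coords (b : bool) (u : R * R) : R * R := (snd u, sign b * (level a u - 1 / 2)).
(** The form [level a (anc w u) - 1 / 2] in the coordinates of u: it vanishes when the point reached
    by going back along w lies on the critical line. The constant term is its value at (1/(2(1 -
    a)), 0), the point with coordinates (0, 0). *)
Definition line (b : bool) (w : list bool) : R * R * R :=
  (level a (anc w (/ (2 * (1 - a)), 0)) - 1 / 2, level a (winv a w (dir 0 1)), sign b * level a (winv a w (dir 1 0))).
Definition lines (b : bool) (K : nat) : list (R * R * R) := map (line b) (flat_map words (seq 0 (S K))).

Lemma level_add (u v : R * R) : level a (vadd u v) = level a u + level a v.
Proof. unfold level, vadd; cbn; ring. Qed.

Lemma level_scal (k : R) (v : R * R) : level a (vscal k v) = k * level a v.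
Proof. unfold level, vscal; cbn; ring. Qed.

Lemma level_norm (v : R * R) : Rabs (level a v) <= norm1 v.
Proof.
unfold level, norm1. eapply Rle_trans; [apply Rabs_triang|]. rewrite !Rabs_mult.
rewrite (Rabs_pos_eq a), (Rabs_pos_eq (1 - a)) by lra.
pose proof (Rabs_pos (fst v)). pose proof (Rabs_pos (snd v)). nra.
Qed.

Lemma norm1_scal (k : R) (v : R * R) : norm1 (vscal k v) = Rabs k * norm1 v.
Proof. unfold norm1, vscal; cbn. rewrite !Rabs_mult. ring. Qed.

Lemma line_value (b : bool) (w : list bool) (u : R * R) :
  value (line b w) (coords b u) = level a (anc w u) - 1 / 2.
Proof.
assert (e : u = vadd (/ (2 * (1 - a)), 0) (vadd (vscal (snd u) (dir 0 1)) (vscal (level a u - 1 / 2) (dir 1 0)))).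
{ destruct u as [x y]. unfold vadd, vscal, dir, level; cbn. f_equal; [field; lra|ring]. }
rewrite e at 2. rewrite anc_add, winv_add, !winv_scal, !level_add, !level_scal.
unfold value, line, coords; cbn [fst snd]. destruct (sign_cases b) as [-> | ->]; ring.
Qed.

Lemma coords_step (b : bool) (u : R * R) (t k : R) :
  coords b (vadd u (vscal k (dir (sign b) t))) = vadd (coords b u) (step t k).
Proof.
unfold coords. rewrite level_add, level_scal.
replace (level a (dir (sign b) t)) with (sign b) by (unfold level, dir; cbn; field; lra).
unfold vadd, vscal, step; cbn. f_equal. destruct (sign_cases b) as [-> | ->]; ring.
Qed.

Lemma meas_coords (b : bool) (A : set2) : meas A -> meas (fun u => A (coords b u)).
Proof.
intros h. apply (meas_ext (fun u => A (snd u, sign b * (1 - a) * fst u + sign b * a * snd u + - (sign b / 2)))).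
- now apply meas_shear.
- intros u. unfold coords, level.
  replace (sign b * (1 - a) * fst u + sign b * a * snd u + - (sign b / 2)) with
    (sign b * (a * snd u + (1 - a) * fst u - 1 / 2)) by field. easy.
Qed.

Lemma lines_in (b : bool) (K : nat) (w : list bool) : (length w <= K)%nat -> In (line b w) (lines b K).
Proof.
intros h. apply in_map, in_flat_map. exists (length w). split; [apply in_seq; lia|apply words_complete].
Qed.

Lemma dir_norm (b : bool) (t T : R) : Rabs t <= T -> norm1 (dir (sign b) t) <= 2 * T + 2.
Proof.
intros h. unfold norm1, dir; cbn [fst snd].
assert (h1 : Rabs ((sign b - a * t) / (1 - a)) <= T + 2); [|lra].
unfold Rdiv. rewrite Rabs_mult, (Rabs_pos_eq (/ (1 - a))) by (apply Rlt_le, Rinv_0_lt_compat; lra).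
apply Rmult_le_reg_r with (1 - a); [lra|].
replace (Rabs (sign b - a * t) * / (1 - a) * (1 - a)) with (Rabs (sign b - a * t)) by (field; lra).
assert (Rabs (sign b - a * t) <= 1 + a * T).
{ eapply Rle_trans; [apply Rabs_triang|]. rewrite Rabs_Ropp, Rabs_mult, (Rabs_pos_eq a) by lra.
  rewrite sign_abs. nra. }
pose proof (Rabs_pos t). nra.
Qed.

Section Exit.
Variables (b : bool) (K0 K1 : nat) (T : R).
Hypothesis T_pos : 0 < T.
Hypothesis T_big : forall w, (length w <= K0)%nat -> ~ flat T (line b w).

(* If a sweep of step h is interrupted k steps back in the past, then the orbit is within h cross k
   of the critical line at that time: among the words of length at most K0 no line is flat, and
   among those of length at most K1 only the flat lines can be crossed. *)
Definition cross (k : nat) : R := late_term th (4 * C) K0 k + late_term th (C * (2 * T + 2)) K1 k.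

(** Where a sweep may be interrupted: so close to the boundary of [corner] that a displacement of
    norm at most h C (2T + 2) may leave it, or too close to the critical line at an earlier time. *)
Definition exits (n : nat) (h : R) : set2 := fun q =>
  (fst q <= 9 / 10 + h * (C * (2 * T + 2)) \/ 1 - h * (C * (2 * T + 2)) <= fst q \/
   snd q <= 9 / 10 + h * (C * (2 * T + 2)) \/ 1 - h * (C * (2 * T + 2)) <= snd q) \/
  exists j, In j (seq 0 n) /\ Rabs (level a (iterG a j q) - 1 / 2) <= h * cross (n - j).

Lemma cross_ge0 (k : nat) : 0 <= cross k.
Proof. apply Rplus_le_le_0_compat; apply tail_ge0; try lra; nra. Qed.

Lemma same_plus (x y : R * R) :
  0 < (level a x - 1 / 2) * (level a x - 1 / 2 + level a y) -> plus a (vadd x y) = plus a x.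
Proof.
intros h. unfold plus. rewrite level_add.
destruct (Rlt_dec (level a x + level a y) (1 / 2)), (Rlt_dec (level a x) (1 / 2)); try easy; exfalso; nra.
Qed.

Lemma pow_th (k : nat) : 0 < th ^ k <= 1.
Proof. split; [apply pow_lt; lra|]. rewrite <- (pow1 k). apply pow_incr; lra. Qed.

Lemma stay_corner (n : nat) (h : R) (q v : R * R) : 0 < h -> corner q -> norm1 v <= h * (2 * T + 2) ->
  ~ exits n h q -> corner (vadd q (winv a (itin a n q) v)).
Proof.
intros hh hq hv hN. apply not_or_and in hN. destruct hN as [hB _].
pose proof (winv_bound q v 0 n hq) as bd. cbn [iterG] in bd. pose proof (pow_th n).
assert (norm1 (winv a (itin a n q) v) <= h * (C * (2 * T + 2))).
{ eapply Rle_trans; [apply bd|].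
  assert (0 <= norm1 v) by (unfold norm1; pose proof (Rabs_pos (fst v)); pose proof (Rabs_pos (snd v)); lra).
  assert (C * th ^ n <= C) by nra. assert (C * th ^ n * norm1 v <= C * norm1 v) by nra. nra. }
set (x := winv a (itin a n q) v) in *. unfold norm1 in H0.
pose proof (Rle_abs (fst x)). pose proof (Rle_abs (- fst x)) as h1. rewrite Rabs_Ropp in h1.
pose proof (Rle_abs (snd x)). pose proof (Rle_abs (- snd x)) as h2. rewrite Rabs_Ropp in h2.
pose proof (Rabs_pos (fst x)). pose proof (Rabs_pos (snd x)).
unfold corner, vadd; cbn [fst snd]. lra.
Qed.

Lemma small_change (x y : R) : Rabs y < Rabs x -> 0 < x * (x + y).
Proof.
intros d. destruct (Rle_lt_dec 0 x) as [x0|x0].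
- rewrite (Rabs_pos_eq x x0) in d. apply Rabs_def2 in d. nra.
- rewrite (Rabs_left x x0) in d. apply Rabs_def2 in d. nra.
Qed.

Lemma not_exits_level (n j : nat) (h : R) (q : R * R) : (j < n)%nat -> ~ exits n h q ->
  h * cross (n - j) < Rabs (level a (iterG a j q) - 1 / 2).
Proof.
intros hj hN. apply not_or_and in hN. apply Rnot_le_lt. intros hx. apply hN.
exists j. split; [apply in_seq; lia|easy].
Qed.

Lemma skipn_suffix (n j : nat) (q : R * R) : (j < n)%nat ->
  skipn j (itin a n q) = itin a (n - j) (iterG a j q).
Proof. intros hj. replace n with (j + (n - j))%nat at 1 by lia. apply skipn_itin. Qed.

(** More than K1 steps back, contraction makes the displacement smaller than the distance to the
    critical line. *)
Lemma late_letter (n j : nat) (h : R) (q v : R * R) : 0 < h -> corner q -> norm1 v <= h * (2 * T + 2) ->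
  (j < n)%nat -> (K1 < n - j)%nat -> ~ exits n h q ->
  0 < (level a (iterG a j q) - 1 / 2) *
      (level a (iterG a j q) - 1 / 2 + level a (winv a (skipn j (itin a n q)) v)).
Proof.
intros hh hq hv hj hk hN. apply small_change. rewrite skipn_suffix by easy.
eapply Rle_lt_trans; [|exact (not_exits_level n j h q hj hN)].
eapply Rle_trans; [apply level_norm|]. eapply Rle_trans; [now apply winv_bound|].
set (k := (n - j)%nat) in *. pose proof (pow_th k).
apply Rle_trans with (h * (C * (2 * T + 2) * th ^ k)).
- replace (h * (C * (2 * T + 2) * th ^ k)) with (C * th ^ k * (h * (2 * T + 2))) by ring.
  apply Rmult_le_compat_l; [nra|easy].
- apply Rmult_le_compat_l; [lra|]. unfold cross, late_term at 2. destruct (Nat.leb_spec k K1); [lia|].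
  assert (0 <= late_term th (4 * C) K0 k) by (apply tail_ge0; lra). lra.
Qed.

(** A change of the symbol k steps back is excluded by contraction if k > K1, by a cost independent
    of T if the line is flat, and by the choice of the direction otherwise. *)
Lemma no_exit (e h : R) (I : list (R * R)) (U V : R * R -> set2) (n : nat) (i q : R * R) :
  sweeping (lines b K1) T e I U V -> 0 < h <= e -> In i I -> corner q ->
  V i (coords b (iterG a n q)) -> 0 <= snd (coords b (iterG a n q)) <= 2 * e ->
  ~ exits n h q ->
  let v := vscal h (dir (sign b) (snd i)) in
  corner (vadd q (winv a (itin a n q) v)) /\ itin a n (vadd q (winv a (itin a n q) v)) = itin a n q.
Proof.
intros sw he hi hq hV hu hN v.
assert (hv : norm1 v <= h * (2 * T + 2)).
{ unfold v. rewrite norm1_scal, Rabs_pos_eq by lra. apply Rmult_le_compat_l; [lra|].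
  apply dir_norm. now apply (sw_dir _ _ _ _ _ _ sw). }
split; [now apply (stay_corner n h)|].
apply same_itin; [lra|]. intros j hj. apply same_plus.
destruct (Nat.le_gt_cases (n - j) K1) as [hk1|hk1]; [|now apply (late_letter n j h)].
pose proof (not_exits_level n j h q hj hN) as hx.
rewrite skipn_suffix by easy. set (x := level a (iterG a j q) - 1 / 2) in *.
set (k := (n - j)%nat) in *. set (w := itin a k (iterG a j q)).
pose proof (pow_th k) as hk.
destruct (classic (flat T (line b w))) as [hf|hf].
- apply small_change. eapply Rle_lt_trans; [|exact hx].
  assert (hk0 : (K0 < k)%nat).
  { apply Nat.nle_gt. intros hk0. apply (T_big w); [|easy]. unfold w. now rewrite itin_length. }
  (* On a flat line T |al| <= |be|, so a direction (t, 1) with |t| <= T changes the form by at most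
     2 |be|, and |be| <= 2 C th^k. *)
  apply Rle_trans with (h * (4 * C * th ^ k)).
  2:{ apply Rmult_le_compat_l; [lra|]. unfold cross, late_term at 1. destruct (Nat.leb_spec k K0); [lia|].
      assert (0 <= late_term th (C * (2 * T + 2)) K1 k) by (apply tail_ge0; nra). lra. }
  unfold v. rewrite winv_scal, level_scal, Rabs_mult, (Rabs_pos_eq h) by lra.
  apply Rmult_le_compat_l; [lra|].
  set (al := level a (winv a w (dir 0 1))). set (be := level a (winv a w (dir 1 0))).
  replace (level a (winv a w (dir (sign b) (snd i)))) with (snd i * al + sign b * be).
  2:{ replace (dir (sign b) (snd i)) with (vadd (vscal (snd i) (dir 0 1)) (vscal (sign b) (dir 1 0))).
      - now rewrite winv_add, !winv_scal, level_add, !level_scal.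
      - unfold vadd, vscal, dir; cbn. f_equal; [field; lra|ring]. }
  assert (hbe : Rabs be <= 2 * (C * th ^ k)).
  { eapply Rle_trans; [apply level_norm|]. eapply Rle_trans; [now apply winv_bound|].
    rewrite Rmult_comm. apply Rmult_le_compat_r; [nra|].
    unfold norm1, dir; cbn. rewrite Rabs_R0, Rabs_pos_eq by (apply Rlt_le, Rdiv_lt_0_compat; lra).
    apply Rmult_le_reg_r with (1 - a); [lra|]. replace (((1 - a * 0) / (1 - a) + 0) * (1 - a)) with 1 by (field; lra). lra. }
  destruct hf as [hf1 hf2]. unfold line in hf1, hf2; cbn [fst snd] in hf1, hf2. fold al be in hf1, hf2.
  assert (hsb : Rabs (sign b * be) = Rabs be) by (rewrite Rabs_mult, sign_abs; ring).
  unfold Rdiv in hf2. rewrite Rabs_mult, hsb, Rabs_inv in hf2.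
  assert (hal : 0 < Rabs al) by (now apply Rabs_pos_lt).
  apply Rmult_le_compat_r with (r := Rabs al) in hf2; [|lra].
  replace (Rabs be * / Rabs al * Rabs al) with (Rabs be) in hf2 by (field; lra).
  eapply Rle_trans; [apply Rabs_triang|]. rewrite hsb, Rabs_mult.
  pose proof (sw_dir _ _ _ _ _ _ sw i hi). pose proof (Rabs_pos (snd i)). nra.
- pose proof (sw_sign _ _ _ _ _ _ sw i (coords b (iterG a n q)) h (line b w) hi hV hu) as s.
  rewrite <- coords_step, !line_value, anc_add, level_add in s.
  assert (ew : anc w (iterG a n q) = iterG a j q).
  { replace n with (j + k)%nat by lia. rewrite iterG_add. apply anc_itin. }
  rewrite ew in s. unfold x.
  replace (level a (iterG a j q) - 1 / 2 + level a (winv a w v)) with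
    (level a (iterG a j q) + level a (winv a w v) - 1 / 2) by ring.
  apply s; [lra| |easy|].
  + apply lines_in. unfold w. now rewrite itin_length.
  + fold x. intros x0. rewrite x0, Rabs_R0 in hx.
    assert (0 <= h * cross k) by (apply Rmult_le_pos; [lra|apply cross_ge0]). lra.
Qed.

Lemma meas_exits (n : nat) (h : R) : meas (exits n h).
Proof.
apply meas_or; [|apply meas_ex_list; intros j _; exact (meas_iterG a j _ (meas_level_abs a _))].
set (y := h * (C * (2 * T + 2))).
apply (meas_ext (fun p => (1 * fst p + 0 * snd p <= 9 / 10 + y \/ -1 * fst p + 0 * snd p <= y - 1) \/
  (0 * fst p + 1 * snd p <= 9 / 10 + y \/ 0 * fst p + -1 * snd p <= y - 1))).
- apply meas_or; apply meas_or; apply meas_le.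
- intros p; lra.
Qed.

Definition strip (n : nat) (d : R) : R := area (fun p => corner p /\ Rabs (level a (iterG a n p) - 1 / 2) <= d).

Lemma meas_strip (n : nat) (d : R) : meas (fun p => corner p /\ Rabs (level a (iterG a n p) - 1 / 2) <= d).
Proof. apply meas_and; [apply meas_corner|]. exact (meas_iterG a n _ (meas_level_abs a _)). Qed.

Lemma exits_area (n : nat) (h : R) : 0 < h ->
  area (fun p => corner p /\ exits n h p) <=
    4 * (h * (C * (2 * T + 2))) + lsum (fun j => strip j (h * cross (n - j))) (seq 0 n).
Proof.
intros hh. set (y := h * (C * (2 * T + 2))).
assert (hy : 0 < y) by (unfold y; apply Rmult_lt_0_compat; [easy|nra]).
assert (rect : forall x1 x2 y1 y2 s, x1 <= x2 -> y1 <= y2 -> (x2 - x1) * (y2 - y1) <= s ->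
  area (fun p => x1 <= fst p <= x2 /\ y1 <= snd p <= y2) <= s).
{ intros x1 x2 y1 y2 s h1 h2 h3. eapply Rle_trans; [now apply area_rect_le|easy]. }
set (R1 := fun p : R * R => 9 / 10 <= fst p <= 9 / 10 + y /\ 9 / 10 <= snd p <= 1).
set (R2 := fun p : R * R => 1 - y <= fst p <= 1 /\ 9 / 10 <= snd p <= 1).
set (R3 := fun p : R * R => 9 / 10 <= fst p <= 1 /\ 9 / 10 <= snd p <= 9 / 10 + y).
set (R4 := fun p : R * R => 9 / 10 <= fst p <= 1 /\ 1 - y <= snd p <= 1).
assert (m1 : meas R1) by apply meas_rect. assert (m2 : meas R2) by apply meas_rect.
assert (m3 : meas R3) by apply meas_rect. assert (m4 : meas R4) by apply meas_rect.
assert (a1 : area R1 <= y) by (apply rect; lra). assert (a2 : area R2 <= y) by (apply rect; lra).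
assert (a3 : area R3 <= y) by (apply rect; lra). assert (a4 : area R4 <= y) by (apply rect; lra).
set (W := fun p => exists j, In j (seq 0 n) /\ (corner p /\ Rabs (level a (iterG a j p) - 1 / 2) <= h * cross (n - j))).
assert (mW : meas W) by (apply meas_ex_list; intros j _; apply meas_strip).
assert (aW : area W <= lsum (fun j => strip j (h * cross (n - j))) (seq 0 n)).
{ apply area_union_list. intros j _. apply meas_strip. }
apply Rle_trans with (area (fun p => ((R1 p \/ R2 p) \/ (R3 p \/ R4 p)) \/ W p)).
- apply area_mono.
  + apply meas_and; [apply meas_corner|apply meas_exits].
  + apply meas_or; [apply meas_or; now apply meas_or|easy].
  + intros p _ [hc [hp|[j [hj hp]]]].
    * left. unfold R1, R2, R3, R4, corner in *. fold y in hp. lra.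
    * right. now exists j.
- eapply Rle_trans; [apply area_or_le; [apply meas_or; now apply meas_or|easy]|].
  assert (area (fun p => (R1 p \/ R2 p) \/ R3 p \/ R4 p) <= 4 * y); [|lra].
  eapply Rle_trans; [apply area_or_le; apply meas_or; easy|].
  pose proof (area_or_le R1 R2 m1 m2). pose proof (area_or_le R3 R4 m3 m4). lra.
Qed.

(** Each step changes the level by 3d while the strip has width 2d, so its translates are disjoint.
    As the sets [V i] are disjoint too, both terms are summed over all directions without
    multiplicity. *)
Lemma family_bound (e d : R) (I : list (R * R)) (U V : R * R -> set2) (n J : nat) :
  sweeping (lines b K1) T e I U V -> 0 < d -> (0 < J)%nat -> INR J * (3 * d) <= e ->
  area (fun p => corner p /\ exists i, In i I /\ (U i (coords b (iterG a n p)) /\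
      Rabs (level a (iterG a n p) - 1 / 2) <= d /\ 0 <= snd (coords b (iterG a n p)))) <=
    / INR J + area (fun p => corner p /\ exits n (3 * d) p).
Proof.
intros sw hd hJ he.
assert (hJ1 : 1 <= INR J) by (replace 1 with (INR 1) by easy; apply le_INR; lia).
assert (hde : 3 * d <= e) by nra.
set (Z := fun i u => U i (coords b u) /\ Rabs (level a u - 1 / 2) <= d /\ 0 <= snd (coords b u)).
set (Q := fun i u => V i (coords b u)).
set (D := exits n (3 * d)).
assert (mZ : forall i, meas (Z i)).
{ intros i. apply meas_and; [apply meas_coords, (sw_measU _ _ _ _ _ _ sw)|].
  apply meas_and; [apply meas_level_abs|]. apply (meas_coords b (fun z => 0 <= snd z)).
  apply (meas_ext (fun z => 0 * fst z + -1 * snd z <= 0)); [apply meas_le|]. intros z; lra. }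
assert (mQ : forall i, meas (Q i)) by (intros i; apply meas_coords, (sw_measV _ _ _ _ _ _ sw)).
assert (mD : meas D) by apply meas_exits.
assert (mXZ : forall i, meas (fun p => corner p /\ Z i (iterG a n p))).
{ intros i. apply meas_and; [apply meas_corner|]. now apply meas_iterG. }
assert (mXQ : forall i, meas (fun p => corner p /\ Q i (iterG a n p))).
{ intros i. apply meas_and; [apply meas_corner|]. now apply meas_iterG. }
assert (mXQD : forall i, meas (fun p => (corner p /\ Q i (iterG a n p)) /\ D p)) by (intros i; now apply meas_and).
apply Rle_trans with (area (fun p => exists i, In i I /\ (corner p /\ Z i (iterG a n p)))).
{ apply area_mono.
  - apply (meas_ext (fun p => exists i, In i I /\ (corner p /\ Z i (iterG a n p)))).
    + apply meas_ex_list; easy.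
    + intros p; split; [intros [i [h1 [h2 h3]]]; split; [easy|now exists i]|intros [h1 [i [h2 h3]]]; now exists i].
  - apply meas_ex_list; easy.
  - intros p _ [h1 [i [h2 h3]]]; now exists i. }
eapply Rle_trans; [apply area_union_list; easy|].
assert (bound : forall k, 0 <= k <= e -> forall i u, In i I -> Z i u ->
  Q i (vadd u (vscal k (dir (sign b) (snd i))))).
{ intros k hk i u hi [hu _]. unfold Q. rewrite coords_step. now apply (sw_stay _ _ _ _ _ _ sw). }
assert (scal : forall (j : R) (i : R * R), vscal j (vscal (3 * d) (dir (sign b) (snd i))) = vscal (j * (3 * d)) (dir (sign b) (snd i))).
{ intros j i. unfold vscal; cbn. f_equal; ring. }
assert (hjJ : forall j, (j <= J)%nat -> 0 <= INR j * (3 * d) <= e).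
{ intros j hj. apply le_INR in hj. pose proof (pos_INR j). split; [nra|]. nra. }
assert (one : forall i, In i I -> area (fun p => corner p /\ Z i (iterG a n p)) <=
  / INR J * area (fun p => corner p /\ Q i (iterG a n p)) + area (fun p => (corner p /\ Q i (iterG a n p)) /\ D p)).
{ intros i hi. rewrite Rmult_comm.
  apply (sweep_words a a_lt corner meas_corner corner_sq n J (Z i) (Q i) D (vscal (3 * d) (dir (sign b) (snd i)))); try easy.
  - intros u j hu hj. rewrite scal. apply bound; [now apply hjJ|easy|easy].
  - intros u i' j' [_ [h1 _]] [_ [h2 _]] hi' hj'. rewrite scal, level_add, level_scal in h2.
    replace (level a (dir (sign b) (snd i))) with (sign b) in h2 by (unfold level, dir; cbn; field; lra).
    assert (h : Rabs ((INR i' - INR j') * (3 * d)) <= 2 * d).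
    { replace ((INR i' - INR j') * (3 * d)) with
        (sign b * ((level a u + (INR i' - INR j') * (3 * d) * sign b - 1 / 2) + - (level a u - 1 / 2))).
      - rewrite Rabs_mult, sign_abs, Rmult_1_l. eapply Rle_trans; [apply Rabs_triang|]. rewrite Rabs_Ropp. lra.
      - destruct (sign_cases b) as [-> | ->]; ring. }
    apply INR_eq. rewrite Rabs_mult, (Rabs_pos_eq (3 * d)) in h by lra.
    assert (h' : Rabs (INR i' - INR j') < 1) by nra. apply Rabs_def2 in h'.
    destruct (Nat.lt_trichotomy i' j') as [t|[t|t]]; [exfalso|now f_equal|exfalso].
    + apply (le_INR (S i') j') in t. rewrite S_INR in t. lra.
    + apply (le_INR (S j') i') in t. rewrite S_INR in t. lra.
  - intros p q j hp hZ hj hq _ e0 hN. apply NNPP. intros hD. apply hN. rewrite scal in e0.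
    assert (hj' : 0 <= INR j * (3 * d) <= e) by (apply hjJ; lia).
    apply (no_exit e (3 * d) I U V n i q sw); [lra|easy|easy| | |exact hD].
    + rewrite e0. now apply (bound _ hj').
    + rewrite e0, coords_step. destruct hZ as [_ [h1 h2]]. unfold vadd, step; cbn [snd].
      assert (snd (coords b (iterG a n p)) <= d); [|lra].
      unfold coords; cbn [snd]. apply Rle_trans with (2 := h1).
      destruct (sign_cases b) as [-> | ->].
      * rewrite Rmult_1_l. apply Rle_abs.
      * rewrite <- Rabs_Ropp. replace (-1 * (level a (iterG a n p) - 1 / 2)) with (- (level a (iterG a n p) - 1 / 2)) by ring.
        apply Rle_abs. }
eapply Rle_trans; [apply (lsum_le _ _ I one)|].
rewrite lsum_add, lsum_scal.
assert (disj : forall i j p, In i I -> In j I -> Q i (iterG a n p) -> Q j (iterG a n p) -> i = j).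
{ intros i j p hi hj h1 h2. exact (sw_disj _ _ _ _ _ _ sw i j _ hi hj h1 h2). }
apply Rplus_le_compat.
- rewrite <- (Rmult_1_r (/ INR J)) at 2. apply Rmult_le_compat_l; [apply Rlt_le, Rinv_0_lt_compat; lra|].
  eapply Rle_trans; [apply (area_disjoint_list I _ corner)|apply area_le1, meas_corner].
  + apply (sw_nodup _ _ _ _ _ _ sw).
  + apply meas_corner.
  + intros i _. apply mXQ.
  + now intros i p _ [h _].
  + intros i j p hi hj [_ h1] [_ h2]. now apply (disj i j p).
- apply area_disjoint_list.
  + apply (sw_nodup _ _ _ _ _ _ sw).
  + apply meas_and; [apply meas_corner|easy].
  + intros i _. apply mXQD.
  + now intros i p _ [[h _] h'].
  + intros i j p hi hj [[_ h1] _] [[_ h2] _]. now apply (disj i j p).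
Qed.

End Exit.

Lemma strip_step (n : nat) (K : R) : 0 <= K ->
  (forall j, (j < n)%nat -> forall x, 0 < x -> strip j x <= K * x) ->
  forall K0 K1 T, 0 < T -> forall h, 0 < h ->
  lsum (fun j => strip j (h * cross K0 K1 T (n - j))) (seq 0 n) <=
    K * h * (lsum (fun j => late_term th (4 * C) K0 (n - j)) (seq 0 n) +
             lsum (fun j => late_term th (C * (2 * T + 2)) K1 (n - j)) (seq 0 n)).
Proof.
intros hK IH K0 K1 T hT h hh. rewrite <- lsum_add, <- lsum_scal. apply lsum_le. intros j hj.
apply in_seq in hj. rewrite Rmult_assoc.
change (strip j (h * cross K0 K1 T (n - j)) <= K * (h * cross K0 K1 T (n - j))).
destruct (Rle_lt_or_eq_dec 0 (h * cross K0 K1 T (n - j))) as [hc|hc].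
- apply Rmult_le_pos; [lra|now apply cross_ge0].
- apply IH; [lia|easy].
(* The induction hypothesis needs a positive width; a strip of width zero is contained in all thin
   ones. *)
- rewrite <- hc, Rmult_0_r. apply le_epsilon. intros x hx. rewrite Rplus_0_l.
  apply Rle_trans with (strip j (x / (K + 1))).
  + apply area_mono; [apply meas_strip|apply meas_strip|].
    intros p _ [h1 h2]. split; [easy|]. eapply Rle_trans; [exact h2|]. apply Rlt_le, Rdiv_lt_0_compat; lra.
  + eapply Rle_trans; [apply IH; [lia|apply Rdiv_lt_0_compat; lra]|].
    apply Rmult_le_reg_r with (K + 1); [lra|]. replace (K * (x / (K + 1)) * (K + 1)) with (K * x) by (field; lra). nra.
Qed.

Theorem strip_bound : exists K, 0 < K /\ forall n d, 0 < d -> strip n d <= K * d.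
Proof.
(* The constants are chosen in the order K0, T, K1. Each 1/48 contributes K (3d)/48 to the area of
   [exits]; after the factor 4 the two of them amount to K d/2, so the induction closes. *)
destruct (tail_small th (4 * C) (1 / 48)) as [K0 hK0]; [easy|lra|lra|].
destruct (not_flat_list (lines true K0 ++ lines false K0)) as [T [T_pos hT]].
assert (T_big : forall b w, (length w <= K0)%nat -> ~ flat T (line b w)).
{ intros b w hw. apply hT, in_or_app. destruct b; [left|right]; now apply lines_in. }
set (M := C * (2 * T + 2)). assert (M_pos : 0 < M) by (apply Rmult_lt_0_compat; lra).
destruct (tail_small th M (1 / 48)) as [K1 hK1]; [easy|lra|lra|].
(* The factor 2 stands for the points far from the vertices and those in chambers. *)
assert (fans : forall b, exists e, 0 < e /\ forall n d J, 0 < d -> (0 < J)%nat -> INR J * (3 * d) <= e ->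
  area (fun p => (corner p /\ Rabs (level a (iterG a n p) - 1 / 2) <= d) /\
     0 <= sign b * (level a (iterG a n p) - 1 / 2)) <=
  2 * (/ INR J + area (fun p => corner p /\ exits K0 K1 T n (3 * d) p))).
{ intros b. destruct (fan (lines b K1) T T_pos) as [e [e_pos [Uf [Un [Vn [sf [sn cov]]]]]]].
  exists e. split; [easy|]. intros n d J hd hJ he.
  pose proof (family_bound b K0 K1 T T_pos (T_big b) e d _ _ _ n J sf hd hJ he) as bf.
  pose proof (family_bound b K0 K1 T T_pos (T_big b) e d _ _ _ n J sn hd hJ he) as bn.
  assert (mc : forall (I : list (R * R)) (U : R * R -> set2), (forall i, meas (U i)) ->
    meas (fun p => corner p /\ exists i, In i I /\ (U i (coords b (iterG a n p)) /\
      Rabs (level a (iterG a n p) - 1 / 2) <= d /\ 0 <= snd (coords b (iterG a n p))))).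
  { intros I U mU. apply meas_and; [apply meas_corner|].
    apply (meas_iterG a n (fun u => exists i, In i I /\ (U i (coords b u) /\
      Rabs (level a u - 1 / 2) <= d /\ 0 <= snd (coords b u)))).
    apply meas_ex_list. intros i _. apply meas_and; [now apply meas_coords|]. apply meas_and; [apply meas_level_abs|].
    apply (meas_coords b (fun z => 0 <= snd z)).
    apply (meas_ext (fun z => 0 * fst z + -1 * snd z <= 0)); [apply meas_le|]. intros z; lra. }
  pose proof (mc [(0, 0)] _ (sw_measU _ _ _ _ _ _ sf)) as mf.
  pose proof (mc (chambers (lines b K1) T) _ (sw_measU _ _ _ _ _ _ sn)) as mn.
  eapply Rle_trans; [|apply Rle_trans with (1 := area_or_le _ _ mf mn); lra].
  apply area_mono; [|now apply meas_or|].
  - apply meas_and; [apply meas_strip|]. apply (meas_iterG a n (fun u => 0 <= snd (coords b u))).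
    apply (meas_coords b (fun z => 0 <= snd z)).
    apply (meas_ext (fun z => 0 * fst z + -1 * snd z <= 0)); [apply meas_le|]. intros z; lra.
  - intros p _ [[h1 h2] h3]. destruct (cov (coords b (iterG a n p))) as [h|[i [hi h]]].
    + left. split; [easy|]. exists (0, 0). split; [now left|now split].
    + right. split; [easy|]. exists i. split; [easy|now split]. }
destruct (fans true) as [e1 [e1_pos H1]]. destruct (fans false) as [e2 [e2_pos H2]]. clear fans.
set (e := Rmin e1 e2). assert (e_pos : 0 < e) by (now apply Rmin_glb_lt).
assert (e_1 : e <= e1) by apply Rmin_l. assert (e_2 : e <= e2) by apply Rmin_r.
(* The solution of K = 24/e + 48 M + K/2, which is the recursive estimate divided by d. *)
set (K := 2 * (24 / e + 48 * M)).
assert (K_e : 48 <= K * e).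
{ unfold K. replace (2 * (24 / e + 48 * M) * e) with (48 + 96 * (M * e)) by (field; lra).
  assert (0 < M * e) by (now apply Rmult_lt_0_compat). lra. }
assert (K_pos : 0 < K) by nra.
exists K. split; [easy|]. intros n. induction n as [n IH] using (well_founded_induction lt_wf). intros d hd.
(* For wide strips the trivial bound 1 is enough, because K e >= 48. *)
destruct (Rlt_le_dec e (3 * d)) as [he|he].
- apply Rle_trans with 1; [apply area_le1, meas_strip|]. nra.
- destruct (nat_floor (e / (3 * d))) as [J [hJ [J1 J2]]].
  { apply Rmult_le_reg_r with (3 * d); [lra|]. replace (e / (3 * d) * (3 * d)) with e by (field; lra). lra. }
  assert (hJ1 : 1 <= INR J) by (replace 1 with (INR 1) by easy; apply le_INR; lia).
  assert (heJ : INR J * (3 * d) <= e).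
  { apply Rmult_le_compat_r with (r := 3 * d) in J1; [|lra]. replace (e / (3 * d) * (3 * d)) with e in J1 by (field; lra). easy. }
  assert (hiJ : / INR J <= 6 * d / e).
  { apply Rmult_lt_compat_r with (r := 3 * d) in J2; [|lra]. replace (e / (3 * d) * (3 * d)) with e in J2 by (field; lra).
    apply Rmult_le_reg_r with (INR J * e); [apply Rmult_lt_0_compat; lra|].
    replace (/ INR J * (INR J * e)) with e by (field; lra).
    replace (6 * d / e * (INR J * e)) with (6 * d * INR J) by (field; lra). nra. }
  set (X := area (fun p => corner p /\ exits K0 K1 T n (3 * d) p)).
  assert (hX : X <= 12 * (d * M) + K * d / 8).
  { eapply Rle_trans; [apply exits_area; lra|]. fold M.
    pose proof (strip_step n K ltac:(lra) IH K0 K1 T T_pos (3 * d) ltac:(lra)) as st. fold M in st.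
    specialize (hK0 n). specialize (hK1 n).
    assert (0 < K * (3 * d)) by (apply Rmult_lt_0_compat; lra).
    apply Rmult_le_compat_l with (r := K * (3 * d)) in hK0; [|lra].
    apply Rmult_le_compat_l with (r := K * (3 * d)) in hK1; [|lra].
    rewrite Rmult_plus_distr_l in st. lra. }
  assert (split : strip n d <= 2 * (/ INR J + X) + 2 * (/ INR J + X)).
  { set (Y := fun b p => (corner p /\ Rabs (level a (iterG a n p) - 1 / 2) <= d) /\
      0 <= sign b * (level a (iterG a n p) - 1 / 2)).
    assert (mY : forall b, meas (Y b)).
    { intros b. apply meas_and; [apply meas_strip|]. apply (meas_iterG a n (fun u => 0 <= snd (coords b u))).
      apply (meas_coords b (fun z => 0 <= snd z)).
      apply (meas_ext (fun z => 0 * fst z + -1 * snd z <= 0)); [apply meas_le|]. intros z; lra. }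
    apply Rle_trans with (area (fun p => Y true p \/ Y false p)).
    - apply area_mono; [apply meas_strip|now apply meas_or|]. intros p _ hp.
      destruct (Rle_lt_dec 0 (level a (iterG a n p) - 1 / 2)) as [h|h]; [left|right]; (split; [easy|]); cbn; lra.
    - eapply Rle_trans; [apply area_or_le; apply mY|]. apply Rplus_le_compat.
      + apply H1; [easy|easy|lra].
      + apply H2; [easy|easy|lra]. }
  apply Rle_trans with (1 := split).
  assert (e0 : K * d = 48 * d / e + 96 * (d * M)) by (unfold K; field; lra).
  replace (48 * d / e) with (8 * (6 * d / e)) in e0 by (field; lra). lra.
Qed.

End Strips.

(** * Uniform absolute continuity *)

Section Transfer.
Variable a : R.
Hypotheses (a_pos : 0 < a) (a_lt : a < 1 / 2).

Lemma det_pow_pos (n : nat) : 0 < det a ^ n.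
Proof. apply pow_lt. pose proof (det_bounds a a_pos a_lt). lra. Qed.

Lemma G_branch (b : bool) (q : R * R) : plus a q = b ->
  G a q = (snd q, sign b * det a * fst q + sign b * (2 * a) * snd q + (1 - sign b)).
Proof.
destruct b; intros e; [rewrite (G_plus _ _ e)|rewrite (G_minus _ _ e)]; unfold level, det; cbn; f_equal; ring.
Qed.

Lemma branch_step (b : bool) (p q x : R * R) :
  q = vadd p (dinv a b x) <->
  (snd q, sign b * det a * fst q + sign b * (2 * a) * snd q + (1 - sign b)) =
  vadd (snd p, sign b * det a * fst p + sign b * (2 * a) * snd p + (1 - sign b)) x.
Proof.
pose proof (det_bounds a a_pos a_lt) as db.
destruct p as [p1 p2], q as [q1 q2], x as [x1 x2]. unfold vadd, dinv; cbn [fst snd]. split; intros h.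
- injection h as -> ->. f_equal. destruct (sign_cases b) as [-> | ->]; field; lra.
- injection h as -> h. f_equal. apply Rmult_eq_reg_l with (det a); [|lra].
  replace (det a * (p1 + (sign b * x2 - 2 * a * x1) / det a)) with
    (det a * p1 + (sign b * x2 - 2 * a * x1)) by (field; lra).
  destruct (sign_cases b) as [s | s]; rewrite s in *; lra.
Qed.

Lemma branch_det (b : bool) : sign b * det a <> 0 /\ Rabs (sign b * det a) = det a.
Proof.
pose proof (det_bounds a a_pos a_lt). split; [destruct b; cbn; lra|].
rewrite Rabs_mult, sign_abs, Rabs_pos_eq; lra.
Qed.

(** On a cylinder the iterate is injective and affine with Jacobian [det a ^ n] in absolute value;
    each symbol contributes one use of [area_shear_le]. *)
Lemma cylinder_image (n : nat) (w : list bool) (A : set2) : meas A ->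
  area (fun q => (unit_square q /\ itin a n q = w) /\ A (iterG a n q)) <= area A / det a ^ n.
Proof.
intros mA. revert w; induction n as [|n IH]; intros w.
- simpl. unfold Rdiv. rewrite Rinv_1, Rmult_1_r. apply area_mono; [|easy|now intros q _ [_ h]].
  apply meas_and; [|easy]. apply meas_and; [apply meas_sq|apply meas_const].
- destruct w as [|b w].
  + rewrite area_empty; [| |now intros q [[_ h] _]].
    * apply Rmult_le_pos; [apply area_ge0|]. apply Rlt_le, Rinv_0_lt_compat, det_pow_pos.
    * apply meas_and; [|exact (meas_iterG a (S n) A mA)].
      apply meas_and; [apply meas_sq|exact (meas_itin a (S n) [])].
  + set (B := fun q => (unit_square q /\ itin a n q = w) /\ A (iterG a n q)).
    assert (mB : meas B).
    { apply meas_and; [apply meas_and; [apply meas_sq|apply meas_itin]|]. exact (meas_iterG a n A mA). }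
    destruct (branch_det b) as [d1 d2].
    apply Rle_trans with (area (fun q => B (snd q, sign b * det a * fst q + sign b * (2 * a) * snd q + (1 - sign b)))).
    * apply area_mono.
      -- apply meas_and; [apply meas_and; [apply meas_sq|exact (meas_itin a (S n) (b :: w))]|].
         exact (meas_iterG a (S n) A mA).
      -- now apply meas_shear.
      -- intros q _ [[h1 h2] h3]. simpl in h2. injection h2 as h4 h5.
         rewrite <- (G_branch b q h4). split; [split; [now apply G_square|easy]|easy].
    * eapply Rle_trans; [apply area_shear_le; [easy|easy|now intros q [[h _] _]]|].
      rewrite d2. pose proof (det_bounds a a_pos a_lt). pose proof (det_pow_pos n).
      apply Rmult_le_reg_r with (det a); [lra|]. unfold Rdiv at 1. rewrite Rmult_assoc, Rinv_l, Rmult_1_r by lra.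
      eapply Rle_trans; [apply IH|]. right. simpl. field. lra.
Qed.

(** Here the area is exact, since the whole box pulls back into the square at every stage. *)
Lemma inner_box (e : R) (n : nat) (p : R * R) : 0 < e ->
  (forall v, Rabs (fst v) <= e -> Rabs (snd v) <= e ->
     unit_square (vadd p (winv a (itin a n p) v)) /\
     itin a n (vadd p (winv a (itin a n p) v)) = itin a n p) ->
  let B := fun q => exists v, Rabs (fst v) <= e /\ Rabs (snd v) <= e /\ q = vadd p (winv a (itin a n p) v) in
  meas B /\ area B = 4 * e ^ 2 / det a ^ n.
Proof.
intros he. revert p; induction n as [|n IH]; intros p H.
- cbn [itin winv]. cbn [itin winv] in H.
  assert (iff : forall q, (fst p - e <= fst q <= fst p + e /\ snd p - e <= snd q <= snd p + e) <->
    exists v, Rabs (fst v) <= e /\ Rabs (snd v) <= e /\ q = vadd p v).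
  { intros [x y]. split.
    - intros [h1 h2]; cbn [fst snd] in *. exists (x - fst p, y - snd p). cbn. repeat split.
      + apply Rabs_le; lra.
      + apply Rabs_le; lra.
      + unfold vadd; cbn. f_equal; ring.
    - intros [v [h1 [h2 h3]]]. unfold vadd in h3. injection h3 as -> ->. cbn [fst snd].
      pose proof (Rle_abs (fst v)). pose proof (Rle_abs (- fst v)) as h3. rewrite Rabs_Ropp in h3.
      pose proof (Rle_abs (snd v)). pose proof (Rle_abs (- snd v)) as h4. rewrite Rabs_Ropp in h4. lra. }
  assert (m : meas (fun q => exists v, Rabs (fst v) <= e /\ Rabs (snd v) <= e /\ q = vadd p v)).
  { eapply meas_ext; [apply (meas_rect (fst p - e) (fst p + e) (snd p - e) (snd p + e))|exact iff]. }
  split; [exact m|].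
  rewrite (area_ext _ (fun q => fst p - e <= fst q <= fst p + e /\ snd p - e <= snd q <= snd p + e));
    [|exact m|apply meas_rect|intros q _; now rewrite iff].
  assert (ae : Rabs e <= e) by (rewrite Rabs_pos_eq; lra).
  assert (am : Rabs (- e) <= e) by (now rewrite Rabs_Ropp).
  destruct (H (e, e) ae ae) as [h1 _]. destruct (H (- e, - e) am am) as [h2 _].
  unfold unit_square, vadd in h1, h2; cbn [fst snd] in h1, h2.
  rewrite area_rect by lra. simpl. field.
- set (b := plus a p).
  assert (H' : forall v, Rabs (fst v) <= e -> Rabs (snd v) <= e ->
     unit_square (vadd (G a p) (winv a (itin a n (G a p)) v)) /\
     itin a n (vadd (G a p) (winv a (itin a n (G a p)) v)) = itin a n (G a p)).
  { intros v h1 h2. destruct (H v h1 h2) as [h3 h4]. cbn [itin winv] in h3, h4. injection h4 as h5 h6.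
    apply (G_square a a_pos a_lt) in h3. rewrite (G_same _ _ _ h5), dfwd_dinv in h3, h6 by easy. now split. }
  destruct (IH (G a p) H') as [m e0]. cbv zeta.
  set (B := fun q => exists v, Rabs (fst v) <= e /\ Rabs (snd v) <= e /\ q = vadd (G a p) (winv a (itin a n (G a p)) v)) in *.
  assert (iff : forall q,
    B (snd q, sign b * det a * fst q + sign b * (2 * a) * snd q + (1 - sign b)) <->
    exists v, Rabs (fst v) <= e /\ Rabs (snd v) <= e /\ q = vadd p (winv a (itin a (S n) p) v)).
  { intros q; split; intros [v [h1 [h2 h3]]]; exists v; (split; [easy|split; [easy|]]).
    - apply (branch_step b p q). now rewrite <- (G_branch b p eq_refl).
    - pattern (G a p) at 1. rewrite (G_branch b p eq_refl). now apply branch_step. }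
  assert (m' : meas (fun q => B (snd q, sign b * det a * fst q + sign b * (2 * a) * snd q + (1 - sign b)))) by
    (now apply meas_shear).
  assert (m2 : meas (fun q => exists v, Rabs (fst v) <= e /\ Rabs (snd v) <= e /\ q = vadd p (winv a (itin a (S n) p) v))).
  { eapply meas_ext; [exact m'|exact iff]. }
  split; [exact m2|].
  rewrite (area_ext _ _ m2 m'); [|intros q _; now rewrite iff].
  destruct (branch_det b) as [d1 d2].
  rewrite area_shear; [|easy|easy| |].
  + rewrite e0, d2. pose proof (det_bounds a a_pos a_lt). pose proof (det_pow_pos n). simpl. field. lra.
  + intros q [v [h1 [h2 ->]]]. now apply H'.
  + intros q hq. apply iff in hq. destruct hq as [v [h1 [h2 ->]]]. now apply H.
Qed.

End Transfer.

Section Uniform.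
Variables a C th K : R.
Hypotheses (a_pos : 0 < a) (a_le : a <= 46 / 100) (C_pos : 0 < C) (th_bd : 0 < th < 1).
Hypothesis contr : forall p, Lam a p -> forall n v, norm1 (back a n p v) <= C * th ^ n * norm1 v.
Hypotheses (K_pos : 0 < K) (strips : forall n d, 0 < d -> strip a n d <= K * d).

Let a_lt : a < 1 / 2.
Proof. lra. Qed.

(** With K0 = K1 = 0 every earlier time counts as late, so contraction alone protects the itinerary
    and displacements in all directions are allowed. *)
Let bad (n : nat) (e : R) : set2 := exits a C th 0 0 1 n (2 * e).

Lemma bad_area : exists M, 0 < M /\ forall n e, 0 < e -> area (fun p => corner p /\ bad n e p) <= M * e.
Proof.
set (t := th ^ 0 / (1 - th)).
assert (t_pos : 0 < t) by (apply Rdiv_lt_0_compat; simpl; lra).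
exists (32 * C + 16 * (K * (C * t))). split.
{ assert (0 < C * t) by nra. assert (0 < K * (C * t)) by nra. lra. }
intros n e he. eapply Rle_trans; [apply exits_area; lra|].
pose proof (strip_step a C th a_pos a_le C_pos th_bd n K ltac:(lra) (fun j _ x hx => strips j x hx)
  0 0 1 ltac:(lra) (2 * e) ltac:(lra)) as st.
assert (tl : forall c, 0 <= c -> lsum (fun j => late_term th c 0 (n - j)) (seq 0 n) <= c * t).
{ intros c hc. eapply Rle_trans; [now apply tail_sum_le|]. fold t. apply Rmult_le_compat_l; [easy|].
  assert (0 < th ^ (n - 0)) by (apply pow_lt; lra). nra. }
pose proof (tl (4 * C) ltac:(lra)) as t1. pose proof (tl (C * (2 * 1 + 2)) ltac:(lra)) as t2.
assert (0 < K * (2 * e)) by nra.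
apply Rmult_le_compat_l with (r := K * (2 * e)) in t1; [|lra].
apply Rmult_le_compat_l with (r := K * (2 * e)) in t2; [|lra].
rewrite Rmult_plus_distr_l in st. lra.
Qed.

Lemma good_box (n : nat) (e : R) (p v : R * R) : 0 < e -> corner p -> ~ bad n e p ->
  Rabs (fst v) <= e -> Rabs (snd v) <= e ->
  corner (vadd p (winv a (itin a n p) v)) /\ itin a n (vadd p (winv a (itin a n p) v)) = itin a n p.
Proof.
intros he hp hb h1 h2. unfold bad in hb.
assert (hv : norm1 v <= 2 * e * (2 * 1 + 2)) by (unfold norm1; lra).
split; [apply (stay_corner a C th a_pos a_le C_pos th_bd contr 0 0 1 n (2 * e)); easy || lra|].
apply same_itin; [lra|]. intros j hj. apply same_plus.
apply (late_letter a C th a_pos a_le C_pos th_bd contr 0 0 1 n j (2 * e)); easy || lra || lia.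
Qed.

(** If the cylinder contains a good point, its part in [corner] has area at least 4e^2 / d^n, while
    the part sent into [A] has area at most |A| / d^n: the power of d cancels. *)
Lemma good_cylinder (n : nat) (e : R) (w : list bool) (A : set2) : 0 < e -> meas A ->
  area (fun p => itin a n p = w /\ ((corner p /\ A (iterG a n p)) /\ ~ bad n e p)) <=
    area A / (4 * e ^ 2) * area (fun p => itin a n p = w /\ corner p).
Proof.
intros he mA.
assert (mb : meas (bad n e)) by apply meas_exits.
assert (mE : meas (fun p => itin a n p = w /\ ((corner p /\ A (iterG a n p)) /\ ~ bad n e p))).
{ apply meas_and; [apply meas_itin|]. apply meas_and; [|now apply meas_compl].
  apply meas_and; [apply meas_corner|now apply meas_iterG]. }
assert (mC : meas (fun p => itin a n p = w /\ corner p)).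
{ apply meas_and; [apply meas_itin|apply meas_corner]. }
destruct (classic (exists p, itin a n p = w /\ ((corner p /\ A (iterG a n p)) /\ ~ bad n e p))) as [[p [hw [[hp _] hb]]]|h].
- destruct (inner_box a a_pos a_lt e n p he) as [mB aB].
  { intros v h1 h2. destruct (good_box n e p v he hp hb h1 h2) as [h3 h4]. split; [now apply corner_sq|easy]. }
  assert (low : 4 * e ^ 2 / det a ^ n <= area (fun p => itin a n p = w /\ corner p)).
  { rewrite <- aB. apply area_mono; [exact mB|exact mC|]. intros q _ [v [h1 [h2 ->]]].
    destruct (good_box n e p v he hp hb h1 h2) as [h3 h4]. split; [congruence|easy]. }
  apply Rle_trans with (area A / det a ^ n).
  + eapply Rle_trans; [|apply (cylinder_image a a_pos a_lt n w A mA)]. apply area_mono; [exact mE| |].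
    * apply meas_and; [apply meas_and; [apply meas_sq|apply meas_itin]|now apply meas_iterG].
    * intros q _ [h1 [[h2 h3] _]]. split; [split; [now apply corner_sq|easy]|easy].
  + assert (h0 : 0 <= area A / (4 * e ^ 2)).
    { apply Rmult_le_pos; [apply area_ge0|]. apply Rlt_le, Rinv_0_lt_compat. nra. }
    apply Rmult_le_compat_l with (r := area A / (4 * e ^ 2)) in low; [|easy].
    replace (area A / (4 * e ^ 2) * (4 * e ^ 2 / det a ^ n)) with (area A / det a ^ n) in low; [easy|].
    pose proof (det_pow_pos a a_pos a_lt n). field. lra.
- rewrite (area_empty _ mE); [|intros p hp; apply h; now exists p].
  apply Rmult_le_pos; [|apply area_ge0]. apply Rmult_le_pos; [apply area_ge0|].
  apply Rlt_le, Rinv_0_lt_compat. nra.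
Qed.

Theorem uniformly_absolutely_continuous : exists M, 0 < M /\ forall n e A, 0 < e -> meas A ->
  area (fun p => corner p /\ A (iterG a n p)) <= M * e + area A / (4 * e ^ 2).
Proof.
destruct bad_area as [M [M_pos hM]]. exists M. split; [easy|]. intros n e A he mA.
assert (mb : meas (bad n e)) by apply meas_exits.
assert (mX : meas (fun p => corner p /\ A (iterG a n p))).
{ apply meas_and; [apply meas_corner|now apply meas_iterG]. }
assert (mXB : meas (fun p => corner p /\ bad n e p)) by (apply meas_and; [apply meas_corner|easy]).
assert (mG : meas (fun p => (corner p /\ A (iterG a n p)) /\ ~ bad n e p)).
{ apply meas_and; [easy|now apply meas_compl]. }
apply Rle_trans with (area (fun p => (corner p /\ bad n e p) \/ ((corner p /\ A (iterG a n p)) /\ ~ bad n e p))).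
{ apply area_mono; [easy|now apply meas_or|]. intros p _ h. destruct (classic (bad n e p)); tauto. }
eapply Rle_trans; [now apply area_or_le|]. apply Rplus_le_compat; [now apply hM|].
rewrite <- (area_by_words a n _ mG).
eapply Rle_trans; [apply lsum_le; intros w _; now apply good_cylinder|].
rewrite lsum_scal, (area_by_words a n _ meas_corner).
rewrite <- (Rmult_1_r (area A / (4 * e ^ 2))) at 2. apply Rmult_le_compat_l; [|apply area_le1, meas_corner].
apply Rmult_le_pos; [apply area_ge0|]. apply Rlt_le, Rinv_0_lt_compat. nra.
Qed.

End Uniform.

(** * The invariant measure *)

(** The tails of a disjoint union have areas tending to 0; smallness on sets of small area then
    turns finite additivity into countable additivity. *)
Lemma sigma_additive (nu : set2 -> R) :
  (forall A B, meas A -> meas B -> (forall p, A p <-> B p) -> nu A = nu B) ->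
  (forall A, meas A -> 0 <= nu A) ->
  (forall A B, meas A -> meas B -> (forall p, A p -> B p -> False) -> nu (fun p => A p \/ B p) = nu A + nu B) ->
  (forall e, 0 < e -> exists d, 0 < d /\ forall A, meas A -> area A < d -> nu A < e) ->
  forall F : nat -> set2, (forall n, meas (F n)) ->
  (forall m n p, m <> n -> F m p -> F n p -> False) ->
  infinite_sum (fun n => nu (F n)) (nu (fun p => exists n, F n p)).
Proof.
intros next npos nadd ncont F mF dF.
set (low := fun N p => exists k, (k <= N)%nat /\ F k p).
set (high := fun N p => exists k, (N < k)%nat /\ F k p).
assert (mlow : forall N, meas (low N)).
{ intros N. apply meas_ex. intros k. apply meas_and; [apply meas_const|apply mF]. }
assert (mhigh : forall N, meas (high N)).
{ intros N. apply meas_ex. intros k. apply meas_and; [apply meas_const|apply mF]. }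
assert (mall : meas (fun p => exists n, F n p)) by (now apply meas_ex).
assert (split : forall f : set2 -> R,
  (forall A B, meas A -> meas B -> (forall p, A p <-> B p) -> f A = f B) ->
  (forall A B, meas A -> meas B -> (forall p, A p -> B p -> False) -> f (fun p => A p \/ B p) = f A + f B) ->
  forall N, f (fun p => exists n, F n p) = sum_f_R0 (fun n => f (F n)) N + f (high N)).
{ intros f fext fadd N.
  assert (hlow : sum_f_R0 (fun n => f (F n)) N = f (low N)).
  { induction N as [|N IH].
    - simpl. apply fext; [easy|easy|]. intros p; split.
      + intros h. exists 0%nat. now split.
      + intros [k [h1 h2]]. now replace 0%nat with k by lia.
    - simpl. rewrite IH, <- fadd; [|easy|easy|].
      + apply fext; [now apply meas_or|easy|]. intros p; split.
        * intros [[k [h1 h2]]|h]; [exists k; split; [lia|easy]|exists (S N); now split].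
        * intros [k [h1 h2]]. destruct (Nat.eq_dec k (S N)) as [->|]; [now right|].
          left. exists k. split; [lia|easy].
      + intros p [k [h1 h2]] h3. apply (dF k (S N) p); [lia|easy|easy]. }
  rewrite hlow, <- fadd; [|easy|easy|].
  - apply fext; [easy|now apply meas_or|]. intros p; split.
    + intros [k h]. destruct (Nat.le_gt_cases k N); [left|right]; now exists k.
    + intros [[k [_ h]]|[k [_ h]]]; now exists k.
  - intros p [k [h1 h2]] [l [h3 h4]]. apply (dF k l p); [lia|easy|easy]. }
intros e he. destruct (ncont e he) as [d [hd H]].
destruct (area_sigma F mF dF d hd) as [N HN]. exists N. intros n hn. specialize (HN n hn).
unfold Rdist in *.
rewrite (split area) with (N := n) in HN.
- rewrite (split nu next nadd n).
  pose proof (npos _ (mhigh n)) as p0. pose proof (area_ge0 (high n)) as a0.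
  replace (sum_f_R0 (fun k => area (F k)) n - (sum_f_R0 (fun k => area (F k)) n + area (high n)))
    with (- area (high n)) in HN by ring.
  replace (sum_f_R0 (fun k => nu (F k)) n - (sum_f_R0 (fun k => nu (F k)) n + nu (high n)))
    with (- nu (high n)) by ring.
  rewrite Rabs_Ropp, Rabs_pos_eq in * by easy. now apply H.
- intros A B hA hB h. apply area_ext; [easy|easy|]. intros p _; apply h.
- intros A B hA hB h. now apply area_or.
Qed.

Section Mean.
Variable LIM : (nat -> R) -> R.
Hypothesis LIM_add : forall u v M, (forall n, Rabs (u n) <= M) -> (forall n, Rabs (v n) <= M) ->
  LIM (fun n => u n + v n) = LIM u + LIM v.
Hypothesis LIM_bound : forall u x y, (forall n, x <= u n <= y) -> x <= LIM u <= y.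
Hypothesis LIM_eq : forall u v M, (forall n, Rabs (u n) <= M) -> (forall n, Rabs (v n) <= M) ->
  Un_cv (fun n => u n - v n) 0 -> LIM u = LIM v.

Definition cesaro (u : nat -> R) (N : nat) : R := sum_f_R0 u N / INR (S N).

Lemma cesaro_bound (u : nat -> R) (x y : R) (N : nat) : (forall n, x <= u n <= y) -> x <= cesaro u N <= y.
Proof.
intros H. assert (hN : 0 < INR (S N)) by (apply lt_0_INR; lia).
assert (h : x * INR (S N) <= sum_f_R0 u N <= y * INR (S N)).
{ clear hN. induction N as [|N IH]; [simpl; specialize (H 0%nat); lra|].
  rewrite S_INR. simpl sum_f_R0. specialize (H (S N)). lra. }
unfold cesaro. split; apply Rmult_le_reg_r with (INR (S N)); try easy;
  unfold Rdiv; rewrite Rmult_assoc, Rinv_l, Rmult_1_r by lra; lra.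
Qed.

Lemma cesaro_ext (u v : nat -> R) (N : nat) : (forall n, u n = v n) -> cesaro u N = cesaro v N.
Proof. intros H. unfold cesaro. now rewrite (sum_eq u v N) by auto. Qed.

Lemma cesaro_add (u v : nat -> R) (N : nat) : cesaro (fun n => u n + v n) N = cesaro u N + cesaro v N.
Proof. unfold cesaro. rewrite plus_sum. unfold Rdiv. ring. Qed.

Lemma LIM_ext (u v : nat -> R) : (forall n, 0 <= u n <= 1) -> (forall n, u n = v n) -> LIM u = LIM v.
Proof.
intros hu h. apply (LIM_eq u v 1).
- intros n. specialize (hu n). rewrite Rabs_pos_eq; lra.
- intros n. rewrite <- h. specialize (hu n). rewrite Rabs_pos_eq; lra.
- intros e he. exists 0%nat. intros n _. unfold Rdist. rewrite h.
  replace (v n - v n - 0) with 0 by ring. now rewrite Rabs_R0.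
Qed.

(** The two sums differ by two terms only, which the division by n + 1 makes negligible; invariance
    of [mu] comes from here. *)
Lemma cesaro_shift (u : nat -> R) : (forall n, 0 <= u n <= 1) ->
  LIM (cesaro (fun n => u (S n))) = LIM (cesaro u).
Proof.
intros hu. apply (LIM_eq _ _ 1).
- intros n. pose proof (cesaro_bound (fun n => u (S n)) 0 1 n (fun k => hu (S k))). rewrite Rabs_pos_eq; lra.
- intros n. pose proof (cesaro_bound u 0 1 n hu). rewrite Rabs_pos_eq; lra.
- intros e he. destruct (archimed_cor1 e he) as [N [hN hN0]]. exists N. intros n hn.
  unfold Rdist, cesaro. rewrite Rminus_0_r.
  assert (tele : sum_f_R0 (fun k => u (S k)) n - sum_f_R0 u n = u (S n) - u 0%nat).
  { clear. induction n as [|n IH]; [easy|]. cbn [sum_f_R0]. lra. }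
  assert (hSn : 0 < INR (S n)) by (apply lt_0_INR; lia).
  replace (sum_f_R0 (fun k => u (S k)) n / INR (S n) - sum_f_R0 u n / INR (S n)) with
    ((u (S n) - u 0%nat) * / INR (S n)) by (rewrite <- tele; field; lra).
  rewrite Rabs_mult, (Rabs_pos_eq (/ INR (S n))) by (now apply Rlt_le, Rinv_0_lt_compat).
  assert (hd : Rabs (u (S n) - u 0%nat) <= 1).
  { apply Rabs_le. pose proof (hu (S n)). pose proof (hu 0%nat). lra. }
  apply Rle_lt_trans with (1 * / INR N); [|lra].
  apply Rmult_le_compat; [apply Rabs_pos|now apply Rlt_le, Rinv_0_lt_compat|easy|].
  apply Rinv_le_contravar; [now apply lt_0_INR|]. apply le_INR. lia.
Qed.

Variables a M : R.
Hypotheses (a_pos : 0 < a) (a_lt : a < 1 / 2) (M_pos : 0 < M).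
Hypothesis unif : forall n e A, 0 < e -> meas A ->
  area (fun p => corner p /\ A (iterG a n p)) <= M * e + area A / (4 * e ^ 2).

(** The factor 100 normalises the area 1/100 of [corner]. *)
Definition push (A : set2) (n : nat) : R := 100 * area (fun p => corner p /\ A (iterG a n p)).
Definition mu (A : set2) : R := LIM (cesaro (push A)).

Lemma meas_push (A : set2) (n : nat) : meas A -> meas (fun p => corner p /\ A (iterG a n p)).
Proof. intros h. apply meas_and; [apply meas_corner|now apply meas_iterG]. Qed.

Lemma corner_area : area corner = 1 / 100.
Proof. unfold corner. rewrite area_rect; lra. Qed.

Lemma push_bound (A : set2) (n : nat) : meas A -> 0 <= push A n <= 1.
Proof.
intros h. unfold push. pose proof (area_ge0 (fun p => corner p /\ A (iterG a n p))).
assert (area (fun p => corner p /\ A (iterG a n p)) <= 1 / 100); [|lra].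
rewrite <- corner_area. apply area_mono; [now apply meas_push|apply meas_corner|now intros p _ [h1 _]].
Qed.

(** Orbits of points of the square stay in it, so only the trace of a set on the square matters. *)
Lemma push_ext (A B : set2) (n : nat) : meas A -> meas B -> (forall p, unit_square p -> (A p <-> B p)) ->
  push A n = push B n.
Proof.
intros hA hB h. unfold push. f_equal. apply area_ext; [now apply meas_push|now apply meas_push|].
intros p hp. assert (hs : unit_square (iterG a n p)).
{ clear hA hB h. revert p hp; induction n as [|n IH]; intros p hp; [easy|]. now apply IH, G_square. }
now rewrite (h _ hs).
Qed.

Lemma mu_ext (A B : set2) : meas A -> meas B -> (forall p, unit_square p -> (A p <-> B p)) -> mu A = mu B.
Proof.
intros hA hB h. apply LIM_ext.
- intros n. apply cesaro_bound. intros k. now apply push_bound.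
- intros n. apply cesaro_ext. intros k. now apply push_ext.
Qed.

Lemma mu_full (A : set2) : meas A -> (forall p, unit_square p -> A p) -> mu A = 1.
Proof.
intros hA h. rewrite (mu_ext A (fun _ => True)); [|easy|apply meas_const|intros p hp; split; auto].
assert (H : 1 <= mu (fun _ => True) <= 1); [|lra].
apply LIM_bound. intros n. apply cesaro_bound. intros k. unfold push.
rewrite (area_ext _ corner); [rewrite corner_area; lra| |apply meas_corner|tauto].
exact (meas_push (fun _ => True) k (meas_const True)).
Qed.

Lemma mu_ge0 (A : set2) : meas A -> 0 <= mu A.
Proof.
intros hA. refine (proj1 (LIM_bound (cesaro (push A)) 0 1 _)).
intros n. apply cesaro_bound. intros k. now apply push_bound.
Qed.

Lemma mu_add (A B : set2) : meas A -> meas B -> (forall p, A p -> B p -> False) ->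
  mu (fun p => A p \/ B p) = mu A + mu B.
Proof.
intros hA hB h.
assert (bd : forall S, meas S -> forall n, Rabs (cesaro (push S) n) <= 1).
{ intros S hS n. pose proof (cesaro_bound (push S) 0 1 n (fun k => push_bound S k hS)). rewrite Rabs_pos_eq; lra. }
unfold mu. rewrite <- (LIM_add _ _ 1) by auto. apply LIM_ext.
- intros n. apply cesaro_bound. intros k. now apply push_bound, meas_or.
- intros n. rewrite <- cesaro_add. apply cesaro_ext. intros k. unfold push.
  rewrite <- Rmult_plus_distr_l, <- area_or; [|now apply meas_push|now apply meas_push|].
  + f_equal. apply area_ext; [exact (meas_push _ k (meas_or A B hA hB))| |tauto].
    apply meas_or; now apply meas_push.
  + intros p [_ h1] [_ h2]. now apply (h (iterG a k p)).
Qed.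

Lemma mu_cont (e : R) : 0 < e -> exists d, 0 < d /\ forall A, meas A -> area A < d -> mu A < e.
Proof.
(* With the factor 100, each of the two terms of [unif] is at most e/4; the total e/2 leaves room
   for the limit, which preserves only weak inequalities. *)
intros he. set (f := e / (400 * M)). assert (hf : 0 < f) by (apply Rdiv_lt_0_compat; lra).
exists (e * f ^ 2 / 100). assert (0 < f ^ 2) by nra. split; [apply Rdiv_lt_0_compat; nra|]. intros A hA hd.
assert (b : 0 <= mu A <= e / 2); [|lra].
apply LIM_bound. intros n. apply cesaro_bound. intros k. split; [now apply push_bound|].
unfold push. pose proof (unif k f A hf hA) as u.
assert (M * f = e / 400) by (unfold f; field; lra).
assert (area A / (4 * f ^ 2) <= e / 400); [|lra].
apply Rmult_le_reg_r with (4 * f ^ 2); [lra|].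
replace (area A / (4 * f ^ 2) * (4 * f ^ 2)) with (area A) by (field; lra). lra.
Qed.

Lemma mu_invariant (A : set2) : meas A -> mu (fun p => unit_square p /\ A (G a p)) = mu A.
Proof.
intros hA.
assert (hG : meas (fun p => A (G a p))) by (now apply meas_G).
rewrite (mu_ext _ (fun p => A (G a p))); [|apply meas_and; [apply meas_sq|easy]|easy|tauto].
unfold mu. rewrite <- (cesaro_shift (push A)) by (intros n; now apply push_bound).
apply LIM_ext.
- intros n. apply cesaro_bound. intros k. now apply push_bound.
- intros n. apply cesaro_ext. intros k. unfold push. f_equal.
  apply area_ext; [exact (meas_push _ k hG)|now apply meas_push|].
  intros p _. now rewrite <- iterG_succ.
Qed.

Lemma has_acip_of_uniform : has_acip (G a).
Proof.
exists mu. split; [split; [|split; [|split]]|split].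
- intros A hA. now apply mu_ge0, borel_meas.
- intros F hF dF. apply sigma_additive; [|apply mu_ge0|apply mu_add|apply mu_cont| |easy].
  + intros A B hA hB h. now apply mu_ext.
  + intros n. now apply borel_meas.
- apply mu_full; [apply meas_const|easy].
- apply mu_full; [apply meas_sq|easy].
- intros A hA nA. apply borel_meas in hA. pose proof (mu_ge0 A hA).
  apply Rle_antisym; [|easy]. apply le_epsilon. intros e he. rewrite Rplus_0_l.
  destruct (mu_cont e he) as [d [hd H']]. apply Rlt_le, H'; [easy|]. now rewrite area_null.
- intros A hA. now apply mu_invariant, borel_meas.
Qed.

End Mean.

Theorem theorem4 (alpha : R) (h0 : 0 < alpha) (h1 : alpha <= 46 / 100) :
  has_acip (G alpha).
Proof.
destruct (Expansion.contraction alpha h0 h1) as [C [th [C_pos [th_bd contr]]]].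
destruct (strip_bound alpha C th h0 h1 C_pos th_bd contr) as [K [K_pos hK]].
destruct (uniformly_absolutely_continuous alpha C th K h0 h1 C_pos th_bd contr K_pos hK) as [M [M_pos hM]].
destruct generalized_limit as [LIM [L1 [L2 L3]]].
apply (has_acip_of_uniform LIM L1 L2 L3 alpha M); [easy|lra|easy|easy].
Qed.
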